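(* Let $(b,\mathbf B,m,\mu)$ be an admissible parameter set (defined in the context). Then for every $d\in\mathbb N$, $T>0$ and $u\in\mathcal H^+$ there exists a unique solution $(\phi_d(\cdot,\mathbf P_d(u)),\psi_d(\cdot,\mathbf P_d(u)))$, with $\phi_d(\cdot,\mathbf P_d(u))\in C^1([0,T],\mathbb R)$ and $\psi_d(\cdot,\mathbf P_d(u))\in C^1([0,T],\mathcal H_d^+)$, of the Galerkin system $$\partial_t\phi_d=F(\psi_d),\ \ \phi_d(0)=0,\qquad\partial_t\psi_d=L\psi_d+\mathbf P_d\hat R(\psi_d),\ \ \psi_d(0)=\mathbf P_d(u).$$ Moreover, $\phi_d(\cdot,\mathbf P_d(u))$ and $\psi_d(\cdot,\mathbf P_d(u))$ converge uniformly on $[0,T]$ to $\phi(\cdot,u)\in C^1([0,T],\mathbb R)$ and $\psi(\cdot,u)\in C([0,T],\mathcal H^+)$, the unique mild solution of the limiting Riccati system, i.e. the unique pair satisfying $$\psi(t,u)=\mathcal T(t)u+\int_0^t\mathcal T(t-s)\hat R(\psi(s,u))\,ds,\qquad\phi(t,u)=\int_0^tF(\psi(s,u))\,ds,\qquad t\in[0,T];$$ that is, $$\sup_{t\in[0,T]}\big(|\phi_d(t,\mathbf P_d(u))-\phi(t,u)|+\|\psi_d(t,\mathbf P_d(u))-\psi(t,u)\|\big)\to0,\qquad d\to\infty.$$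
   Context: **Spaces.** $V,H$ are separable real Hilbert spaces with $V\hookrightarrow H\hookrightarrow V^*$, where $V^*$ is the dual of $V$ with respect to the pivot space $H$. $\mathcal L(E,G)$, $\mathcal L_2(E,G)$ denote bounded and Hilbert--Schmidt operators. $\mathcal H$ is the real Hilbert space of self-adjoint operators in $\mathcal L_2(H,H)$ with $\langle A,C\rangle=\sum_n\langle Ae_n,Ce_n\rangle_H$ and norm $\|\cdot\|$; $\mathcal H^+\subset\mathcal H$ is the closed convex cone of positive operators. $\mathcal V=\mathcal L_2(V^*,H)\cap\mathcal L_2(H,V)$ with $\|x\|_{\mathcal V}^2=\|x\|_{\mathcal L_2(H,V)}^2+\|x\|_{\mathcal L_2(V^*,H)}^2$. $\chi(\xi)=\xi\mathbf 1_{\{\|\xi\|\le 1\}}$. Integrals without indicated domain are over $\mathcal H^+\setminus\{0\}$. **Admissible parameter set.** $(b,\mathbf B,m,\mu)$ is admissible if: (i) $m$ is a Borel measure on $\mathcal H^+\setminus\{0\}$ with $\int\|\xi\|^2m(d\xi)<\infty$, $\int|\langle\chi(\xi),h\rangle|m(d\xi)<\infty$ for all $h\in\mathcal H$, and there is $I_m\in\mathcal H$ with $\langle I_m,h\rangle=\int\langle\chi(\xi),h\rangle m(d\xi)$ for all $h\in\mathcal H$; (ii) $b\in\mathcal H$ and $\langle b,v\rangle-\int\langle\chi(\xi),v\rangle m(d\xi)\ge0$ for all $v\in\mathcal H^+$; (iii) $\mu$ is an $\mathcal H^+$-valued measure on $\mathcal B(\mathcal H^+\setminus\{0\})$ with $\mu(\mathcal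 H^+\setminus\{0\})\in\mathcal H^+$ such that $\int\langle\chi(\xi),u\rangle\|\xi\|^{-2}\langle x,\mu(d\xi)\rangle<\infty$ for all $u,x\in\mathcal H^+$ with $\langle u,x\rangle=0$; (iv) $\mathbf B\in\mathcal L(\mathcal V,\mathcal V^* )$ has the form $\mathbf B(x)=Bx+xB^*+\Gamma(x)$ ($\mathcal H$ identified with a subspace of $\mathcal V^*$ via $h\mapsto\langle h,\cdot\rangle$), where (a) $B$ is a self-adjoint non-positive operator on $H$, $B\in\mathcal L(V,V^* )$, with an orthonormal basis $(e_i)_{i\in\mathbb N}$ of $H$ such that $Be_i=-\lambda_ie_i$, $0\le\lambda_1\le\lambda_2\le\cdots\to\infty$, and domain $\{h:\sum_i\lambda_i^2|\langle h,e_i\rangle_H|^2<\infty\}$; (b) $\Gamma:\mathcal H\to\mathcal H$ is bounded linear, $\Gamma(\mathcal H^+)\subseteq\mathcal H^+$, and $\langle\Gamma(x),u\rangle-\int\langle\chi(\xi),u\rangle\|\xi\|^{-2}\langle\mu(d\xi),x\rangle\ge0$ for all $x,u\in\mathcal H^+$ with $\langle u,x\rangle=0$; (c) there are $\alpha_0,\alpha_1>0$, $\kappa\ge0$ with $\alpha_0\|u\|_V^2\le-2\langle Bu,u\rangle_{V^*,V}+\kappa\|u\|_H^2\le\alpha_1\|u\|_V^2$ for all $u\in V$; moreover $e_i\in V$ for all $i$, their linear span is dense in $V$, and $\sum_i(1+\lambda_i)|\langle u,e_i\rangle_H|^2$ is equivalent to $\|u\|_V^2$ on $V$. **Lyapunov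 operator, coefficients, projections.** With $(x\otimes y)h=\langle x,h\rangle_Hy$, put $\mathbf e_{i,i}=e_i\otimes e_i$, $\mathbf e_{i,j}=\frac1{\sqrt2}(e_i\otimes e_j+e_j\otimes e_i)$ for $i<j$; $(\mathbf e_{i,j})_{i\le j}$ is an orthonormal basis of $\mathcal H$. With $\lambda_{i,j}=\lambda_i+\lambda_j$, $Lx=-\sum_{i\le j}\lambda_{i,j}\langle x,\mathbf e_{i,j}\rangle\mathbf e_{i,j}$ on $\mathrm{dom}(L)=\{x\in\mathcal H:\sum_{i\le j}\lambda_{i,j}^2\langle x,\mathbf e_{i,j}\rangle^2<\infty\}$; it generates the $C_0$-semigroup $\mathcal T(t)\mathbf e_{i,j}=e^{-\lambda_{i,j}t}\mathbf e_{i,j}$ on $\mathcal H$. For $u\in\mathcal H^+$, $F(u)=\langle b,u\rangle-\int(e^{-\langle\xi,u\rangle}-1+\langle\chi(\xi),u\rangle)m(d\xi)$ and $\hat R(u)=\Gamma^*(u)-\int(e^{-\langle\xi,u\rangle}-1+\langle\chi(\xi),u\rangle)\|\xi\|^{-2}\mu(d\xi)$. $\mathcal H_d=\mathrm{span}\{\mathbf e_{i,j}:1\le i\le j\le d\}$, $\mathcal H_d^+=\mathcal H_d\cap\mathcal H^+$, and $\mathbf P_d$ is the orthogonal projection of $\mathcal H$ onto $\mathcal H_d$. *)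

(* Defs.v *)
From HB Require Import structures.
From mathcomp Require Import all_boot all_order all_algebra.
From mathcomp Require Import ring lra.
From mathcomp Require Import all_classical all_reals all_analysis.

Set Implicit Arguments.
Unset Strict Implicit.
Unset Printing Implicit Defensive.

Import Order.TTheory GRing.Theory Num.Theory.
Import numFieldNormedType.Exports.

Local Open Scope classical_set_scope.
Local Open Scope ring_scope.

HB.mixin Record isInnerProduct (R : realType) E & NormedModule R E := {
  inner : E -> E -> R ;
  innerC : forall x y, inner x y = inner y x ;
  innerDl : forall x y z, inner (x + y) z = inner x z + inner y z ;
  innerZl : forall a x y, inner (a *: x) y = a * inner x y ;
  inner_norm : forall x, inner x x = `|x| ^+ 2 }.

#[short(type="innerType")]
HB.structure Definition InnerProduct (R : realType) :=
  {E of NormedModule R E & isInnerProduct R E}.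

#[short(type="hilbertType")]
HB.structure Definition Hilbert (R : realType) :=
  {E of InnerProduct R E & Complete E}.

Notation "⟨ x , y ⟩" := (inner x y) (at level 0, format "⟨ x ,  y ⟩").

Section inner_theory.
Context {R : realType} {E : innerType R}.
Implicit Types x y z : E.

Lemma innerDr x y z : ⟨x, y + z⟩ = ⟨x, y⟩ + ⟨x, z⟩.
Proof. by rewrite innerC innerDl !(innerC x). Qed.

Lemma innerZr a x y : ⟨x, a *: y⟩ = a * ⟨x, y⟩.
Proof. by rewrite innerC innerZl innerC. Qed.

Lemma inner0l y : ⟨(0 : E), y⟩ = 0.
Proof. by rewrite -(scale0r 0) innerZl mul0r. Qed.

Lemma inner0r x : ⟨x, (0 : E)⟩ = 0.
Proof. by rewrite innerC inner0l. Qed.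

Lemma inner_le x y : `|⟨x, y⟩| <= `|x| ^+ 2 + `|y| ^+ 2.
Proof.
have h0 z : 0 <= ⟨z, z⟩ by rewrite inner_norm sqr_ge0.
have := h0 (x + y); have := h0 (x + (- 1) *: y).
have := h0 x; have := h0 y.
rewrite -!inner_norm !(innerDl, innerDr, innerZl, innerZr) (innerC y x).
by move=> ? ? ? ?; rewrite ler_norml; apply/andP; split; lra.
Qed.

End inner_theory.

Section inner_norm_from_form.
Context {R : realType} {M : lmodType R} (f : M -> M -> R).
Context (fC : forall x y, f x y = f y x).
Context (fD : forall x y z, f (x + y) z = f x z + f y z).
Context (fZ : forall a x y, f (a *: x) y = a * f x y).
Context (f_ge0 : forall x, 0 <= f x x).

Lemma form_cauchy_schwarz x y : f x y ^+ 2 <= f x x * f y y.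
Proof.
have key a b : 0 <= a ^+ 2 * f x x + 2 * a * b * f x y + b ^+ 2 * f y y.
  have := f_ge0 (a *: x + b *: y).
  rewrite fD !fZ !(fC _ (_ + _)) !fD !fZ (fC y x); lra.
have [y0|yN0] := eqVneq (f y y) 0.
  have := key (f x y) (- (f x x + 1)); rewrite y0 mulr0 addr0.
  have := f_ge0 x; have := sqr_ge0 (f x y).
  set p := f x x; set q := f x y => q0 p0 h; nra.
have y0 : 0 < f y y by rewrite lt_neqAle eq_sym yN0 f_ge0.
have := key (f y y) (- f x y).
rewrite (_ : _ + _ = f y y * (f x x * f y y - f x y ^+ 2)); last by ring.
by rewrite pmulr_rge0 // subr_ge0.
Qed.

Lemma form_normD x y :
  Num.sqrt (f (x + y) (x + y)) <= Num.sqrt (f x x) + Num.sqrt (f y y).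
Proof.
rewrite -(ler_pXn2r (n := 2)) ?nnegrE ?addr_ge0 ?sqrtr_ge0 //.
rewrite sqrrD !sqr_sqrtr // fD !(fC _ (_ + _)) !fD (fC y x).
suff : f x y <= Num.sqrt (f x x) * Num.sqrt (f y y) by rewrite -mulr_natl; lra.
rewrite -sqrtrM // (le_trans (ler_norm _)) // -sqrtr_sqr.
by rewrite ler_wsqrtr // form_cauchy_schwarz.
Qed.

Lemma form_normZ a x : Num.sqrt (f (a *: x) (a *: x)) = `|a| * Num.sqrt (f x x).
Proof.
by rewrite fZ fC fZ mulrA -expr2 sqrtrM ?sqr_ge0 // sqrtr_sqr.
Qed.

End inner_norm_from_form.

Lemma inner_cauchy_schwarz {R : realType} {G : innerType R} (x y : G) :
  `|⟨x, y⟩| <= `|x| * `|y|.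
Proof.
rewrite -(ler_pXn2r (n := 2)) ?nnegrE ?mulr_ge0 // exprMn real_normK ?num_real //.
rewrite -!inner_norm; apply: form_cauchy_schwarz.
- exact: innerC.
- exact: innerDl.
- exact: innerZl.
- by move=> z; rewrite inner_norm sqr_ge0.
Qed.

Section real_series.
Context {R : realType}.
Implicit Types u v : R ^nat.

Lemma is_cvg_series_lincomb a b u v : cvgn (series u) -> cvgn (series v) ->
  cvgn (series (fun n => a * u n + b * v n)).
Proof.
by move=> cu cv; exact: is_cvg_seriesD (@is_cvg_seriesZ _ _ a cu)
  (@is_cvg_seriesZ _ _ b cv).
Qed.

Lemma lim_series_lincomb a b u v : cvgn (series u) -> cvgn (series v) ->
  limn (series (fun n => a * u n + b * v n)) =
  a * limn (series u) + b * limn (series v).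
Proof.
move=> cu cv; rewrite (_ : (fun n => _) = a *: u + b *: v) //.
rewrite lim_seriesD; last 2 first.
- exact: (@is_cvg_seriesZ _ _ a cu).
- exact: (@is_cvg_seriesZ _ _ b cv).
by rewrite (lim_seriesZ a cu) (lim_seriesZ b cv).
Qed.

Lemma nneg_series_le_lim u n : (forall n, 0 <= u n) -> cvgn (series u) ->
  series u n <= limn (series u).
Proof.
move=> u0 cu; apply: nondecreasing_cvgn_le => //.
exact: (@nondecreasing_series _ u xpredT 0).
Qed.

End real_series.
Arguments is_cvg_series_lincomb {R} a b {u v}.
Arguments lim_series_lincomb {R} a b {u v}.
Arguments nneg_series_le_lim {R u} n.

Section hilbert_schmidt.
Context {R : realType}.

Definition lin_span {E : lmodType R} (S : set E) : set E :=
  [set x | exists n (c : 'I_n -> R) (v : 'I_n -> E),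
    (forall i, S (v i)) /\ x = \sum_(i < n) c i *: v i].

Record onb (E : hilbertType R) := Onb {
  onb_seq :> nat -> E ;
  onb_orthonormal : forall i j, ⟨onb_seq i, onb_seq j⟩ = (i == j)%:R ;
  onb_total : dense (lin_span (range onb_seq)) }.

(* The sum of the series does not depend on the orthonormal basis e. *)
Definition hilbert_schmidt {E G : hilbertType R} (e : onb E) (A : E -> G) :=
  [/\ linear A, continuous A & cvgn (series (fun n => `|A (e n)| ^+ 2))].

Definition selfadjoint_hs {E : hilbertType R} (e : onb E) : {pred E -> E} :=
  mem [set A | hilbert_schmidt e A /\ forall x y, ⟨A x, y⟩ = ⟨x, A y⟩].

(* The space of self-adjoint Hilbert-Schmidt operators on E. Its inner product
   is \sum_n <A (e n), C (e n)>; e appears in the type only because it is used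
   to compute this basis-independent quantity. *)
Record HS {E : hilbertType R} (e : onb E) : Type := MkHS {
  hs_fun :> E -> E ;
  hs_funP : hs_fun \in selfadjoint_hs e }.

End hilbert_schmidt.

Section HS_lmodType.
Context {R : realType} {E : hilbertType R} (e : onb E).

HB.instance Definition _ := [isSub for @hs_fun _ _ e].
HB.instance Definition _ := [Choice of HS e by <:].

Lemma selfadjoint_hs_submod : submod_closed (selfadjoint_hs e).
Proof.
split.
  apply/mem_set; split; last by move=> x y; rewrite inner0l inner0r.
  split; first by move=> a x y; rewrite /= scaler0 addr0.
    by move=> x; exact: cvg_cst.
  rewrite (_ : (fun n => _) = fun=> 0); last first.
    by apply/funext => n; rewrite normr0 expr0n.
  rewrite (_ : series _ = fun=> 0); first exact: is_cvg_cst.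
  by apply/funext => n; rewrite /series /= big1.
move=> a A C /set_mem[[lA cA sA] aA] /set_mem[[lC cC sC] aC].
have DE z : (a *: A + C) z = a *: A z + C z by [].
apply/mem_set; split; last first.
  by move=> x y; rewrite !DE innerDl innerDr innerZl innerZr aA aC.
split.
- move=> b x y; rewrite !DE lA lC !scalerDr !scalerA (mulrC a b) -!addrA.
  by congr (_ + _); rewrite addrCA.
- by move=> x; apply: cvgD; [apply: cvgZr; exact: cA|exact: cC].
- have := is_cvg_series_lincomb (2 * a ^+ 2) 2 sA sC.
  apply: series_le_cvg => n; first exact: sqr_ge0.
    by apply: addr_ge0; rewrite mulr_ge0 ?sqr_ge0 // mulr_ge0 ?sqr_ge0.
  rewrite DE (le_trans (y := (`|a| * `|A (e n)| + `|C (e n)|) ^+ 2)) //.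
    rewrite lerXn2r ?nnegrE ?addr_ge0 ?mulr_ge0 // -normrZ.
    exact: ler_normD.
  rewrite -(real_normK (num_real a)).
  set p := `|a|; set q := `|A (e n)|; set r := `|C (e n)|.
  have := sqr_ge0 (p * q - r); nra.
Qed.

HB.instance Definition _ :=
  GRing.isSubmodClosed.Build _ _ (selfadjoint_hs e) selfadjoint_hs_submod.
HB.instance Definition _ := [SubChoice_isSubLmodule of HS e by <:].

Definition hs_inner (A C : HS e) : R :=
  limn (series (fun n => ⟨A (e n), C (e n)⟩)).


Lemma hs_is_cvg (A C : HS e) : cvgn (series (fun n => ⟨A (e n), C (e n)⟩)).
Proof.
have [[_ _ sA] _] := set_mem (hs_funP A).
have [[_ _ sC] _] := set_mem (hs_funP C).
apply: normed_cvg.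
have := is_cvg_series_lincomb 1 1 sA sC.
apply: series_le_cvg => n; first exact: normr_ge0.
  by rewrite !mul1r addr_ge0 ?sqr_ge0.
by rewrite !mul1r; exact: inner_le.
Qed.

Arguments hs_is_cvg : clear implicits.

Lemma hs_innerC A C : hs_inner A C = hs_inner C A.
Proof.
by rewrite /hs_inner; congr (limn (series _)); apply/funext => n; exact: innerC.
Qed.

Lemma hs_innerDl A B C : hs_inner (A + B) C = hs_inner A C + hs_inner B C.
Proof.
have := lim_series_lincomb 1 1 (hs_is_cvg A C) (hs_is_cvg B C).
rewrite !mul1r => <-.
congr (limn (series _)); apply/funext => n.
by rewrite !mul1r -innerDl.
Qed.

Lemma hs_innerZl a A C : hs_inner (a *: A) C = a * hs_inner A C.
Proof.
have := lim_series_lincomb a 0 (hs_is_cvg A C) (hs_is_cvg A C).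
rewrite mul0r addr0 => <-.
congr (limn (series _)); apply/funext => n.
by rewrite mul0r addr0 -innerZl.
Qed.

Lemma hs_inner_ge0 A : 0 <= hs_inner A A.
Proof.
have ge0 n : 0 <= ⟨A (e n), A (e n)⟩ by rewrite inner_norm sqr_ge0.
have := nneg_series_le_lim 0 ge0 (hs_is_cvg A A).
by rewrite /series /= big_geq.
Qed.

Lemma onb_eq0 (x : E) : (forall n, ⟨x, e n⟩ = 0) -> x = 0.
Proof.
move=> xe; apply/eqP/negP => /negP x0.
have xs s : lin_span (range e) s -> ⟨x, s⟩ = 0.
  move=> [n [c [v [vP ->]]]].
  elim/big_ind : _ => [|a b|i _]; first exact: inner0r.
    by rewrite innerDr => -> ->; rewrite addr0.
  by have [k _ <-] := vP i; rewrite innerZr xe mulr0.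
have [] := onb_total e (O := ball x `|x|) _ (ball_open _ _).
- by exists x; apply: ballxx; rewrite normr_gt0.
- move=> s [/=]; rewrite -ball_normE /= => xs_lt /xs xs0.
  move: xs_lt; rewrite -(ltr_pXn2r (n := 2)) ?nnegrE // -!inner_norm.
  rewrite -(scaleN1r s) !(innerDl, innerDr, innerZl, innerZr) (innerC s) xs0.
  by have := sqr_ge0 `|s|; rewrite -inner_norm; lra.
Qed.

Lemma hs_inner_eq0 A : hs_inner A A = 0 -> A = 0.
Proof.
move=> A0; have [_ sA] := set_mem (hs_funP A).
have Ae n : A (e n) = 0.
  apply/eqP; rewrite -normr_eq0 -sqrf_eq0 -inner_norm eq_le.
  have ge0 k : 0 <= ⟨A (e k), A (e k)⟩ by rewrite inner_norm sqr_ge0.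
  rewrite ge0 andbT.
  have := nneg_series_le_lim n.+1 ge0 (hs_is_cvg A A).
  rewrite -/(hs_inner A A) A0 seriesSr; apply: le_trans.
  by rewrite lerDr /series /= sumr_ge0.
apply/val_inj/funext => x /=; apply: onb_eq0 => n.
by rewrite sA Ae inner0r.
Qed.

Lemma hs_norm_eq0 A : Num.sqrt (hs_inner A A) = 0 -> A = 0.
Proof.
move=> /eqP; rewrite sqrtr_eq0 => A0; apply: hs_inner_eq0.
by apply/eqP; rewrite eq_le A0 hs_inner_ge0.
Qed.

HB.instance Definition _ := @Lmodule_isNormed.Build R (HS e)
  (fun A => Num.sqrt (hs_inner A A))
  (form_normD hs_innerC hs_innerDl hs_innerZl hs_inner_ge0)
  (form_normZ hs_innerC hs_innerZl) hs_norm_eq0.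

Lemma hs_inner_norm (A : HS e) : hs_inner A A = `|A| ^+ 2.
Proof. by rewrite sqr_sqrtr // hs_inner_ge0. Qed.

HB.instance Definition _ := @isInnerProduct.Build R (HS e) hs_inner
  hs_innerC hs_innerDl hs_innerZl hs_inner_norm.

End HS_lmodType.
Section rank_two.
Context {R : realType} {E : hilbertType R} (e : onb E).
Implicit Types x y : E.

Definition tensor x y : E -> E := fun h => ⟨x, h⟩ *: y.

Lemma tensor_linear x y : linear (tensor x y).
Proof.
by move=> a h k; rewrite /tensor innerDr innerZr scalerDl scalerA.
Qed.

Lemma tensor_norm_le x y h :
  `|tensor x y h| <= (`|x| * `|y|) * `|h|.
Proof.
rewrite normrZ mulrAC ler_wpM2r //.
exact: inner_cauchy_schwarz.
Qed.

Lemma tensor_continuous x y : continuous (tensor x y).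
Proof.
move=> h; apply/cvgrPdist_le => eps eps0; near=> k.
have -> : tensor x y h - tensor x y k = tensor x y (h - k).
  rewrite /tensor -scalerBl -(scaleN1r k) innerDr innerZr.
  by rewrite mulN1r.
rewrite (le_trans (tensor_norm_le _ _ _)) //.
have c0 : 0 < `|x| * `|y| + 1 by rewrite ltr_wpDl ?mulr_ge0.
rewrite (le_trans (y := (`|x| * `|y| + 1) * `|h - k|)) //.
  by rewrite ler_wpM2r // lerDl.
rewrite -ler_pdivlMl //; near: k.
apply: cvgr_dist_le; first exact: cvg_id.
by rewrite mulr_gt0 ?invr_gt0.
Unshelve. all: by end_near. Qed.

Lemma bessel x n : \sum_(k < n) ⟨x, e k⟩ ^+ 2 <= `|x| ^+ 2.
Proof.
pose p := \sum_(k < n) ⟨x, e k⟩ *: e k.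
have sumr (z : E) (c : 'I_n -> R) :
    ⟨z, \sum_(k < n) c k *: e k⟩ = \sum_(k < n) c k * ⟨z, e k⟩.
  elim/big_rec2 : _ => [|k r w _ IH]; first exact: inner0r.
  by rewrite innerDr innerZr IH.
have xp : ⟨x, p⟩ = \sum_(k < n) ⟨x, e k⟩ ^+ 2 by rewrite sumr.
have pp : ⟨p, p⟩ = \sum_(k < n) ⟨x, e k⟩ ^+ 2.
  rewrite sumr; apply: eq_bigr => k _; rewrite expr2; congr (_ * _).
  rewrite innerC sumr (bigD1 k) //= onb_orthonormal eqxx mulr1 big1 ?addr0 //.
  move=> i ik; rewrite onb_orthonormal (_ : (_ == _) = false) ?mulr0 //.
  by apply/negbTE; rewrite eq_sym.
have := sqr_ge0 `|x + (-1) *: p|.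
rewrite -!inner_norm !(innerDl, innerDr, innerZl, innerZr) (innerC p x) xp pp.
lra.
Qed.

Lemma tensor_hs x y : hilbert_schmidt e (tensor x y).
Proof.
split; [exact: tensor_linear|exact: tensor_continuous|].
apply: nondecreasing_is_cvgn.
  by apply: (@nondecreasing_series _ _ xpredT 0) => n _ _; exact: sqr_ge0.
exists (`|x| ^+ 2 * `|y| ^+ 2) => _ [n _ <-].
rewrite /series /= big_mkord.
under eq_bigr do rewrite normrZ exprMn real_normK ?num_real //.
by rewrite -big_distrl ler_wpM2r ?sqr_ge0 // bessel.
Qed.

Lemma tensor_adj x y h k : ⟨tensor x y h, k⟩ = ⟨h, tensor y x k⟩.
Proof. by rewrite /tensor innerZl innerZr (innerC x) (innerC y) mulrC. Qed.

Lemma hilbert_schmidtD (A C : E -> E) :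
  hilbert_schmidt e A -> hilbert_schmidt e C ->
  hilbert_schmidt e (fun h => A h + C h).
Proof.
move=> [lA cA sA] [lC cC sC]; split.
- by move=> a x y; rewrite lA lC scalerDr -!addrA; congr (_ + _); rewrite addrCA.
- by move=> x; apply: cvgD; [exact: cA|exact: cC].
have := is_cvg_series_lincomb 2 2 sA sC.
apply: series_le_cvg => n; first exact: sqr_ge0.
  by apply: addr_ge0; rewrite mulr_ge0 ?sqr_ge0.
rewrite (le_trans (y := (`|A (e n)| + `|C (e n)|) ^+ 2)) //.
  by rewrite lerXn2r ?nnegrE ?addr_ge0 ?ler_normD.
set q := `|A (e n)|; set r := `|C (e n)|.
have := sqr_ge0 (q - r); nra.
Qed.

Lemma tensor_sq_subproof x : tensor x x \in selfadjoint_hs e.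
Proof. by apply/mem_set; split; [exact: tensor_hs|exact: tensor_adj]. Qed.

Lemma tensor_sym_subproof x y :
  (fun h => tensor x y h + tensor y x h) \in selfadjoint_hs e.
Proof.
apply/mem_set; split; first by apply: hilbert_schmidtD; exact: tensor_hs.
by move=> h k; rewrite innerDl innerDr !tensor_adj addrC.
Qed.

(* For i <= j these are the vectors of an orthonormal basis of HS e. *)
Definition ebasis (i j : nat) : HS e :=
  if i == j then MkHS (tensor_sq_subproof (e i))
  else (Num.sqrt 2)^-1 *: MkHS (tensor_sym_subproof (e i) (e j)).

End rank_two.

Section HS_complete.
Context {R : realType} {E : hilbertType R} (e : onb E).
Implicit Types (A C : HS e) (x y : E).

Lemma hs_linear A : linear A.
Proof. by have [[]] := set_mem (hs_funP A). Qed.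

Lemma hs_continuous A : continuous A.
Proof. by have [[]] := set_mem (hs_funP A). Qed.

Lemma hs_sym A x y : ⟨A x, y⟩ = ⟨x, A y⟩.
Proof. by have [_] := set_mem (hs_funP A). Qed.

Lemma hs_sum A n (c : 'I_n -> R) (v : 'I_n -> E) :
  A (\sum_(i < n) c i *: v i) = \sum_(i < n) c i *: A (v i).
Proof.
have A0 : A 0 = 0.
  by have := hs_linear A (-1) 0 0; rewrite scaleN1r oppr0 addr0 scaleN1r addNr.
elim/big_rec2 : _ => [//|i y1 y2 _ <-].
by rewrite hs_linear.
Qed.

Lemma sum_cauchy_schwarz n (a b : nat -> R) :
  (\sum_(k < n) a k * b k) ^+ 2 <=
  (\sum_(k < n) a k ^+ 2) * (\sum_(k < n) b k ^+ 2).
Proof.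
pose g (u v : nat -> R) := \sum_(k < n) u k * v k.
under [X in _ <= X * _]eq_bigr do rewrite expr2.
under [X in _ <= _ * X]eq_bigr do rewrite expr2.
apply: (@form_cauchy_schwarz _ _ g).
- by move=> u v; apply: eq_bigr => i _; rewrite mulrC.
- by move=> u v w; rewrite /g -big_split; apply: eq_bigr => i _; exact: mulrDl.
- by move=> r u v; rewrite /g big_distrr; apply: eq_bigr => i _; exact/esym/mulrA.
- by move=> u; apply: sumr_ge0 => i _; rewrite -expr2 sqr_ge0.
Qed.

Lemma span_expansion (s : E) : lin_span (range e) s ->
  exists n, s = \sum_(k < n) ⟨s, e k⟩ *: e k.
Proof.
move=> [n [c [v [vP sE]]]].
have [k kP] : {k : 'I_n -> nat & forall i, e (k i) = v i}.
  by apply: (@choice _ _ (fun i k => e k = v i)) => i; have [j _ <-] := vP i; exists j.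
have [N kN] : exists N, forall i, (k i < N)%N.
  by exists (\max_(i < n) k i).+1 => i; rewrite ltnS leq_bigmax.
exists N; pose p x := \sum_(j < N) ⟨x, e j⟩ *: e j.
have pD a x y : p (a *: x + y) = a *: p x + p y.
  rewrite /p scaler_sumr -big_split; apply: eq_bigr => j _.
  by rewrite innerDl innerZl scalerDl scalerA.
suff pv i : p (v i) = v i.
  rewrite -/(p s) sE; elim/big_rec : _ => [|i y _ yE].
    by rewrite /p big1 // => j _; rewrite inner0l scale0r.
  by rewrite pD -yE pv.
rewrite /p -(kP i) (bigD1 (Ordinal (kN i))) //= onb_orthonormal eqxx scale1r.
rewrite big1 ?addr0 // => j jk.
rewrite onb_orthonormal (_ : (_ == _) = false) ?scale0r //.
by apply/negbTE; move: jk; apply: contra => /eqP h; apply/eqP/val_inj.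
Qed.

Lemma hs_sum_le A n : \sum_(k < n) `|A (e k)| ^+ 2 <= `|A| ^+ 2.
Proof.
have ge0 k : 0 <= ⟨A (e k), A (e k)⟩ by rewrite inner_norm sqr_ge0.
have := nneg_series_le_lim n ge0 (@hs_is_cvg _ _ _ A A).
rewrite -/(hs_inner A A) hs_inner_norm /series /= big_mkord.
by apply: le_trans; apply: ler_sum => k _; rewrite inner_norm.
Qed.

Lemma hs_opnorm_le A x : `|A x| <= `|A| * `|x|.
Proof.
have span_le s : lin_span (range e) s -> `|A s| <= `|A| * `|s|.
  move=> /span_expansion[n sE].
  rewrite [in leLHS]sE hs_sum.
  rewrite (le_trans (ler_norm_sum _ _ _)) //.
  under eq_bigr do rewrite normrZ.
  rewrite -(ler_pXn2r (n := 2)) ?nnegrE ?mulr_ge0 //; last first.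
    by apply: sumr_ge0 => i _; rewrite mulr_ge0.
  rewrite (le_trans (sum_cauchy_schwarz _ (fun k => `|⟨s, e k⟩|) (fun k => `|A (e k)|))) //.
  rewrite exprMn mulrC ler_pM ?sumr_ge0 //=.
  - exact: hs_sum_le.
  - under eq_bigr do rewrite real_normK ?num_real //.
    exact: bessel.
apply: contrapT => /negP; rewrite -ltNge => xlt.
pose g y := `|A y| - `|A| * `|y|.
have cg : continuous g.
  move=> y; apply: cvgB.
    by apply: cvg_norm; exact: hs_continuous.
  by apply: cvgM; [exact: cvg_cst|exact: norm_continuous].
have [] := onb_total e (O := g @^-1` [set r | 0 < r]) _ _.
- by exists x; rewrite /= subr_gt0.
- by apply: open_comp; [move=> y _; exact: cg|exact: open_gt].
- by move=> s [/= gs /span_le]; move: gs; rewrite subr_gt0 ltNge => /negP.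
Qed.


Lemma inner_cvg {T} {F : set_system T} {FF : Filter F} {G : innerType R}
    (g : T -> G) (l y : G) :
  g @ F --> l -> (fun t => ⟨g t, y⟩) @ F --> ⟨l, y⟩.
Proof.
move=> gl; apply/cvgrPdist_le => eps eps0; near=> t.
have -> : ⟨l, y⟩ - ⟨g t, y⟩ = ⟨l - g t, y⟩.
  by rewrite -(scaleN1r (g t)) innerDl innerZl mulN1r.
rewrite (le_trans (inner_cauchy_schwarz _ _)) //.
have c0 : 0 < `|y| + 1 by rewrite ltr_wpDl.
rewrite (le_trans (y := `|l - g t| * (`|y| + 1))) //.
  by rewrite ler_wpM2l // lerDl.
rewrite -ler_pdivlMr //; near: t.
apply: cvgr_dist_le; first exact: gl.
by rewrite divr_gt0.
Unshelve. all: by end_near. Qed.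

Lemma cvg_le_cst {T} {F : set_system T} {FF : ProperFilter F} (g : T -> R)
    (l c : R) : g @ F --> l -> (\forall t \near F, g t <= c) -> l <= c.
Proof.
move=> gl gc; rewrite -(cvg_lim (@Rhausdorff R) gl).
by apply: limr_le => //; apply/cvg_ex; exists l.
Qed.

Lemma HS_cauchy_cvg (F : set_system (HS e)) :
  ProperFilter F -> cauchy F -> cvg F.
Proof.
move=> FF /cauchyP Fc.
have Fnear eps : 0 < eps -> exists A, \forall C \near F, `|A - C| < eps.
  move=> eps0; have [A FA] := Fc _ eps0.
  by exists A; move: FA; rewrite -ball_normE.
have HSB A C x : (A - C) x = A x - C x by [].
have Lex x : cvg ((fun A : HS e => A x) @ F).
  apply: cauchy_cvg; apply/cauchyP => eps eps0.
  have [|A FA] := Fnear (eps / (`|x| + 1)).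
    by rewrite divr_gt0 // ltr_wpDl.
  exists (A x); rewrite /= -ball_normE /=; near=> C.
  rewrite /= -HSB (le_lt_trans (hs_opnorm_le _ _)) //.
  rewrite (le_lt_trans (y := `|A - C| * (`|x| + 1))) //.
    by rewrite ler_wpM2l // lerDl.
  by rewrite -ltr_pdivlMr ?ltr_wpDl //; near: C.
pose L x := lim ((fun A : HS e => A x) @ F).
have Lcvg x : (fun A : HS e => A x) @ F --> L x by exact: Lex.
have Llin : linear L.
  move=> a x y; apply: (cvg_unique _ (Lcvg _)) => //=.
  have -> : (fun A : HS e => A (a *: x + y)) = (fun A => a *: A x + A y).
    by apply/funext => A; exact: hs_linear.
  by apply: cvgD; [apply: cvgZr; exact: Lcvg|exact: Lcvg].
have Lsym x y : ⟨L x, y⟩ = ⟨x, L y⟩.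
  apply: (cvg_unique _ (@inner_cvg _ _ _ _ _ _ y (Lcvg x))) => //.
  have -> : (fun A : HS e => ⟨A x, y⟩) = (fun A : HS e => ⟨A y, x⟩).
    by apply/funext => A; rewrite hs_sym innerC.
  by rewrite innerC; exact: inner_cvg.
have Ldiff A eps n : (\forall C \near F, `|A - C| < eps) ->
    \sum_(k < n) `|A (e k) - L (e k)| ^+ 2 <= eps ^+ 2.
  move=> FA; apply: (@cvg_le_cst _ F _ (fun C : HS e => \sum_(k < n) `|A (e k) - C (e k)| ^+ 2)).
    apply: cvg_big => [|i _]; first exact: add_continuous.
    under eq_fun do rewrite expr2.
    by rewrite expr2; apply: cvgM; apply: cvg_norm; apply: cvgB;
      [exact: cvg_cst|exact: Lcvg|exact: cvg_cst|exact: Lcvg].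
  near=> C; rewrite (le_trans (hs_sum_le (A - C) n)) //.
  rewrite lerXn2r ?nnegrE //.
    by rewrite (le_trans (normr_ge0 (A - C))) // ltW //; near: C.
  by rewrite ltW //; near: C.
have Lcont : continuous L.
  have [//|A0 FA0] := Fnear 1.
  have Lle x : `|L x| <= (`|A0| + 1) * `|x|.
    apply: (@cvg_le_cst _ F _ (fun C : HS e => `|C x|)); first by apply: cvg_norm; exact: Lcvg.
    near=> C; rewrite (le_trans (hs_opnorm_le _ _)) // ler_wpM2r //.
    rewrite -[X in `|X|](subKr A0) (le_trans (ler_normB _ _)) // lerD2l ltW //.
    by near: C.
  move=> x; apply/cvgrPdist_le => eps eps0; near=> y.
  have -> : L x - L y = L (x - y).
    by rewrite addrC -scaleN1r -Llin scaleN1r addrC.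
  rewrite (le_trans (Lle _)) // -ler_pdivlMl ?ltr_wpDl //; near: y.
  apply: cvgr_dist_le; first exact: cvg_id.
  by rewrite mulr_gt0 // invr_gt0 ltr_wpDl.
have Lser : cvgn (series (fun n => `|L (e n)| ^+ 2)).
  have [//|A0 FA0] := Fnear 1.
  apply: nondecreasing_is_cvgn.
    by apply: (@nondecreasing_series _ _ xpredT 0) => n _ _; exact: sqr_ge0.
  exists (2 * `|A0| ^+ 2 + 2 * 1 ^+ 2) => _ [n _ <-].
  rewrite /series /= big_mkord.
  rewrite (le_trans (y := \sum_(k < n) (2 * `|A0 (e k)| ^+ 2 +
      2 * `|A0 (e k) - L (e k)| ^+ 2))) //.
    apply: ler_sum => k _.
    rewrite (le_trans (y := (`|A0 (e k)| + `|A0 (e k) - L (e k)|) ^+ 2)) //.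
      rewrite lerXn2r ?nnegrE ?addr_ge0 //.
      by rewrite -[X in `|X| <= _](subKr (A0 (e k))) ler_normB.
    set q := `|A0 (e k)|; set r := `|A0 (e k) - L (e k)|.
    have := sqr_ge0 (q - r); nra.
  rewrite big_split -!big_distrr /= lerD // ler_wpM2l //.
    exact: hs_sum_le.
  exact: Ldiff.
have LP : L \in selfadjoint_hs e by apply/mem_set; split.
apply/cvg_ex; exists (MkHS LP); apply/cvgrPdist_le => eps eps0.
have [|A FA] := Fnear (eps / 2); first by rewrite divr_gt0.
have AL : `|A - MkHS LP| <= eps / 2.
  have e2 : 0 <= eps / 2 by rewrite divr_ge0 // ltW.
  rewrite -(ler_pXn2r (n := 2)) ?nnegrE // -hs_inner_norm.
  apply: (cvg_le_cst (@hs_is_cvg _ _ _ _ _)).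
  near=> n; rewrite /series /= big_mkord.
  by rewrite (le_trans _ (Ldiff A (eps / 2) n FA)) // ler_sum // => k _; rewrite inner_norm.
near=> C.
rewrite -(subrK A (MkHS LP)) -addrA (le_trans (ler_normD _ _)) //.
rewrite [leRHS](splitr eps) lerD //; first by rewrite distrC.
by rewrite ltW //; near: C.
Unshelve. all: by end_near. Qed.

HB.instance Definition _ := Uniform_isComplete.Build (HS e) HS_cauchy_cvg.

End HS_complete.

Section operator_cone.
Context {R : realType} {H : hilbertType R} {e : onb H}.

Definition Hplus : set (HS e) := [set A | forall h, 0 <= ⟨A h, h⟩].

Definition Hplus0 : set (HS e) := Hplus `\ 0.

Definition chi (xi : HS e) : HS e := if `|xi| <= 1 then xi else 0.

End operator_cone.
Arguments Hplus {R H} e.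
Arguments Hplus0 {R H} e.

Definition borel (E : ptopologicalType) := g_sigma_algebraType (@open E).

(* Measures on the Borel sets of H^+ \ {0} are encoded as measures on the Borel
   sets of the whole space HS e that vanish on the complement of Hplus0 e. *)
Section cone_valued_measure.
Context {R : realType} {H : hilbertType R} {e : onb H}.
Implicit Types (mu : set (borel (HS e)) -> HS e) (x : HS e).

Definition Hplus_measure mu : Prop :=
  [/\ mu set0 = 0,
      forall A, measurable A -> Hplus e (mu A),
      forall F : nat -> set (borel (HS e)), (forall n, measurable (F n)) ->
        trivIset setT F -> series (mu \o F) @ \oo --> mu (\bigcup_n F n)
    & mu (~` Hplus0 e) = 0].

Definition pairing mu x : set (borel (HS e)) -> \bar R :=
  fun A => ⟨x, mu A⟩%:E.

(* The integral of a scalar function g against mu is the element y such that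
   <y, x> is the integral of g against <x, mu(.)> for x in the cone, which
   spans HS e and on which <x, mu(.)> is a positive measure. *)
Definition vintegral mu (g : HS e -> R) : HS e :=
  xget 0 [set y | forall x, Hplus e x ->
    (pairing mu x).-integrable (Hplus0 e) (EFin \o g) /\
    ⟨y, x⟩%:E = (\int[pairing mu x]_(xi in Hplus0 e) (g xi)%:E)%E].

End cone_valued_measure.

(* Where the defining equations have a unique solution, as for a bounded linear
   operator on a Hilbert space, adjoint and orth_proj return it. *)
Definition adjoint {R : realType} {E : innerType R} (A : E -> E) (u : E) : E :=
  xget 0 [set y | forall x, ⟨y, x⟩ = ⟨u, A x⟩].

Section unbounded_operator.
Context {R : realType} {H : hilbertType R} (D : set H) (A : H -> H).

(* The last clause says that A and its adjoint have the same graph. *)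
Definition selfadjoint_operator : Prop :=
  [/\ D 0,
      forall a x y, D x -> D y ->
        D (a *: x + y) /\ A (a *: x + y) = a *: A x + A y,
      dense D
    & forall y z, (D y /\ A y = z) <-> (forall x, D x -> ⟨A x, y⟩ = ⟨x, z⟩)].

Definition nonpositive_operator : Prop := forall x, D x -> ⟨A x, x⟩ <= 0.

End unbounded_operator.

Section gelfand_triple.
Context {R : realType} {H V : hilbertType R} (iota : V -> H).

Definition dual : set (V -> R) := [set phi : V -> R | scalar phi /\ continuous phi].

Definition dual_norm (phi : V -> R) : R :=
  sup [set `|phi v| | v in [set v | `|v| <= 1]].

Definition gelfand_triple : Prop :=
  [/\ linear iota, continuous iota, injective iota & dense (range iota)].

(* the embedding of H in V^* *)
Definition pivot (h : H) : V -> R := fun v => ⟨h, iota v⟩.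

(* the vector of V identified with h, for h in V *)
Definition to_V (h : H) : V := xget 0 [set v | iota v = h].

Definition bounded_to_dual (A : V -> V -> R) : Prop :=
  [/\ forall u, dual (A u),
      forall a u w v, A (a *: u + w) v = a * A u v + A w v
    & exists C, forall u, dual_norm (A u) <= C * `|u|].

Definition dual_adjoint (A : V -> V -> R) : V -> V -> R := fun u v => A v u.

(* the Riesz isomorphism from V to V^* *)
Definition riesz (u : V) : V -> R := fun v => ⟨u, v⟩.

(* Hilbert-Schmidt operators from V^* to H, computed in the orthonormal basis
   (riesz (f n))_n of V^* *)
Definition hilbert_schmidt_dual (f : onb V) (X : (V -> R) -> H) : Prop :=
  [/\ forall a phi psi, dual phi -> dual psi ->
        X (fun v => a * phi v + psi v) = a *: X phi + X psi,
      exists C, forall phi, dual phi -> `|X phi| <= C * dual_norm phi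
    & cvgn (series (fun n => `|X (riesz (f n))| ^+ 2))].

Context (e : onb H) (f : onb V).
Implicit Types x y : HS e.

(* x regarded as an operator from H to V, and extended to one from V^* to H *)
Definition to_HV x : H -> V := fun h => to_V (x h).

Definition extends_to_dual x (X : (V -> R) -> H) : Prop :=
  hilbert_schmidt_dual f X /\ forall h, X (pivot h) = x h.

Definition to_VdH x : (V -> R) -> H := xget (fun=> 0) [set X | extends_to_dual x X].

Definition calV : set (HS e) :=
  [set x : HS e | [/\ range x `<=` range iota, hilbert_schmidt e (to_HV x)
             & exists X, extends_to_dual x X]].

Definition calV_norm x : R :=
  Num.sqrt (limn (series (fun n => `|to_HV x (e n)| ^+ 2)) +
            limn (series (fun n => `|to_VdH x (riesz (f n))| ^+ 2))).

Definition bounded_calV_to_dual (bB : HS e -> HS e -> R) : Prop :=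
  [/\ forall a x y z, calV x -> calV y -> calV z ->
        bB (a *: x + y) z = a * bB x z + bB y z,
      forall a x y z, calV x -> calV y -> calV z ->
        bB x (a *: y + z) = a * bB x y + bB x z
    & exists C, forall x y, calV x -> calV y ->
        `|bB x y| <= C * calV_norm x * calV_norm y].

(* The duality pairing of B x + x B^* with y, extending the inner product
   \sum_n <A (e n), y (e n)> of HS e: the n-th term is the value of the
   functional (B x + x B^* ) (e n) of V^* on the vector y (e n) of V. *)
Definition lyapunov_form (B : V -> V -> R) x y : R :=
  limn (series (fun n =>
    B (to_HV x (e n)) (to_HV y (e n)) +
    pivot (to_VdH x (dual_adjoint B (to_V (e n)))) (to_HV y (e n)))).

End gelfand_triple.

(* H and V are separable and infinite-dimensional, as witnessed by the bases e
   and f. *)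
Section admissible.
Context {R : realType} {H V : hilbertType R} (iota : V -> H)
  (f : onb V) (e : onb H) (lam : nat -> R) (domB : set H) (B : H -> H)
  (B' : V -> V -> R) (Gamma : HS e -> HS e)
  (b : HS e) (bB : HS e -> HS e -> R)
  (m : {measure set (borel (HS e)) -> \bar R})
  (mu : set (borel (HS e)) -> HS e).

Definition admissible_m : Prop :=
  [/\ m (~` Hplus0 e) = 0%E,
      (\int[m]_(xi in Hplus0 e) (`|xi : HS e| ^+ 2)%:E < +oo)%E,
      forall h : HS e, (\int[m]_(xi in Hplus0 e) `|⟨chi xi, h⟩|%:E < +oo)%E
    & exists I_m : HS e, forall h : HS e,
        ⟨I_m, h⟩ = \int[m]_(xi in Hplus0 e) ⟨chi xi, h⟩].

Definition admissible_b : Prop :=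
  forall v : HS e, Hplus e v ->
    0 <= ⟨b, v⟩ - \int[m]_(xi in Hplus0 e) ⟨chi xi, v⟩.

Definition admissible_mu : Prop :=
  [/\ Hplus_measure mu, Hplus e (mu (Hplus0 e))
    & forall u x : HS e, Hplus e u -> Hplus e x -> ⟨u, x⟩ = 0 ->
        (\int[pairing mu x]_(xi in Hplus0 e)
          (⟨chi xi, u⟩ * `|xi : HS e| ^- 2)%:E < +oo)%E].

(* B is the operator on H with domain domB, B' the same operator as an element
   of L(V, V^* ). *)
Definition admissible_B : Prop :=
  [/\ selfadjoint_operator domB B,
      nonpositive_operator domB B,
      bounded_to_dual B' /\
        (forall v w, domB (iota v) -> B' v w = pivot iota (B (iota v)) w),
      [/\ forall i, B (e i) = - lam i *: e i, 0 <= lam 0%N,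
        {homo lam : i j / (i <= j)%N >-> i <= j} & lam @ \oo --> +oo]
    & domB = [set h | cvgn (series (fun i => lam i ^+ 2 * ⟨h, e i⟩ ^+ 2))]].

Definition admissible_Gamma : Prop :=
  [/\ linear Gamma, continuous Gamma,
      forall x : HS e, Hplus e x -> Hplus e (Gamma x)
    & forall x u : HS e, Hplus e x -> Hplus e u -> ⟨u, x⟩ = 0 ->
        (0 <= ⟨Gamma x, u⟩%:E - \int[pairing mu x]_(xi in Hplus0 e)
          (⟨chi xi, u⟩ * `|xi : HS e| ^- 2)%:E)%E].

Definition coercive_B : Prop :=
  [/\ exists alpha0 alpha1 kappa : R,
        [/\ 0 < alpha0, 0 < alpha1, 0 <= kappa & forall u : V,
          alpha0 * `|u| ^+ 2 <= - 2 * B' u u + kappa * `|iota u| ^+ 2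
            <= alpha1 * `|u| ^+ 2],
      forall i, range iota (e i),
      dense (lin_span [set v | exists i, iota v = e i])
    & exists c0 c1 : R, [/\ 0 < c0, 0 < c1 & forall u : V,
        let s := series (fun i => (1 + lam i) * ⟨iota u, e i⟩ ^+ 2) in
        cvgn s /\ c0 * `|u| ^+ 2 <= limn s <= c1 * `|u| ^+ 2]].

Definition admissible_bB : Prop :=
  [/\ bounded_calV_to_dual iota f bB,
      forall x y, calV iota f x -> calV iota f y ->
        bB x y = lyapunov_form iota f B' x y + ⟨Gamma x, y⟩,
      admissible_B, admissible_Gamma & coercive_B].

Definition admissible : Prop :=
  [/\ gelfand_triple iota, admissible_m, admissible_b, admissible_mu
    & admissible_bB].

End admissible.

Section riccati.
Context {R : realType} {H : hilbertType R} {e : onb H}.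
Implicit Types (u x : HS e).

Definition lambda2 (lam : nat -> R) i j : R := lam i + lam j.

Definition ebasis_sum (c : nat -> nat -> R) : HS e :=
  limn (fun n => \sum_(j < n) \sum_(i < n | (i <= j)%N) c i j *: ebasis e i j).

(* The series converges exactly on the domain of L, which contains every
   calH e d; elsewhere the value is irrelevant. *)
Definition lyapunov (lam : nat -> R) x : HS e :=
  - ebasis_sum (fun i j => lambda2 lam i j * ⟨x, ebasis e i j⟩).

Definition semigroup (lam : nat -> R) (t : R) x : HS e :=
  ebasis_sum (fun i j => expR (- lambda2 lam i j * t) * ⟨x, ebasis e i j⟩).

Definition jump_kernel (u xi : HS e) : R :=
  expR (- ⟨xi, u⟩) - 1 + ⟨chi xi, u⟩.

Definition coef_F (b : HS e) (m : {measure set (borel (HS e)) -> \bar R}) u : R :=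
  ⟨b, u⟩ - \int[m]_(xi in Hplus0 e) jump_kernel u xi.

Definition coef_R (Gamma : HS e -> HS e) (mu : set (borel (HS e)) -> HS e) u :
    HS e :=
  adjoint Gamma u - vintegral mu (fun xi => jump_kernel u xi * `|xi| ^- 2).

(* indices start from 0: calH d is spanned by the first d * (d + 1) / 2 vectors
   ebasis e i j with i <= j < d *)
Definition calH (d : nat) : set (HS e) :=
  lin_span [set x | exists i j, (i <= j < d)%N /\ x = ebasis e i j].

Definition orth_proj {E : innerType R} (M : set E) (x : E) : E :=
  xget 0 [set y | M y /\ forall z, M z -> ⟨x - y, z⟩ = 0].

Definition projH (d : nat) : HS e -> HS e := orth_proj (calH d).

End riccati.
Arguments calH {R H} e d.

Section solutions.
Context {R : realType}.

(* l is the derivative of h at t, one-sided at the end points of [0, T]. *)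
Definition derivative_on {E : normedModType R} (T : R) (h : R -> E) (t : R)
    (l : E) : Prop :=
  (fun s => (s - t)^-1 *: (h s - h t)) @
    within [set s | s \in `[0, T] /\ s != t] (nbhs t) --> l.

Definition C1_on {E : normedModType R} (T : R) (h : R -> E) : Prop :=
  exists2 h' : R -> E, {within `[0, T], continuous h'} &
    forall t, t \in `[0, T] -> derivative_on T h t (h' t).

(* y is the integral over D of h, in the weak sense; for the continuous
   integrands of this file it is the Bochner integral. *)
Definition is_integral {E : innerType R} (D : set R) (h : R -> E) (y : E) : Prop :=
  forall z : E, lebesgue_measure.-integrable D (fun s => ⟨h s, z⟩%:E) /\
    ⟨y, z⟩ = \int[lebesgue_measure]_(s in D) ⟨h s, z⟩.

Context {H : hilbertType R} {e : onb H} (lam : nat -> R)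
  (Gamma : HS e -> HS e) (b : HS e)
  (m : {measure set (borel (HS e)) -> \bar R})
  (mu : set (borel (HS e)) -> HS e).

Definition galerkin_solution (d : nat) (T : R) (u : HS e)
    (phi : R -> R) (psi : R -> HS e) : Prop :=
  [/\ C1_on T phi,
      C1_on T psi /\ (forall t, t \in `[0, T] -> (calH e d `&` Hplus e) (psi t)),
      forall t, t \in `[0, T] -> derivative_on T phi t (coef_F b m (psi t)),
      forall t, t \in `[0, T] -> derivative_on T psi t
        (lyapunov lam (psi t) + projH d (coef_R Gamma mu (psi t)))
    & phi 0 = 0 /\ psi 0 = projH d u].

Definition mild_solution (T : R) (u : HS e) (phi : R -> R) (psi : R -> HS e) :
    Prop :=
  [/\ C1_on T phi,
      {within `[0, T], continuous psi} /\
        (forall t, t \in `[0, T] -> Hplus e (psi t)),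
      forall t, t \in `[0, T] ->
        is_integral `[0, t] (fun s => semigroup lam (t - s) (coef_R Gamma mu (psi s)))
          (psi t - semigroup lam t u)
    & forall t, t \in `[0, T] ->
        phi t = \int[lebesgue_measure]_(s in `[0, t]) coef_F b m (psi s)].

(* uniqueness of functions on [0, T], represented by functions on R *)
Definition unique_solution_on (T : R) (S : (R -> R) -> (R -> HS e) -> Prop)
    (phi : R -> R) (psi : R -> HS e) : Prop :=
  S phi psi /\ forall phi' psi', S phi' psi' ->
    forall t, t \in `[0, T] -> phi' t = phi t /\ psi' t = psi t.

End solutions.

(* Main.v *)
(* The cone of positive operators is self-dual, and on its bounded subsets R̂ is
   Lipschitz. The jump kernel is nonnegative for small jumps and at least -1
   for large ones, so only Gamma* and a constant contribute to the growth of R̂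
   from above, whence <R̂(u), u> <= C (|u|^2 + |u|) on the cone;
   admissibility makes R̂ quasi-monotone, and <L x, y> = 0 whenever x, y are
   positive and <x, y> = 0.

   The Galerkin field, composed with the metric projection onto the cone of H_d
   and with a radial truncation, is globally Lipschitz, so Picard's iteration
   solves it. Quasi-monotonicity and the self-duality of the cone make the
   squared distance to the cone nonincreasing, and the growth bound keeps the
   solution, uniformly in d, inside the ball on which the truncation is inactive.

   The modes with index j >= m are damped at rate lambda_m, which tends to
   infinity, while the low modes are compared by Gronwall's inequality: the
   Galerkin solutions are uniformly Cauchy. In the coordinates e_{i,j} the limit
   satisfies the variation of constants formula, i.e. the mild equation, whose
   solution is unique, again by Gronwall. *)
Require Import Defs.
From HB Require Import structures.
From mathcomp Require Import all_boot all_order all_algebra.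
From mathcomp Require Import all_classical all_reals all_analysis.
From mathcomp Require Import measurable_realfun.
From mathcomp Require Import ring lra.

Set Implicit Arguments.
Unset Strict Implicit.
Unset Printing Implicit Defensive.

Import Order.TTheory GRing.Theory Num.Theory.
Import numFieldNormedType.Exports.

Local Open Scope classical_set_scope.
Local Open Scope ring_scope.

(** * Hilbert spaces *)

(** Two obstacles shape the proof. The integral in R̂ is controlled only at points of the cone, so
    no field may be evaluated off it; and the Lipschitz constant [2 * lam d + K] of the Galerkin
    field grows with [lam d], so it serves existence at fixed d but no estimate uniform in d. The
    uniform estimates rest on <L x, x> <= 0, the growth bound and the Lipschitz constant of R̂ on
    one fixed ball of the cone.

    The finite sections inherit the structure of the limit because P_d maps the cone into itself: it
    is the compression x -> Q x Q by the projection Q onto the span of the first d basis vectors.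
    Hence quasi-monotonicity passes from R̂ to P_d R̂ on the cone of H_d. Self-duality has a second
    use: it makes the norm monotone for the cone order, which turns scalar bounds against the
    positive measures <x, mu(.)> into norm bounds for integrals against the cone-valued mu. The mild
    solution is not built independently: it is the limit of the Galerkin solutions, so existence and
    convergence come together. *)

Section inner_product.
Context {R : realType} {E : innerType R}.
Implicit Types x y z : E.

Lemma innerNl x y : ⟨- x, y⟩ = - ⟨x, y⟩.
Proof. by rewrite -scaleN1r innerZl mulN1r. Qed.

Lemma innerNr x y : ⟨x, - y⟩ = - ⟨x, y⟩.
Proof. by rewrite innerC innerNl innerC. Qed.

Lemma innerBl x y z : ⟨x - y, z⟩ = ⟨x, z⟩ - ⟨y, z⟩.
Proof. by rewrite innerDl innerNl. Qed.

Lemma innerBr x y z : ⟨x, y - z⟩ = ⟨x, y⟩ - ⟨x, z⟩.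
Proof. by rewrite innerDr innerNr. Qed.

Lemma inner_suml (I : Type) (r : seq I) (P : pred I) (F : I -> E) y :
  ⟨\sum_(i <- r | P i) F i, y⟩ = \sum_(i <- r | P i) ⟨F i, y⟩.
Proof.
elim/big_rec2 : _ => [|i a b _ <-]; first exact: inner0l.
by rewrite innerDl.
Qed.

Lemma inner_sumr (I : Type) (r : seq I) (P : pred I) (F : I -> E) y :
  ⟨y, \sum_(i <- r | P i) F i⟩ = \sum_(i <- r | P i) ⟨y, F i⟩.
Proof. by rewrite innerC inner_suml; apply: eq_bigr => i _; exact: innerC. Qed.

Lemma sqr_normD x y : `|x + y| ^+ 2 = `|x| ^+ 2 + 2 * ⟨x, y⟩ + `|y| ^+ 2.
Proof.
rewrite -!inner_norm !(innerDl, innerDr) (innerC y x).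
by ring.
Qed.

Lemma sqr_normB x y : `|x - y| ^+ 2 = `|x| ^+ 2 - 2 * ⟨x, y⟩ + `|y| ^+ 2.
Proof. by rewrite sqr_normD innerNr normrN; ring. Qed.

Lemma inner_le_norm x y : ⟨x, y⟩ <= `|x| * `|y|.
Proof. exact: le_trans (ler_norm _) (inner_cauchy_schwarz _ _). Qed.

(** The way back from weak to strong bounds: an estimate of [⟨v, z⟩] that is uniform in z is applied
    at z = v. *)
Lemma norm_le_inner x C : 0 <= C -> ⟨x, x⟩ <= C * `|x| -> `|x| <= C.
Proof.
rewrite inner_norm expr2 => C0.
have [-> _|x0] := eqVneq `|x| 0; first by [].
by rewrite ler_pM2r // lt_neqAle eq_sym x0 normr_ge0.
Qed.

Lemma inner_ext x y : (forall z, ⟨x, z⟩ = ⟨y, z⟩) -> x = y.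
Proof.
move=> xy; apply/eqP; rewrite -subr_eq0 -normr_eq0 -sqrf_eq0 -inner_norm.
by rewrite innerBl xy subrr.
Qed.

(** The parallelogram law, in the shape of the midpoint convexity that [strongly_convex_min]
    assumes. *)
Lemma sqr_norm_mid x y a :
  `|2^-1 *: (x + y) - a| ^+ 2 =
  (`|x - a| ^+ 2 + `|y - a| ^+ 2) / 2 - `|x - y| ^+ 2 / 4.
Proof.
rewrite -!inner_norm !(innerDl, innerDr, innerNl, innerNr, innerZl, innerZr).
by rewrite (innerC y x) (innerC a x) (innerC a y); field.
Qed.

Lemma inner_continuousl y : continuous (fun x => ⟨x, y⟩).
Proof. by move=> x; apply: inner_cvg; exact: cvg_id. Qed.

Lemma inner_continuousr x : continuous (fun y => ⟨x, y⟩).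
Proof.
move=> y; under eq_fun do rewrite innerC.
exact: inner_continuousl.
Qed.

End inner_product.

Section normed_sequences.
Context {R : realType}.

Lemma cvg_seqP {E : normedModType R} (u : nat -> E) (l : E) :
  (forall eps, 0 < eps -> exists N, forall n, (N <= n)%N -> `|u n - l| <= eps) ->
  u @ \oo --> l.
Proof.
move=> h; apply/cvgrPdist_le => eps eps0; have [N hN] := h _ eps0.
by exists N => // n /= Nn; rewrite distrC; exact: hN.
Qed.

Lemma cvg_seq_dist {E : normedModType R} (u : nat -> E) (l : E) eps :
  u @ \oo --> l -> 0 < eps ->
  exists N, forall n, (N <= n)%N -> `|u n - l| <= eps.
Proof.
move=> /cvgrPdist_le h eps0; have [N _ hN] := h _ eps0.
by exists N => n Nn; rewrite distrC; exact: hN.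
Qed.

Lemma cvg_stationary {E : normedModType R} (u : nat -> E) (l : E) N :
  (forall n, (N <= n)%N -> u n = l) -> u @ \oo --> l.
Proof.
by move=> h; apply: cvg_seqP => eps eps0; exists N => n Nn; rewrite h // subrr normr0 ltW.
Qed.

Lemma cauchy_seq_cvg {E : hilbertType R} (u : nat -> E) :
  (forall eps, 0 < eps -> exists N, forall n m, (N <= n)%N -> (N <= m)%N ->
    `|u n - u m| <= eps) ->
  cvgn u.
Proof.
move=> h; apply: cauchy_cvg; apply/cauchyP => eps eps0.
have [|N hN] := h (eps / 2); first by rewrite divr_gt0.
exists (u N), N => // n /= Nn; rewrite -ball_normE /=.
rewrite (le_lt_trans (hN _ _ _ Nn)) //.
by rewrite ltr_pdivrMr // ltr_pMr // ltr1n.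
Qed.

End normed_sequences.

(** * Minimisation: Riesz representation and metric projection *)

Section strongly_convex.
Context {R : realType} {E : hilbertType R}.

(** Midpoint convexity with a quadratic gain makes every minimising sequence Cauchy. The same
    principle yields the Riesz representer and the metric projection. *)
Lemma strongly_convex_min (C : set E) (J : E -> R) (l : R) :
  C !=set0 -> closed C -> continuous J -> (forall x, C x -> l <= J x) ->
  (forall x y, C x -> C y -> C (2^-1 *: (x + y))) ->
  (forall x y, C x -> C y ->
    J (2^-1 *: (x + y)) <= (J x + J y) / 2 - `|x - y| ^+ 2 / 4) ->
  exists2 x, C x & forall y, C y -> J x <= J y.
Proof.
move=> [c0 Cc0] clC cJ lJ Cmid Jmid.
have hi : has_inf (J @` C).
  split; first by exists (J c0), c0.
  by exists l => _ [x Cx <-]; exact: lJ.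
set i := inf (J @` C).
have iJ x : C x -> i <= J x by move=> Cx; apply: ge_inf; [exact: hi.2|exists x].
have /choice[x xP] : forall n : nat, exists x, C x /\ J x < i + n.+1%:R^-1.
  move=> n; have [|_ [x Cx <-] xi] := @inf_adherent _ _ n.+1%:R^-1 _ hi.
    by rewrite invr_gt0.
  by exists x.
have cx : cvgn x.
  apply: cauchy_seq_cvg => eps eps0.
  have [N hN] : exists N : nat, N.+1%:R^-1 < eps ^+ 2 / 4.
    have e2 : 0 < eps ^+ 2 / 4 by rewrite divr_gt0 ?exprn_gt0.
    exists (Num.truncn (eps ^+ 2 / 4)^-1).
    rewrite -[ltRHS]invrK ltf_pV2 ?posrE ?invr_gt0 //.
    by rewrite truncnS_gt.
  exists N => n m Nn Nm.
  have inv k : (N <= k)%N -> k.+1%:R^-1 <= N.+1%:R^-1 :> R.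
    by move=> Nk; rewrite lef_pV2 ?posrE ?ltr0n // ler_nat.
  rewrite -(ler_pXn2r (n := 2)) ?nnegrE ?(ltW eps0) //.
  have [Cn Jn] := xP n; have [Cm Jm] := xP m.
  (* The infimum bounds J at the midpoint from below, so a quarter of the squared distance is at
     most the mean excess of the two values over the infimum, hence below [N.+1%:R^-1]. *)
  have := Jmid _ _ Cn Cm; have := iJ _ (Cmid _ _ Cn Cm).
  move: (inv _ Nn) (inv _ Nm) hN Jn Jm.
  set rn := n.+1%:R^-1; set rm := m.+1%:R^-1; set rN := N.+1%:R^-1.
  lra.
exists (limn x).
  by apply: (closed_cvg C clC _ _ cx); near=> n; have [] := xP n.
move=> y Cy; apply: le_trans (iJ _ Cy).
apply/ler_addgt0Pr => eps eps0.
have /cvgr_dist_le : (J \o x) @ \oo --> J (limn x).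
  by apply: continuous_cvg => //; exact: cJ.
move=> /(_ (eps / 2)); rewrite divr_gt0 // => /(_ isT) [N1 _ hN1].
have e2 : 0 < eps / 2 by rewrite divr_gt0.
set N2 := Num.truncn (eps / 2)^-1.
have hN2 k : (N2 <= k)%N -> k.+1%:R^-1 <= eps / 2.
  move=> Nk; rewrite -[leRHS]invrK lef_pV2 ?posrE ?invr_gt0 //.
  rewrite (le_trans (ltW (truncnS_gt _))) // ler_nat ltnS //.
pose k := maxn N1 N2.
have := hN1 k (leq_maxl _ _); have := hN2 k (leq_maxr _ _).
have [_] := xP k; rewrite /= ler_norml => h1 h2 /andP[_ h3].
by move: h1 h2 h3; set r := k.+1%:R^-1; lra.
Unshelve. all: by end_near. Qed.

(** The representer minimises [|x|^2 - 2 F x], which is bounded below by [- C ^+ 2]; the equation is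
    its first variation. *)
Lemma riesz_representation (F : E -> R) (C : R) :
  (forall a x y, F (a *: x + y) = a * F x + F y) ->
  (forall x, `|F x| <= C * `|x|) ->
  exists y, forall x, ⟨y, x⟩ = F x.
Proof.
move=> linF bF.
have F0 : F 0 = 0 by apply/eqP; rewrite -normr_le0 (le_trans (bF 0)) // normr0 mulr0.
have FD x y : F (x + y) = F x + F y by have := linF 1 x y; rewrite scale1r mul1r.
have FZ a x : F (a *: x) = a * F x by have := linF a x 0; rewrite !addr0 F0 addr0.
have cF : continuous F.
  move=> x; apply/cvgrPdist_le => eps eps0.
  have c0 : 0 < `|C| + 1 by rewrite ltr_wpDl.
  near=> y.
  have -> : F x - F y = F (x - y) by rewrite -(scaleN1r y) FD FZ; ring.
  rewrite (le_trans (bF _)) // (le_trans (y := (`|C| + 1) * `|x - y|)) //.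
    by rewrite ler_wpM2r // (le_trans (ler_norm C)) // lerDl.
  rewrite -ler_pdivlMl //; near: y.
  by apply: cvgr_dist_le; [exact: cvg_id|rewrite mulr_gt0 ?invr_gt0].
pose J x := `|x| ^+ 2 - 2 * F x.
have [||||x y _ _|x y _ _|x _ xmin] := @strongly_convex_min setT J (- (C ^+ 2)).
- by exists 0.
- exact: closedT.
- by move=> x; apply: cvgB; [rewrite expr2; apply: cvgM; exact: norm_continuous|
    apply: cvgMr; exact: cF].
- move=> x _; rewrite /J; have := bF x; rewrite ler_norml => /andP[_].
  by have := sqr_ge0 (`|x| - C); nra.
- by [].
- rewrite /J; have := sqr_norm_mid x y 0; rewrite !subr0 => ->.
  by rewrite FZ FD; lra.
exists x => z.
have key t : 0 <= 2 * t * (⟨x, z⟩ - F z) + t ^+ 2 * `|z| ^+ 2.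
  have := xmin (x + t *: z) Logic.I; rewrite /J sqr_normD FD FZ innerZr normrZ.
  by rewrite exprMn real_normK ?num_real //; lra.
apply/eqP; rewrite -subr_eq0; apply/eqP.
set a := ⟨x, z⟩ - F z in key *.
have [z0|z0] := eqVneq (`|z| ^+ 2) 0.
  by have := key 1; have := key (-1); rewrite z0; lra.
have zp : 0 < `|z| ^+ 2 by rewrite lt_neqAle eq_sym z0 sqr_ge0.
(* This t minimises the quadratic in [key]; its value there is negative unless a = 0. *)
have := key (- a / `|z| ^+ 2).
rewrite (_ : _ + _ = - (a ^+ 2 / `|z| ^+ 2)); last by set q := _ ^+ 2 in z0 *; field.
rewrite oppr_ge0 pmulr_lle0 ?invr_gt0 // => h.
by apply/eqP; rewrite -sqrf_eq0 eq_le h sqr_ge0.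
Unshelve. all: by end_near. Qed.

(** The variational inequality compares the nearest point with the segment from it to z. *)
Lemma metric_projection (C : set E) : C !=set0 -> closed C ->
  (forall (t : R) x y, 0 <= t <= 1 -> C x -> C y -> C (t *: x + (1 - t) *: y)) ->
  exists p : E -> E,
    (forall x, C (p x)) /\ (forall x z, C z -> ⟨x - p x, z - p x⟩ <= 0).
Proof.
move=> C0 clC cvxC.
have half01 : 0 <= (2^-1 : R) <= 1 by lra.
have /choice[p pP] : forall x, exists y,
    C y /\ forall z, C z -> `|y - x| ^+ 2 <= `|z - x| ^+ 2.
  move=> x; have [||y z Cy Cz|y z Cy Cz|y Cy ymin] := @strongly_convex_min C (fun z => `|z - x| ^+ 2) 0 C0 clC.
  - move=> y /=.
    have h : (fun z => `|z - x|) @ y --> `|y - x|.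
      by apply: cvg_norm; apply: cvgB; [exact: cvg_id|exact: cvg_cst].
    exact: (cvgM h h).
  - by move=> y _; exact: sqr_ge0.
  - have := cvxC 2^-1 y z half01 Cy Cz.
    by rewrite scalerDr (_ : 1 - 2^-1 = 2^-1) //; field.
  - by rewrite sqr_norm_mid.
  by exists y.
exists p; split; first by move=> x; have [] := pP x.
move=> x z Cz; have [Cp pmin] := pP x.
set a := ⟨_, _⟩.
have key t : 0 <= t <= 1 -> 0 <= - (2 * t * a) + t ^+ 2 * `|z - p x| ^+ 2.
  move=> t01; have := pmin _ (cvxC t z (p x) t01 Cz Cp).
  rewrite (_ : t *: z + _ - x = (p x - x) + t *: (z - p x)); last first.
    by rewrite scalerBl scale1r scalerBr addrCA addrAC.
  rewrite (sqr_normD (p x - x)) innerZr normrZ exprMn real_normK ?num_real //.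
  rewrite -(opprB x) innerNl -/a; lra.
rewrite leNgt; apply/negP => a0.
(* If a were positive, t = a / c would lie in [0, 1] and make the quadratic of [key] negative. *)
pose c := a + `|z - p x| ^+ 2.
have c0 : 0 < c by rewrite /c ltr_wpDr ?sqr_ge0.
have ac01 : 0 <= a / c <= 1.
  by rewrite divr_ge0 ?(ltW a0) ?(ltW c0) //= ler_pdivrMr // mul1r lerDl sqr_ge0.
have := key _ ac01.
rewrite (_ : _ + _ = - ((a / c) ^+ 2 * (2 * c - `|z - p x| ^+ 2))); last by field; rewrite gt_eqF.
have d0 : 0 < 2 * c - `|z - p x| ^+ 2.
  by rewrite /c; have := sqr_ge0 `|z - p x|; lra.
by rewrite oppr_ge0 leNgt mulr_gt0 // exprn_gt0 // divr_gt0.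
Qed.

End strongly_convex.

Section variational_projection.
Context {R : realType} {E : innerType R} (C : set E) (p : E -> E).
Hypothesis Cp : forall x, C (p x).
Hypothesis pP : forall x z, C z -> ⟨x - p x, z - p x⟩ <= 0.

(** Sum of the variational inequalities at x and at y. Only the two hypotheses on p enter, so the
    lemma also applies to the explicit retraction [radial]. *)
Lemma projection_nonexpansive x y : `|p x - p y| <= `|x - y|.
Proof.
apply: norm_le_inner => //.
have := pP x (Cp y); have := pP y (Cp x).
have := inner_le_norm (x - y) (p x - p y).
rewrite !(innerBl, innerBr) (innerC (p y) (p x)).
lra.
Qed.

(** The squared distance to C has gradient 2 (x - p x) with a quadratic remainder; this is the form
    of differentiability that [derivative_on_chain] takes. *)
Lemma projection_sqr_dist x y :
  `| `|y - p y| ^+ 2 - `|x - p x| ^+ 2 - ⟨2 *: (x - p x), y - x⟩ | <= 1 * `|y - x| ^+ 2.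
Proof.
have := pP x (Cp y); have := pP y (Cp x).
have := inner_le_norm (p y - p x) (y - x).
have := projection_nonexpansive y x.
have := sqr_ge0 `|p y - p x|.
rewrite -!inner_norm innerZl !(innerBl, innerBr) ler_norml.
rewrite (innerC (p y) (p x)) (innerC y (p y)) (innerC x (p y)) (innerC x (p x)) (innerC y (p x)) (innerC y x).
have := inner_norm (y - x); rewrite !(innerBl, innerBr) (innerC y x).
set n := `|y - x|; set k := `|p y - p x| => nE k0 kn h1 h2 h3.
have k00 : 0 <= k by rewrite normr_ge0.
have : k * n <= n ^+ 2 by rewrite expr2 ler_wpM2r ?normr_ge0.
by move: h1 h2 h3 nE k0 => *; apply/andP; split; lra.
Qed.

End variational_projection.

(** * The cone of positive operators and its finite sections *)

Section fourier.
Context {R : realType} {H : hilbertType R} (e : onb H).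
Implicit Types x y : H.

Definition fourier_sum n x : H := \sum_(k < n) ⟨x, e k⟩ *: e k.

Lemma fourier_sum_proj n x y : ⟨fourier_sum n x, y⟩ = \sum_(k < n) ⟨x, e k⟩ * ⟨y, e k⟩.
Proof. by rewrite inner_suml; apply: eq_bigr => k _; rewrite innerZl (innerC y). Qed.

Lemma fourier_sum_basis n x k : (k < n)%N -> ⟨fourier_sum n x, e k⟩ = ⟨x, e k⟩.
Proof.
move=> kn; rewrite fourier_sum_proj (bigD1 (Ordinal kn)) //= onb_orthonormal eqxx mulr1.
rewrite big1 ?addr0 // => i ik; rewrite onb_orthonormal eq_sym.
by rewrite -val_eqE /= in ik; rewrite (negbTE ik) mulr0.
Qed.

(** A point s of the span near x lies in the span of the first N vectors; for n >= N the partial sum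
    is at least as close to x as s, by Pythagoras. *)
Lemma fourier_cvg x : (fun n => fourier_sum n x) @ \oo --> x.
Proof.
apply: cvg_seqP => eps eps0.
have [|s [/= sx /span_expansion[N sE]]] := onb_total e (O := ball x eps) _ (ball_open _ _).
  by exists x; exact: ballxx.
move: sx; rewrite -ball_normE /= => sx.
exists N => n Nn; rewrite distrC (le_trans _ (ltW sx)) //.
rewrite -(ler_pXn2r (n := 2)) ?nnegrE //.
have ps : ⟨x - fourier_sum n x, fourier_sum n x - s⟩ = 0.
  have pe k : (k < n)%N -> ⟨x - fourier_sum n x, e k⟩ = 0.
    by move=> kn; rewrite innerBl fourier_sum_basis // subrr.
  set y := x - fourier_sum n x in pe *.
  rewrite innerBr sE /fourier_sum !inner_sumr !big1 ?subrr // => k _; rewrite innerZr pe ?mulr0 //.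
  exact: leq_trans (ltn_ord k) Nn.
have -> : x - s = (x - fourier_sum n x) + (fourier_sum n x - s) by rewrite addrA subrK.
by rewrite (sqr_normD (x - _)) ps mulr0 addr0 lerDl sqr_ge0.
Qed.

Lemma parseval x y : series (fun n => ⟨x, e n⟩ * ⟨y, e n⟩) @ \oo --> ⟨x, y⟩.
Proof.
rewrite (_ : series _ = fun n => ⟨fourier_sum n x, y⟩); first by apply: inner_cvg; exact: fourier_cvg.
by apply/funext => n; rewrite fourier_sum_proj /series /= big_mkord.
Qed.

End fourier.

(** * Sums over index pairs i <= j *)

Section triangular_sums.
Context {R : realType}.

Definition tri_sum {E : lmodType R} (n : nat) (c : nat -> nat -> E) : E :=
  \sum_(j < n) \sum_(i < j.+1) c i j.

Lemma tri_sumS {E : lmodType R} n (c : nat -> nat -> E) :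
  tri_sum n.+1 c = tri_sum n c + \sum_(i < n.+1) c i n.
Proof. by rewrite /tri_sum big_ord_recr. Qed.

Lemma tri_sum_cond {E : lmodType R} n (c : nat -> nat -> E) :
  \sum_(j < n) \sum_(i < n | (i <= j)%N) c i j = tri_sum n c.
Proof.
apply: eq_bigr => j _; rewrite (big_ord_widen n (fun i => c i j)) //.
Qed.

Lemma eq_tri_sum {E : lmodType R} n (c d : nat -> nat -> E) :
  (forall i j, (i <= j < n)%N -> c i j = d i j) -> tri_sum n c = tri_sum n d.
Proof.
move=> cd; apply: eq_bigr => j _; apply: eq_bigr => i _; apply: cd.
by rewrite -ltnS ltn_ord /=.
Qed.

Lemma tri_sumD {E : lmodType R} n (c d : nat -> nat -> E) :
  tri_sum n (fun i j => c i j + d i j) = tri_sum n c + tri_sum n d.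
Proof. by rewrite -big_split; apply: eq_bigr => j _; rewrite big_split. Qed.

Lemma tri_sumZ {E : lmodType R} n a (c : nat -> nat -> E) :
  tri_sum n (fun i j => a *: c i j) = a *: tri_sum n c.
Proof. by rewrite scaler_sumr; apply: eq_bigr => j _; rewrite scaler_sumr. Qed.

Lemma tri_sumB {E : lmodType R} n (c d : nat -> nat -> E) :
  tri_sum n (fun i j => c i j - d i j) = tri_sum n c - tri_sum n d.
Proof.
rewrite -[- tri_sum n d]scaleN1r -tri_sumZ -tri_sumD.
by apply: eq_tri_sum => i j _; rewrite scaleN1r.
Qed.

Lemma tri_sum0 {E : lmodType R} n (c : nat -> nat -> E) :
  (forall i j, (i <= j < n)%N -> c i j = 0) -> tri_sum n c = 0.
Proof.
move=> c0; rewrite (eq_tri_sum (d := fun _ _ => 0)) //.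
by rewrite /tri_sum big1 // => j _; rewrite big1.
Qed.

Lemma ler_tri_sum n (c d : nat -> nat -> R) :
  (forall i j, (i <= j < n)%N -> c i j <= d i j) -> tri_sum n c <= tri_sum n d.
Proof.
move=> cd; apply: ler_sum => j _; apply: ler_sum => i _; apply: cd.
by rewrite -ltnS ltn_ord /=.
Qed.

Lemma tri_sum_widen {E : lmodType R} m n (c : nat -> nat -> E) : (m <= n)%N ->
  tri_sum m c = tri_sum n (fun i j => if (j < m)%N then c i j else 0).
Proof.
move=> mn; rewrite /tri_sum (big_ord_widen n (fun j => \sum_(i < j.+1) c i j)) //.
rewrite big_mkcond; apply: eq_bigr => j _; case: ifPn => // _.
by rewrite big1.
Qed.

(** The ratio between the coordinate of an operator along [ebasis e i j] and its matrix entry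
    ([inner_ebasis]). *)
Definition tri_weight (i j : nat) : R := if i == j then 1 else Num.sqrt 2.

Lemma tri_weight_gt0 i j : 0 < tri_weight i j.
Proof. by rewrite /tri_weight; case: ifP; rewrite ?sqrtr_gt0. Qed.

(** The squared weight 2 off the diagonal counts both (i, j) and (j, i): orthonormal coordinates are
    thus exchanged for the full matrix. *)
Lemma tri_sum_sym n (a : nat -> nat -> R) : (forall i j, a i j = a j i) ->
  tri_sum n (fun i j => tri_weight i j ^+ 2 * a i j) =
  \sum_(i < n) \sum_(j < n) a i j.
Proof.
move=> asym; elim: n => [|n IH]; first by rewrite /tri_sum !big_ord0.
have -> : \sum_(i < n.+1) \sum_(j < n.+1) a i j =
    \sum_(i < n) \sum_(j < n) a i j + \sum_(i < n) a i n + (\sum_(j < n) a n j + a n n).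
  rewrite big_ord_recr /= [X in _ + X]big_ord_recr /= -big_split; congr (_ + _).
  by apply: eq_bigr => i _; rewrite big_ord_recr.
rewrite tri_sumS IH -!addrA; congr (_ + _).
rewrite big_ord_recr /= /tri_weight eqxx expr1n mul1r addrA; congr (_ + _).
under [X in _ = _ + X]eq_bigr do rewrite asym.
rewrite -big_split; apply: eq_bigr => i _.
by rewrite ltn_eqF // sqr_sqrtr //=; lra.
Qed.

End triangular_sums.

Section operator_basis.
Context {R : realType} {H : hilbertType R} {e : onb H}.
Implicit Types x y : HS e.

Definition entry x i j : R := ⟨x (e i), e j⟩.

Lemma entryC x i j : entry x i j = entry x j i.
Proof. by rewrite /entry hs_sym innerC. Qed.

Definition sqtensor (h : H) : HS e := MkHS (tensor_sq_subproof e h).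

Lemma hs_addE x y h : (x + y) h = x h + y h. Proof. by []. Qed.
Lemma hs_scaleE a x h : (a *: x) h = a *: x h. Proof. by []. Qed.
Lemma hs_subE x y h : (x - y) h = x h - y h. Proof. by []. Qed.

(** Expresses the quadratic form as a pairing in [HS e]: the rank one operators are the tests for
    positivity. *)
Lemma inner_sqtensor x h : ⟨x, sqtensor h⟩ = ⟨x h, h⟩.
Proof.
rewrite -[LHS]/(hs_inner x (sqtensor h)) /hs_inner.
apply: (cvg_lim (@Rhausdorff R)).
rewrite (_ : (fun n => _) = fun n => ⟨x h, e n⟩ * ⟨h, e n⟩); first exact: parseval.
by apply/funext => n; rewrite /= /tensor innerZr hs_sym (innerC (e n)) mulrC.
Qed.

Lemma inner_symtensor x h k :
  ⟨x, MkHS (tensor_sym_subproof e h k)⟩ = 2 * ⟨x h, k⟩.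
Proof.
rewrite -[LHS]/(hs_inner x (MkHS (tensor_sym_subproof e h k))) /hs_inner.
have -> : 2 * ⟨x h, k⟩ = ⟨x k, h⟩ + ⟨x h, k⟩.
  by rewrite (hs_sym x k) innerC; ring.
apply: (cvg_lim (@Rhausdorff R)).
rewrite (_ : series _ = series (fun n => ⟨x k, e n⟩ * ⟨h, e n⟩) + series (fun n => ⟨x h, e n⟩ * ⟨k, e n⟩)).
  exact: (cvgD (@parseval _ _ e (x k) h) (@parseval _ _ e (x h) k)).
apply/funext => n; transitivity (series (fun n => ⟨x k, e n⟩ * ⟨h, e n⟩) n + series (fun n => ⟨x h, e n⟩ * ⟨k, e n⟩) n); last by [].
rewrite /series /= -big_split; apply: eq_bigr => i _ /=.
by rewrite /tensor innerDr !innerZr (hs_sym x _ k) (hs_sym x _ h) (innerC _ (x k)) (innerC _ (x h)) mulrC [X in _ + X = _]mulrC.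
Qed.

Lemma inner_ebasis x i j : ⟨x, ebasis e i j⟩ = tri_weight i j * entry x i j.
Proof.
rewrite /ebasis /tri_weight; case: eqVneq => [->|ij].
  by rewrite mul1r; exact: inner_sqtensor.
rewrite innerZr inner_symtensor mulrA; congr (_ * _).
have s2 : Num.sqrt 2 != 0 :> R by rewrite gt_eqF // sqrtr_gt0.
apply: (mulfI s2); rewrite mulrA mulfV // mul1r -expr2 sqr_sqrtr //.
Qed.

Lemma ebasis_orthonormal i j k l : (i <= j)%N -> (k <= l)%N ->
  ⟨ebasis e i j, ebasis e k l⟩ = ((i == k) && (j == l))%:R.
Proof.
move=> ij kl; rewrite inner_ebasis /entry /ebasis.
have s2 : Num.sqrt 2 != 0 :> R by rewrite gt_eqF // sqrtr_gt0.
have s22 : Num.sqrt 2 * Num.sqrt 2 = 2 :> R by rewrite -expr2 sqr_sqrtr.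
case: eqVneq => [ij_eq|ijN]; rewrite /tri_weight.
  subst j; rewrite /= /tensor innerZl !onb_orthonormal.
  by have [ik|ik] := eqVneq i k; have [il|il] := eqVneq i l; rewrite /= ?mul0r ?mulr0 //;
    subst; rewrite ?eqxx ?mul1r //; case: eqVneq => [?|_]; subst; rewrite ?eqxx ?mulr1 ?mul0r ?mulr0 // in ik il *.
rewrite hs_scaleE innerZl /= /tensor innerDl !innerZl !onb_orthonormal.
have ij' : (i < j)%N by rewrite ltn_neqAle ijN ij.
case: eqVneq => [kl_eq|klN].
  subst l; rewrite mul1r.
  have [ik|ik] := eqVneq i k; have [jk|jk] := eqVneq j k; rewrite /= ?mulr0 ?mul0r ?addr0 ?mulr0 ?andbF //=.
  by move: ijN; rewrite ik jk eqxx.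
have kl' : (k < l)%N by rewrite ltn_neqAle klN kl.
rewrite mulrA mulfV // mul1r.
rewrite -!natrM !mulnb.
have -> : (j == k) && (i == l) = false.
  by apply/negbTE/negP => /andP[/eqP ? /eqP ?]; subst; move: (ltn_trans ij' kl'); rewrite ltnn.
by rewrite addr0.
Qed.

End operator_basis.

(** * Truncations, positivity and self-duality of the cone *)

Section cone.
Context {R : realType} {H : hilbertType R} {e : onb H}.
Implicit Types x y : HS e.

Definition ecoef x i j : R := ⟨x, ebasis e i j⟩.

Definition tri_ebasis n (c : nat -> nat -> R) : HS e :=
  tri_sum n (fun i j => c i j *: ebasis e i j).

Lemma inner_tri_ebasis n c x :
  ⟨tri_ebasis n c, x⟩ = tri_sum n (fun i j => (c i j * ecoef x i j : R^o)).
Proof.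
rewrite inner_suml; apply: eq_bigr => j _; rewrite inner_suml.
by apply: eq_bigr => i _; rewrite innerZl (innerC (ebasis e i j)).
Qed.

Lemma ecoef_tri_ebasis n c i j : (i <= j)%N ->
  ecoef (tri_ebasis n c) i j = if (j < n)%N then c i j else 0.
Proof.
move=> ij; rewrite /ecoef inner_tri_ebasis.
have h k l : (k <= l)%N -> c k l * ecoef (ebasis e i j) k l =
    if (k == i) && (l == j) then c i j else 0.
  move=> kl; rewrite /ecoef ebasis_orthonormal // (eq_sym i) (eq_sym j).
  by case: andP => [[/eqP -> /eqP ->]|_]; rewrite ?mulr1 ?mulr0.
case: ifPn => jn.
  rewrite /tri_sum (bigD1 (Ordinal jn)) //= (bigD1 (Ordinal (n:=j.+1) (m:=i) ij)) //=.
  rewrite h // !eqxx big1 ?addr0 ?big1 ?addr0 // => [k kj|k ki].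
    rewrite big1 // => l _; rewrite h -1?ltnS // (_ : (_ == j) = false) ?andbF //.
    by apply/negbTE; move: kj; rewrite -val_eqE.
  rewrite h -1?ltnS // (_ : (_ == i) = false) //.
  by apply/negbTE; move: ki; rewrite -val_eqE.
apply: tri_sum0 => k l /andP[kl ln]; rewrite h // (_ : (l == j) = false) ?andbF //.
by apply/negbTE; apply: contraNneq jn => <-.
Qed.

Lemma inner_tri_ebasis2 n c d :
  ⟨tri_ebasis n c, tri_ebasis n d⟩ = tri_sum n (fun i j => (c i j * d i j : R^o)).
Proof.
rewrite inner_tri_ebasis; apply: eq_tri_sum => i j /andP[ij jn].
by rewrite ecoef_tri_ebasis // jn.
Qed.

Lemma tri_ebasisB n c d : tri_ebasis n (fun i j => c i j - d i j) = tri_ebasis n c - tri_ebasis n d.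
Proof. by rewrite -tri_sumB; apply: eq_tri_sum => i j _; rewrite scalerBl. Qed.

Lemma tri_ebasisZ n a c : tri_ebasis n (fun i j => a * c i j) = a *: tri_ebasis n c.
Proof. by rewrite -tri_sumZ; apply: eq_tri_sum => i j _; rewrite scalerA. Qed.

Lemma tri_ebasisD n c d : tri_ebasis n (fun i j => c i j + d i j) = tri_ebasis n c + tri_ebasis n d.
Proof. by rewrite -tri_sumD; apply: eq_tri_sum => i j _; rewrite scalerDl. Qed.

Lemma tri_ebasis_widen m n c : (m <= n)%N ->
  tri_ebasis m c = tri_ebasis n (fun i j => if (j < m)%N then c i j else 0).
Proof.
move=> mn; rewrite /tri_ebasis (tri_sum_widen _ mn); apply: eq_tri_sum => i j _.
by case: ifP => // _; rewrite scale0r.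
Qed.

(** The projection P_n in coordinates; [projHE] identifies it with [projH n]. *)
Definition cutoff n x := tri_ebasis n (ecoef x).

Lemma ecoef_cutoff n x i j : (i <= j)%N ->
  ecoef (cutoff n x) i j = if (j < n)%N then ecoef x i j else 0.
Proof. exact: ecoef_tri_ebasis. Qed.

Lemma cutoff_tri n m c : (n <= m)%N -> cutoff m (tri_ebasis n c) = tri_ebasis n c.
Proof.
move=> nm; rewrite [RHS](tri_ebasis_widen _ nm); apply: eq_tri_sum => i j /andP[ij jm].
by rewrite ecoef_tri_ebasis.
Qed.

Lemma cutoffB n x y : cutoff n (x - y) = cutoff n x - cutoff n y.
Proof. by rewrite -tri_ebasisB; apply: eq_tri_sum => i j _; rewrite /ecoef innerBl. Qed.

Lemma cutoffD n x y : cutoff n (x + y) = cutoff n x + cutoff n y.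
Proof. by rewrite -tri_ebasisD; apply: eq_tri_sum => i j _; rewrite /ecoef innerDl. Qed.

Lemma cutoffZ n a x : cutoff n (a *: x) = a *: cutoff n x.
Proof. by rewrite -tri_ebasisZ; apply: eq_tri_sum => i j _; rewrite /ecoef innerZl. Qed.

Lemma inner_cutoff n x y : ⟨cutoff n x, y⟩ = ⟨x, cutoff n y⟩.
Proof.
rewrite inner_tri_ebasis innerC inner_tri_ebasis.
by apply: eq_tri_sum => i j _; rewrite mulrC.
Qed.

Lemma cutoff_idem m n x : (m <= n)%N -> cutoff n (cutoff m x) = cutoff m x.
Proof. exact: cutoff_tri. Qed.

Lemma cutoff_idem' m n x : (m <= n)%N -> cutoff m (cutoff n x) = cutoff m x.
Proof.
move=> mn; apply: eq_tri_sum => i j /andP[ij jm].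
by rewrite ecoef_cutoff // (leq_trans jm mn).
Qed.

Lemma cutoff_sqr_norm n x : `|cutoff n x| ^+ 2 = ⟨cutoff n x, x⟩.
Proof. by rewrite -inner_norm inner_cutoff cutoff_idem // innerC. Qed.

Lemma cutoff_pythagoras n x : `|x - cutoff n x| ^+ 2 = `|x| ^+ 2 - `|cutoff n x| ^+ 2.
Proof. by rewrite sqr_normB (innerC x) -cutoff_sqr_norm; ring. Qed.

Lemma cutoff_le n x : `|cutoff n x| <= `|x|.
Proof.
rewrite -(ler_pXn2r (n := 2)) ?nnegrE //.
by rewrite -subr_ge0 -cutoff_pythagoras sqr_ge0.
Qed.

Lemma cutoff_compl_le n x : `|x - cutoff n x| <= `|x|.
Proof.
rewrite -(ler_pXn2r (n := 2)) ?nnegrE // cutoff_pythagoras.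
by rewrite gerDl oppr_le0 sqr_ge0.
Qed.

Lemma cutoff_sqr_normE n x :
  `|cutoff n x| ^+ 2 = \sum_(i < n) \sum_(j < n) entry x i j ^+ 2.
Proof.
rewrite cutoff_sqr_norm inner_tri_ebasis.
rewrite -[RHS](tri_sum_sym n (a := fun i j => entry x i j ^+ 2)); last by move=> i j; rewrite entryC.
by apply: eq_tri_sum => i j _; rewrite /ecoef inner_ebasis -expr2 exprMn.
Qed.

(** The squared norm is a double series of squared entries: keeping N rows costs half of the
    tolerance, keeping N' columns of these rows the other half, and an n by n block with n >= N, N'
    contains what remains. *)
Lemma cutoff_cvg x : (fun n => cutoff n x) @ \oo --> x.
Proof.
apply: cvg_seqP => eps eps0.
have e2 : 0 < eps ^+ 2 / 2 by rewrite divr_gt0 ?exprn_gt0.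
have cx : series (fun k => `|x (e k)| ^+ 2) @ \oo --> `|x| ^+ 2.
  rewrite -hs_inner_norm /hs_inner (_ : (fun n => ⟨x (e n), x (e n)⟩) = fun k => `|x (e k)| ^+ 2).
    by have [[]] := set_mem (hs_funP x).
  by apply/funext => n; rewrite inner_norm.
have [N hN] := cvg_seq_dist cx e2.
have cN : (fun n => \sum_(k < N) series (fun l => entry x k l ^+ 2) n) @ \oo -->
    \sum_(k < N) `|x (e k)| ^+ 2.
  apply: cvg_big => [|k _]; first exact: add_continuous.
  by rewrite -inner_norm; apply: parseval.
have [N' hN'] := cvg_seq_dist cN e2.
exists (maxn N N') => n; rewrite geq_max => /andP[Nn N'n].
rewrite distrC -(ler_pXn2r (n := 2)) ?nnegrE ?(ltW eps0) // cutoff_pythagoras cutoff_sqr_normE.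
have h1 := hN N (leqnn _); have h2 := hN' n N'n.
have h3 : \sum_(k < N) series (fun l => entry x k l ^+ 2) n <= \sum_(i < n) \sum_(j < n) entry x i j ^+ 2.
  rewrite (big_ord_widen n (fun k => series (fun l => entry x k l ^+ 2) n)) // big_mkcond.
  apply: ler_sum => i _; rewrite /series /= big_mkord; case: ifP => // _.
  by apply: sumr_ge0 => j _; exact: sqr_ge0.
move: h1 h2 h3; rewrite !ler_norml {1}/series /= big_mkord.
move=> /andP[h1 _] /andP[h2 _] h3; lra.
Qed.

(* The Schur multiplier by the matrix (s_i s_j) of the truncation of x. *)
Definition schur (s : nat -> R) n x :=
  tri_ebasis n (fun i j => s i * s j * ecoef x i j).

(** The multiplier has rank one, so it acts as the congruence S x S, where S is diagonal with
    entries s_k for k < n and 0 beyond. Congruences preserve positivity; s = 1 gives P_n. *)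
Lemma schur_quadratic s n x h :
  ⟨schur s n x h, h⟩ = ⟨x (\sum_(k < n) (s k * ⟨h, e k⟩) *: e k),
                        \sum_(k < n) (s k * ⟨h, e k⟩) *: e k⟩.
Proof.
rewrite -inner_sqtensor inner_tri_ebasis hs_sum inner_suml.
under [RHS]eq_bigr do rewrite inner_sumr.
pose a i j := s i * s j * entry x i j * (⟨h, e i⟩ * ⟨h, e j⟩).
transitivity (\sum_(i < n) \sum_(j < n) a i j); last first.
  apply: eq_bigr => i _; apply: eq_bigr => j _; rewrite innerZl innerZr /a /entry; ring.
rewrite -tri_sum_sym; last by move=> i j; rewrite /a entryC; ring.
apply: eq_tri_sum => i j _; rewrite /ecoef !inner_ebasis /a /entry /= /tensor innerZl.
ring.
Qed.

Lemma schur_Hplus s n x : Hplus e x -> Hplus e (schur s n x).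
Proof. by move=> xp h; rewrite schur_quadratic; exact: xp. Qed.

Lemma cutoff_Hplus n x : Hplus e x -> Hplus e (cutoff n x).
Proof.
move=> /(schur_Hplus (fun=> 1) n); congr (Hplus e _); apply: eq_tri_sum => i j _.
by rewrite !mul1r.
Qed.

Lemma sqtensor_Hplus h : Hplus e (sqtensor h).
Proof. by move=> k; rewrite /= /tensor innerZl innerC -expr2 sqr_ge0. Qed.

(* For y with finitely many nonzero rows, one step of Cholesky elimination
   splits off a multiple of sqtensor (y (e n)) and leaves a positive remainder
   with one row less; the general case follows by truncation. *)
Lemma Hplus_inner_ge0 x y : Hplus e x -> Hplus e y -> 0 <= ⟨x, y⟩.
Proof.
move=> xp.
have finite n z : Hplus e z -> (forall k, (n <= k)%N -> z (e k) = 0) -> 0 <= ⟨x, z⟩.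
  elim: n z => [|n IH] z zp z0.
    rewrite (_ : z = 0) ?inner0r //; apply: hs_inner_eq0.
    rewrite /hs_inner (_ : (fun n => _) = fun=> 0); last first.
      by apply/funext => n; rewrite z0 ?inner0l.
    by apply: (cvg_lim (@Rhausdorff R)); rewrite /series /=; under eq_fun do rewrite big1 //; exact: cvg_cst.
  set h := z (e n); set d := ⟨h, e n⟩.
  have d0 : 0 <= d by exact: zp.
  have CS k : ⟨h, k⟩ ^+ 2 <= d * ⟨z k, k⟩.
    have -> : ⟨h, k⟩ = ⟨z (e n), k⟩ by [].
    apply: (form_cauchy_schwarz (f := fun a b => ⟨z a, b⟩)) => [a b|a b c|a b c|a].
    - by rewrite hs_sym innerC.
    - by have := hs_linear z 1 a b; rewrite !scale1r => ->; rewrite innerDl.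
    - have := hs_linear z a b 0; rewrite addr0 => ->.
      have := hs_linear z (-1) 0 0; rewrite scaleN1r addNr scaleN1r addNr => ->.
      by rewrite addr0 innerZl.
    - exact: zp.
  (* With a zero pivot, [CS] forces the whole row h to vanish, and there is nothing to eliminate. *)
  have [dE|dN] := eqVneq d 0.
    apply: IH => // k; rewrite leq_eqVlt => /orP[/eqP <-|]; last exact: z0.
    apply/eqP; rewrite -normr_eq0 -sqrf_eq0 -inner_norm -sqrf_eq0 eq_le sqr_ge0 andbT.
    by have := CS h; rewrite dE mul0r.
  have dp : 0 < d by rewrite lt_neqAle eq_sym dN.
  pose w := z - d^-1 *: sqtensor h.
  have -> : z = w + d^-1 *: sqtensor h by rewrite subrK.
  rewrite innerDr innerZr inner_sqtensor addr_ge0 //; last first.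
    by rewrite mulr_ge0 ?invr_ge0 //; exact: xp.
  apply: IH => [k|k].
    rewrite hs_subE innerBl hs_scaleE innerZl /= /tensor innerZl -expr2 subr_ge0.
    by rewrite ler_pdivrMl //; exact: CS.
  rewrite hs_subE hs_scaleE /= /tensor leq_eqVlt => /orP[/eqP <-|nk].
    by rewrite -/h -/d scalerA mulVf // scale1r subrr.
  rewrite z0 // (_ : ⟨h, e k⟩ = 0) ?scale0r ?scaler0 ?subr0 //.
  by rewrite /h hs_sym z0 // inner0r.
move=> yp; have cy : (fun n => ⟨x, cutoff n y⟩) @ \oo --> ⟨x, y⟩.
  by apply: continuous_cvg; [exact: inner_continuousr|exact: cutoff_cvg].
rewrite -(cvg_lim (@Rhausdorff R) cy); apply: limr_ge; first by apply/cvg_ex; eexists; exact: cy.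
near=> n; apply: (finite n); first exact: cutoff_Hplus.
move=> k nk; apply: onb_eq0 => l.
rewrite -/(entry _ k l).
have key i j : (i <= j)%N -> (n <= j)%N -> entry (cutoff n y) i j = 0.
  move=> ij nj; apply: (mulfI (lt0r_neq0 (tri_weight_gt0 i j))).
  by rewrite -inner_ebasis -/(ecoef _ i j) ecoef_cutoff // ltnNge nj mulr0.
have [kl|lk] := leqP k l; first by apply: key => //; exact: leq_trans nk kl.
by transitivity (entry (cutoff n y) l k); [exact: entryC|apply: key => //; exact: ltnW].
Unshelve. all: by end_near. Qed.

Lemma HplusP x : (forall y, Hplus e y -> 0 <= ⟨x, y⟩) -> Hplus e x.
Proof. by move=> h k; rewrite -inner_sqtensor; apply: h; exact: sqtensor_Hplus. Qed.

Lemma Hplus_comb a c x y : 0 <= a -> 0 <= c -> Hplus e x -> Hplus e y ->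
  Hplus e (a *: x + c *: y).
Proof.
move=> a0 c0 xp yp h; rewrite hs_addE !hs_scaleE innerDl !innerZl.
by rewrite addr_ge0 // mulr_ge0.
Qed.

Lemma Hplus_0 : Hplus e 0.
Proof. by move=> h; rewrite inner0l. Qed.

Lemma Hplus_closed : closed (Hplus e).
Proof.
rewrite (_ : Hplus e = \bigcap_h [set x | 0 <= ⟨x, sqtensor h⟩]).
  apply: closed_bigI => h _.
  apply: (@preimage_closed _ _ (fun x : HS e => ⟨x, sqtensor h⟩) [set r | 0 <= r]).
    by move=> ? _; exact: inner_continuousl.
  exact: closed_ge.
apply/seteqP; split=> [x xp h _ /=|x xp h]; first by rewrite inner_sqtensor; exact: xp.
by rewrite -inner_sqtensor; exact: xp.
Qed.

(** Polarisation recovers every matrix entry from the quadratic form. This makes the element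
    selected by [vintegral] unique. *)
Lemma Hplus_inner_ext x y : (forall z, Hplus e z -> ⟨x, z⟩ = ⟨y, z⟩) -> x = y.
Proof.
move=> xy; apply/eqP; rewrite -subr_eq0; apply/eqP.
have : forall h, ⟨(x - y) h, h⟩ = 0.
  by move=> h; rewrite -inner_sqtensor innerBl xy ?subrr //; exact: sqtensor_Hplus.
move: (x - y) => {xy}z h0.
have e0 i j : entry z i j = 0.
  have := h0 (e i + e j); have := h0 (e i); have := h0 (e j).
  have := hs_linear z 1 (e i) (e j); rewrite !scale1r => ->.
  rewrite !(innerDl, innerDr) -!/(entry _ _ _) (entryC _ j i) => -> ->; lra.
apply: hs_inner_eq0; rewrite /hs_inner (_ : (fun n => _) = fun=> 0).
  by apply: (cvg_lim (@Rhausdorff R)); rewrite /series /=; under eq_fun do rewrite big1 //; exact: cvg_cst.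
by apply/funext => n; rewrite (onb_eq0 (e := e) (x := z (e n))) ?inner0l // => j; exact: e0.
Qed.

End cone.

(** * The spaces H_d, the truncated Lyapunov operator and the semigroup *)

Section galerkin_space.
Context {R : realType} {H : hilbertType R} {e : onb H}.
Implicit Types x y : HS e.

Lemma lin_span_add {E : lmodType R} (S : set E) (x : E) a (v : E) :
  lin_span S x -> S v -> lin_span S (x + a *: v).
Proof.
move=> [n [c [w [Sw ->]]]] Sv.
exists n.+1, (fun i => oapp c a (unlift ord0 i)), (fun i => oapp w v (unlift ord0 i)).
split=> [i|]; first by case: unliftP => [j _|_] //=.
rewrite big_ord_recl unlift_none /= addrC; congr (_ + _).
by apply: eq_bigr => i _; rewrite liftK.
Qed.

Lemma cutoff_calH d x : calH e d (cutoff d x).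
Proof.
rewrite /calH; set S := (X in lin_span X).
(* Adding an arbitrary y of the span lets the terms of the double sum be absorbed one at a time. *)
suff : forall y, lin_span S y -> lin_span S (y + cutoff d x).
  move=> /(_ 0); rewrite add0r; apply; exists 0%N, (fun=> 0), (fun=> 0).
  by split=> [[]//|]; rewrite big_ord0.
rewrite /cutoff /tri_ebasis /tri_sum; elim/big_ind : _ => [y|A B IA IB y Sy|j _]; first by rewrite addr0.
  by rewrite addrA; apply: IB; apply: IA.
elim/big_ind : _ => [y|A B IA IB y Sy|i _ y Sy]; first by rewrite addr0.
  by rewrite addrA; apply: IB; apply: IA.
by apply: lin_span_add => //; exists i, j; split=> //; rewrite -ltnS ltn_ord /=.
Qed.

Lemma ecoef_ext x y : (forall i j, (i <= j)%N -> ecoef x i j = ecoef y i j) -> x = y.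
Proof.
move=> xy; apply: (cvg_unique _ (@cutoff_cvg _ _ _ x)) => //.
rewrite (_ : (fun n => _) = fun n => cutoff n y); first exact: cutoff_cvg.
by apply/funext => n; apply: eq_tri_sum => i j /andP[ij _]; rewrite xy.
Qed.

Lemma cutoff_ebasis d i j : (i <= j < d)%N -> cutoff d (ebasis e i j) = ebasis e i j.
Proof.
move=> /andP[ij jd]; apply: ecoef_ext => k l kl; rewrite ecoef_cutoff //.
case: ifPn => // ld; rewrite /ecoef ebasis_orthonormal //.
rewrite (_ : j == l = false) ?andbF //.
by apply/negbTE; apply: contraNneq ld => <-.
Qed.

Lemma calH_cutoff d x : calH e d x -> cutoff d x = x.
Proof.
move=> [n [c [v [Sv ->]]]].
elim/big_rec : _ => [|i y _ IH].
  by apply: tri_sum0 => i j _; rewrite /ecoef inner0l scale0r.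
by rewrite cutoffD cutoffZ IH; have [k [l [kl ->]]] := Sv i; rewrite cutoff_ebasis.
Qed.

Lemma projHE d x : projH d x = cutoff d x.
Proof.
apply: xget_unique.
  split; first exact: cutoff_calH.
  by move=> z /calH_cutoff <-; rewrite -inner_cutoff cutoffB cutoff_idem // subrr inner0l.
move=> y [/calH_cutoff <- h]; apply: ecoef_ext => i j ij; rewrite !ecoef_cutoff //.
case: ifP => // jd; have := h (ebasis e i j).
have /[swap] /[apply] : calH e d (ebasis e i j).
  by rewrite -(@cutoff_ebasis d) ?ij //; exact: cutoff_calH.
rewrite innerBl -/(ecoef x i j) -[X in _ - X]/(ecoef (cutoff d y) i j) ecoef_cutoff // jd.
by move=> /eqP; rewrite subr_eq0 => /eqP.
Qed.

Lemma ecoefB x y i j : ecoef (x - y) i j = ecoef x i j - ecoef y i j.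
Proof. exact: innerBl. Qed.

Lemma ebasis_sum_finite d (c : nat -> nat -> R) :
  (forall i j, (i <= j)%N -> (d <= j)%N -> c i j = 0) -> ebasis_sum c = tri_ebasis d c :> HS e.
Proof.
move=> c0; apply: (cvg_lim (@norm_hausdorff _ _)).
apply: (@cvg_stationary _ _ _ _ d) => n dn.
rewrite (tri_sum_cond n (fun i j => c i j *: ebasis e i j)) -/(tri_ebasis n c) (tri_ebasis_widen _ dn).
apply: eq_tri_sum => i j /andP[ij _]; case: ltnP => // dj.
by rewrite c0.
Qed.

(** The increments of the series are dominated by those of [cutoff n x], which is a Cauchy sequence.
    The semigroup is the case where c multiplies the coefficients of x by factors in (0, 1]. *)
Lemma ebasis_sum_bounded (c : nat -> nat -> R) x :
  (forall i j, (i <= j)%N -> `|c i j| <= `|ecoef x i j|) ->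
  (forall i j, (i <= j)%N -> ecoef (ebasis_sum c : HS e) i j = c i j) /\
  `|ebasis_sum c : HS e| <= `|x|.
Proof.
move=> cx.
have E : (fun n => \sum_(j < n) \sum_(i < n | (i <= j)%N) c i j *: ebasis e i j) = fun n => tri_ebasis n c : HS e.
  by apply/funext => n; exact: (tri_sum_cond n (fun i j => c i j *: ebasis e i j)).
have sqle i j : (i <= j)%N -> c i j * c i j <= ecoef x i j * ecoef x i j.
  by move=> ij; rewrite -!expr2 -(real_normK (num_real (c i j))) -(real_normK (num_real (ecoef x i j))) lerXn2r ?nnegrE // cx.
have diff m n : (m <= n)%N -> `|tri_ebasis n c - tri_ebasis m c : HS e| <= `|cutoff n x - cutoff m x|.
  move=> mn; rewrite -(ler_pXn2r (n := 2)) ?nnegrE // -!inner_norm.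
  rewrite /cutoff !(tri_ebasis_widen _ mn) -!tri_ebasisB !inner_tri_ebasis2.
  apply: ler_tri_sum => i j /andP[ij _]; case: ifP => _; rewrite ?subrr ?subr0 //.
  exact: sqle.
have cv : cvgn (fun n => tri_ebasis n c : HS e).
  apply: cauchy_seq_cvg => eps eps0.
  have e2 : 0 < eps / 2 by rewrite divr_gt0.
  have [N hN] := cvg_seq_dist (@cutoff_cvg _ _ _ x) e2.
  have key m n : (N <= m)%N -> (m <= n)%N -> `|tri_ebasis n c - tri_ebasis m c : HS e| <= eps.
    move=> Nm mn; rewrite (le_trans (diff _ _ mn)) //.
    rewrite -(subrK x (cutoff n x)) -addrA (le_trans (ler_normD _ _)) //.
    rewrite [leRHS]splitr; apply: lerD; first exact: hN (leq_trans Nm mn).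
    by rewrite distrC; exact: hN.
  exists N => n m Nn Nm; have [mn|nm] := leqP m n; first exact: key.
  by rewrite distrC; apply: key => //; exact: ltnW.
have lE : (tri_ebasis n c : HS e) @[n --> \oo] --> (ebasis_sum c : HS e) by rewrite /ebasis_sum E.
split=> [i j ij|].
  have h : ⟨(tri_ebasis n c : HS e), ebasis e i j⟩ @[n --> \oo] --> c i j.
    apply: (@cvg_stationary _ _ _ _ j.+1) => n jn.
    by rewrite -/(ecoef _ i j) ecoef_tri_ebasis // jn.
  rewrite /ecoef; apply: (cvg_unique _ (@inner_cvg _ _ \oo _ _ (fun n => tri_ebasis n c) _ (ebasis e i j) lE) h).
  exact: Rhausdorff.
apply: (@cvg_le_cst _ _ \oo _ (fun n => `|tri_ebasis n c : HS e|)); first by apply: cvg_norm; exact: lE.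
near=> n; rewrite (le_trans _ (cutoff_le n x)) //.
rewrite -(ler_pXn2r (n := 2)) ?nnegrE // -!inner_norm !inner_tri_ebasis2.
by apply: ler_tri_sum => i j /andP[ij _]; exact: sqle.
Unshelve. all: by end_near. Qed.

Variable lam : nat -> R.
Hypothesis lam0 : forall i, 0 <= lam i.
Hypothesis lamS : {homo lam : i j / (i <= j)%N >-> i <= j}.

(** A bounded operator on all of [HS e] which agrees with L on H_d; Picard's iteration needs a field
    defined on the whole space. *)
Definition lyapunov_cutoff d x : HS e :=
  tri_ebasis d (fun i j => - lambda2 lam i j * ecoef x i j).

Lemma ecoef_lyapunov_cutoff d x i j : (i <= j < d)%N ->
  ecoef (lyapunov_cutoff d x) i j = - lambda2 lam i j * ecoef x i j.
Proof. by move=> /andP[ij jd]; rewrite ecoef_tri_ebasis // jd. Qed.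

Lemma lyapunov_calH d x : calH e d x -> lyapunov lam x = lyapunov_cutoff d x.
Proof.
move=> /calH_cutoff xd; rewrite /lyapunov (@ebasis_sum_finite d).
  by rewrite -scaleN1r -tri_ebasisZ; apply: eq_tri_sum => i j _; rewrite mulN1r mulNr.
by move=> i j ij dj; rewrite -/(ecoef x i j) -xd ecoef_cutoff // ltnNge dj mulr0.
Qed.

Lemma lyapunov_cutoff_calH d x : calH e d (lyapunov_cutoff d x).
Proof.
have := cutoff_calH d (lyapunov_cutoff d x); congr (calH e d _).
by apply: cutoff_tri.
Qed.

Lemma lyapunov_cutoffB d x y :
  lyapunov_cutoff d (x - y) = lyapunov_cutoff d x - lyapunov_cutoff d y.
Proof. by rewrite -tri_ebasisB; apply: eq_tri_sum => i j _; rewrite ecoefB mulrBr. Qed.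

Lemma lambda2_ge0 i j : 0 <= lambda2 lam i j.
Proof. by rewrite addr_ge0. Qed.

Lemma lyapunov_cutoff_le d x : `|lyapunov_cutoff d x| <= 2 * lam d * `|x|.
Proof.
have l0 : 0 <= 2 * lam d by rewrite mulr_ge0.
apply: (@le_trans _ _ (2 * lam d * `|cutoff d x|)); last by rewrite ler_wpM2l // cutoff_le.
rewrite -(ler_pXn2r (n := 2)) ?nnegrE ?mulr_ge0 // exprMn -!inner_norm !inner_tri_ebasis2.
rewrite -[_ * tri_sum _ _]/((2 * lam d) ^+ 2 *: tri_sum d (fun i j => ecoef x i j * ecoef x i j : R^o)).
rewrite -tri_sumZ; apply: ler_tri_sum => i j /andP[ij jd].
rewrite /GRing.scale /= -!expr2 exprMn ler_wpM2r ?sqr_ge0 // sqrrN.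
rewrite lerXn2r ?nnegrE ?lambda2_ge0 // /lambda2.
have := lamS (ltnW jd); have := lamS (leq_trans ij (ltnW jd)); lra.
Qed.

Lemma inner_lyapunov_cutoff d x y :
  ⟨lyapunov_cutoff d x, y⟩ = tri_sum d (fun i j => (- lambda2 lam i j * ecoef x i j * ecoef y i j : R^o)).
Proof. exact: inner_tri_ebasis. Qed.

(** The rate a is tested only where x has a coefficient: a = 0 serves for every x, and a = [lam m]
    for vectors without modes j < m. *)
Lemma lyapunov_cutoff_dissipative d x (a : R) :
  (forall i j, (i <= j)%N -> (j < d)%N -> ecoef x i j != 0 -> a <= lambda2 lam i j) ->
  cutoff d x = x -> ⟨lyapunov_cutoff d x, x⟩ <= - a * `|x| ^+ 2.
Proof.
move=> ha xd; rewrite inner_lyapunov_cutoff -{3}xd cutoff_sqr_norm inner_tri_ebasis.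
rewrite -[_ * tri_sum _ _]/((- a) *: tri_sum d (fun i j => ecoef x i j * ecoef x i j : R^o)).
rewrite -tri_sumZ; apply: ler_tri_sum => i j /andP[ij jd].
rewrite /GRing.scale /= -mulrA.
have [->|cN] := eqVneq (ecoef x i j) 0; first by rewrite !mulr0.
by rewrite ler_wpM2r ?lerN2 ?ha // -expr2 sqr_ge0.
Qed.

(* Conjugating x by the diagonal operator 1 + t B stays in the cone for every
   real t, so the pairing with y is a quadratic polynomial in t which is
   nonnegative and vanishes at 0; its linear coefficient is the claim. *)
Lemma lyapunov_cutoff_orthogonal d x y : Hplus e x -> Hplus e y ->
  cutoff d x = x -> ⟨x, y⟩ = 0 -> ⟨lyapunov_cutoff d x, y⟩ = 0.
Proof.
move=> xp yp xd xy.
pose c2 := tri_sum d (fun i j => (lam i * lam j * ecoef x i j * ecoef y i j : R^o)).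
have key t : 0 <= t * ⟨lyapunov_cutoff d x, y⟩ + t ^+ 2 * c2.
  have := Hplus_inner_ge0 (schur_Hplus (fun k => 1 - t * lam k) d xp) yp; congr (_ <= _).
  have xy0 : tri_sum d (fun i j => (ecoef x i j * ecoef y i j : R^o)) = 0.
    by rewrite -inner_tri_ebasis -/(cutoff d x) xd.
  rewrite inner_tri_ebasis inner_lyapunov_cutoff -[RHS]add0r -[in RHS]xy0.
  rewrite -[t * _]/(t *: tri_sum d (fun i j => - lambda2 lam i j * ecoef x i j * ecoef y i j : R^o)).
  rewrite -[t ^+ 2 * _]/(t ^+ 2 *: tri_sum d (fun i j => lam i * lam j * ecoef x i j * ecoef y i j : R^o)).
  rewrite -!tri_sumZ -!tri_sumD; apply: eq_tri_sum => i j _.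
  by rewrite /GRing.scale /= /lambda2; ring.
set c1 := ⟨_, _⟩ in key *.
have cp : 0 < `|c2| + 1 by rewrite ltr_wpDl.
(* As D exceeds c2, this t gives the quadratic polynomial the value - (c1 / D)^2 (D - c2), which
   forces c1 = 0. *)
have := key (- c1 / (`|c2| + 1)); have := ler_norm c2; move: cp.
set D := `|c2| + 1 => D0 cD.
rewrite (_ : _ + _ = - ((c1 / D) ^+ 2 * (D - c2))); last by field; rewrite gt_eqF.
rewrite oppr_ge0 pmulr_lle0 ?subr_gt0 ?(le_lt_trans cD) /D ?ltrDl // => h.
have : (c1 / D) ^+ 2 = 0 by apply/eqP; rewrite eq_le h sqr_ge0.
by move=> /eqP; rewrite sqrf_eq0 mulf_eq0 invr_eq0 (gt_eqF D0) orbF => /eqP.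
Qed.

Lemma semigroup_factor t i j : 0 <= t -> 0 < expR (- lambda2 lam i j * t) <= 1.
Proof.
move=> t0; rewrite expR_gt0 /= -expR0 ler_expR mulNr oppr_le0.
by rewrite mulr_ge0 ?lambda2_ge0.
Qed.

Lemma semigroup_spec t x : 0 <= t ->
  (forall i j, (i <= j)%N -> ecoef (semigroup lam t x) i j = expR (- lambda2 lam i j * t) * ecoef x i j) /\
  `|semigroup lam t x| <= `|x|.
Proof.
move=> t0; apply: ebasis_sum_bounded => i j ij.
have /andP[h0 h1] := semigroup_factor i j t0.
by rewrite normrM ger0_norm ?(ltW h0) // ler_piMl.
Qed.

Lemma semigroupB t x y : 0 <= t ->
  semigroup lam t (x - y) = semigroup lam t x - semigroup lam t y.
Proof.
move=> t0; apply: ecoef_ext => i j ij; rewrite ecoefB.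
by rewrite !(semigroup_spec _ t0).1 // ecoefB mulrBr.
Qed.

End galerkin_space.

(** * Differential inequalities and ordinary differential equations *)

Section derivative_on.
Context {R : realType}.

(** The first-order expansion involves no inverse and admits s = t; it is the working form of the
    derivative below. *)
Lemma derivative_onP {E : normedModType R} (T : R) (h : R -> E) t l :
  derivative_on T h t l <->
  forall eps, 0 < eps -> exists2 d, 0 < d & forall s, s \in `[0, T] ->
    `|s - t| < d -> `|h s - h t - (s - t) *: l| <= eps * `|s - t|.
Proof.
rewrite /derivative_on; split=> [/cvgrPdist_le hl eps eps0|hl].
  have := hl _ eps0; rewrite near_withinE => -[d /= d0 hd].
  exists d => // s sT st; have [->|sNt] := eqVneq s t.
    by rewrite !subrr scale0r subr0 !normr0 mulr0.
  have := hd s; rewrite /= distrC => /(_ st (conj sT sNt)).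
  have st0 : s - t != 0 by rewrite subr_eq0.
  rewrite -(ler_pM2r (x := `|s - t|)) ?normr_gt0 // mulrC -normrZ scalerBr scalerA.
  by rewrite mulfV // scale1r distrC.
apply/cvgrPdist_le => eps eps0; rewrite near_withinE.
have [d d0 hd] := hl _ eps0; exists d => // s /= st [sT sNt].
have st0 : s - t != 0 by rewrite subr_eq0.
rewrite -(ler_pM2r (x := `|s - t|)) ?normr_gt0 // mulrC -normrZ scalerBr scalerA.
rewrite mulfV // scale1r distrC; apply: hd => //.
by rewrite distrC.
Qed.

Lemma continuous_onP {E : normedModType R} (T : R) (h : R -> E) :
  {within `[0, T], continuous h} <->
  forall t, t \in `[0, T] -> forall eps, 0 < eps -> exists2 d, 0 < d &
    forall s, s \in `[0, T] -> `|s - t| < d -> `|h s - h t| <= eps.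
Proof.
split=> [/subspace_continuousP hc t tT eps eps0|hc].
  have /cvgrPdist_le /(_ _ eps0) := hc t tT.
  rewrite near_withinE => -[d /= d0 hd]; exists d => // s sT st.
  by rewrite distrC; apply: hd => //=; rewrite distrC.
apply/subspace_continuousP => t tT; apply/cvgrPdist_le => eps eps0.
rewrite near_withinE; have [d d0 hd] := hc t tT _ eps0.
by exists d => // s /= st sT; rewrite distrC; apply: hd => //; rewrite distrC.
Qed.

Lemma derivative_on_increment {E : normedModType R} (T : R) (h : R -> E) t l :
  derivative_on T h t l -> exists2 d, 0 < d & forall s, s \in `[0, T] ->
    `|s - t| < d -> `|h s - h t| <= (`|l| + 1) * `|s - t|.
Proof.
move=> /derivative_onP /(_ 1 ltr01)[d d0 hd]; exists d => // s sT st.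
rewrite -(subrK ((s - t) *: l) (h s - h t)) (le_trans (ler_normD _ _)) //.
rewrite normrZ mulrDl [leRHS]addrC [`|l| * _]mulrC lerD2r.
exact: hd.
Qed.

Lemma derivative_on_continuous {E : normedModType R} (T : R) (h h' : R -> E) :
  (forall t, t \in `[0, T] -> derivative_on T h t (h' t)) ->
  {within `[0, T], continuous h}.
Proof.
move=> hd; apply/continuous_onP => t tT eps eps0.
have [d d0 hd'] := derivative_on_increment (hd t tT).
have c0 : 0 < `|h' t| + 1 by rewrite ltr_wpDl.
exists (Num.min d (eps / (`|h' t| + 1))); first by rewrite lt_min d0 divr_gt0.
move=> s sT; rewrite lt_min => /andP[st1 st2].
rewrite (le_trans (hd' s sT st1)) // mulrC -ler_pdivlMr //.
exact: ltW.
Qed.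

(** A quadratic remainder bound stands for the differentiability of f. It covers the squared norm,
    linear functionals (C = 0) and the squared distance to a closed convex set. *)
Lemma derivative_on_chain {E : innerType R} (T : R) (c : R -> E) (f : E -> R)
    (g : E -> E) (C : R) t l :
  (forall x y, `|f y - f x - ⟨g x, y - x⟩| <= C * `|y - x| ^+ 2) ->
  derivative_on T c t l -> derivative_on T (f \o c) t ⟨g (c t), l⟩.
Proof.
move=> fq cl; apply/derivative_onP => eps eps0.
have [d0 d0p hd0] := derivative_on_increment cl.
set L := `|l| + 1 in hd0; set G := `|g (c t)| + 1.
have G0 : 0 < G by rewrite ltr_wpDl.
set Q := (`|C| * L ^+ 2 + 1).
have Q0 : 0 < Q by rewrite ltr_wpDl // mulr_ge0 ?sqr_ge0.
have e1 : 0 < eps / (2 * G) by rewrite divr_gt0 // mulr_gt0.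
have [d1 d1p hd1] := (derivative_onP _ _ _ _).1 cl _ e1.
(* Each error gets eps / 2: Q bounds the quadratic remainder of f, and G the factor in front of the
   remainder of c. *)
exists (Num.min d0 (Num.min d1 (eps / (2 * Q)))).
  by rewrite !lt_min d0p d1p divr_gt0 // mulr_gt0.
move=> s sT; rewrite !lt_min => /and3P[st0 st1 st2].
set r := s - t in st0 st1 st2 *.
rewrite /GRing.scale /=.
have -> : f (c s) - f (c t) - r * ⟨g (c t), l⟩ =
    (f (c s) - f (c t) - ⟨g (c t), c s - c t⟩) + ⟨g (c t), c s - c t - r *: l⟩.
  by rewrite [in X in _ = _ + X]innerBr innerZr; ring.
rewrite (le_trans (ler_normD _ _)) // [leRHS](_ : _ = (eps / 2 + eps / 2) * `|r|); last by field.
rewrite mulrDl lerD //.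
  rewrite (le_trans (fq _ _)) // (le_trans (y := `|C| * (L * `|r|) ^+ 2)) //.
    rewrite (le_trans (ler_wpM2r (sqr_ge0 _) (ler_norm C))) // ler_wpM2l //.
    by rewrite lerXn2r ?nnegrE ?mulr_ge0 ?addr_ge0 // hd0.
  rewrite exprMn mulrA [`|r| ^+ 2]expr2 mulrA ler_wpM2r //.
  rewrite (le_trans (y := Q * `|r|)) //; first by rewrite ler_wpM2r // lerDl.
  rewrite mulrC -ler_pdivlMr // (le_trans (ltW st2)) //.
  by rewrite le_eqVlt; apply/orP; left; apply/eqP; field; rewrite gt_eqF.
rewrite (le_trans (inner_cauchy_schwarz _ _)) //.
rewrite (le_trans (y := G * (eps / (2 * G) * `|r|))) //; last first.
  by rewrite mulrA ler_wpM2r // le_eqVlt; apply/orP; left; apply/eqP; field; rewrite gt_eqF.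
by apply: ler_pM => //; [rewrite lerDl|exact: hd1].
Qed.

Lemma derivative_on_sqr_norm {E : innerType R} (T : R) (c : R -> E) t l :
  derivative_on T c t l ->
  derivative_on T (fun s => `|c s| ^+ 2) t (2 * ⟨c t, l⟩).
Proof.
move=> cl; have := @derivative_on_chain E T c (fun x => `|x| ^+ 2) (fun x => 2 *: x) 1 t l _ cl.
rewrite innerZl; apply=> x y.
rewrite (_ : _ - _ - _ = `|y - x| ^+ 2) ?mul1r ?ger0_norm ?sqr_ge0 //.
by rewrite sqr_normB innerZl innerBr inner_norm (innerC y); ring.
Qed.

Lemma derivative_on_inner {E : innerType R} (T : R) (c : R -> E) z t l :
  derivative_on T c t l -> derivative_on T (fun s => ⟨c s, z⟩) t ⟨l, z⟩.
Proof.
move=> cl; have := @derivative_on_chain E T c (fun x => ⟨x, z⟩) (fun=> z) 0 t l _ cl.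
rewrite innerC; apply=> x y.
by rewrite mul0r [⟨z, _⟩]innerC innerBl subrr normr0.
Qed.

Lemma derivative_onB {E : normedModType R} (T : R) (c d : R -> E) t l k :
  derivative_on T c t l -> derivative_on T d t k ->
  derivative_on T (fun s => c s - d s) t (l - k).
Proof.
move=> cl dk; rewrite /derivative_on.
rewrite (_ : (fun s => _) = (fun s => (s - t)^-1 *: (c s - c t) - (s - t)^-1 *: (d s - d t))).
  exact: cvgB.
apply/funext => s; rewrite -scalerBr; congr (_ *: _).
by rewrite !opprB addrACA [RHS]addrACA (addrC (- d s)).
Qed.

Lemma derivative_on_bounded_linear {E F : normedModType R} (A : E -> F) (C : R) (T : R) (c : R -> E) t l :
  (forall x y, A (x - y) = A x - A y) -> (forall a x, A (a *: x) = a *: A x) ->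
  (forall x, `|A x| <= C * `|x|) ->
  derivative_on T c t l -> derivative_on T (fun s => A (c s)) t (A l).
Proof.
move=> AB AZ AC /derivative_onP cl; apply/derivative_onP => eps eps0.
have C0 : 0 < `|C| + 1 by rewrite ltr_wpDl.
have [|d d0 hd] := cl (eps / (`|C| + 1)); first by rewrite divr_gt0.
exists d => // s sT st; rewrite -AB -AZ -AB (le_trans (AC _)) //.
rewrite (le_trans (y := (`|C| + 1) * `|c s - c t - (s - t) *: l|)) //.
  by rewrite ler_wpM2r // (le_trans (ler_norm C)) // lerDl.
rewrite -ler_pdivlMl // mulrA [_^-1 * _]mulrC.
exact: hd.
Qed.

Lemma derivative_on_is_derive (T : R) (h : R -> R) t l :
  0 < t < T -> derivative_on T h t l -> is_derive t 1 h l.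
Proof.
move=> /andP[t0 tT] hl.
suff cv : (fun x => x^-1 *: (h (x *: 1 + t) - h t)) @ 0^' --> l.
  by split; [apply/cvg_ex; exists l|apply: cvg_lim].
apply/cvgrPdist_le => eps eps0.
have [d d0 hd] := (derivative_onP _ _ _ _).1 hl _ eps0.
pose d' := Num.min d (Num.min t (T - t)).
exists d'; first by rewrite /= !lt_min d0 t0 subr_gt0.
move=> x /=; rewrite distrC subr0 /d' !lt_min => /and3P[xd xt xT] x0.
rewrite /GRing.scale /= mulr1 (addrC x).
have := hd (t + x); rewrite addrAC subrr add0r => /(_ _ xd) h1.
rewrite -(ler_pM2r (x := `|x|)) ?normr_gt0 // mulrC -normrM mulrBr mulrA mulfV // mul1r.
rewrite distrC; apply: h1.
move: xt xT; rewrite !ltr_norml in_itv /= => /andP[? ?] /andP[? ?].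
by apply/andP; split; lra.
Qed.

(** The shift by b / a makes the inequality homogeneous, and the factor exp(- a t) then makes the
    left side nonincreasing. The rate may be negative, which is how damping is exploited. *)
Lemma gronwall (T a b : R) (y y' : R -> R) : a != 0 ->
  (forall t, t \in `[0, T] -> derivative_on T y t (y' t)) ->
  (forall t, t \in `[0, T] -> y' t <= a * y t + b) ->
  forall t, t \in `[0, T] -> y t + b / a <= expR (a * t) * (y 0 + b / a).
Proof.
move=> aN0 yd yle t tT.
move: (tT); rewrite in_itv /= => /andP[t0 tT'].
have cy := derivative_on_continuous yd.
pose w s := expR (- a * s) * (y s + b / a).
have dw x : 0 < x < T -> is_derive x 1 w (expR (- a * x) * (y' x - a * y x - b)).
  move=> xT; have xT' : x \in `[0, T].
    by rewrite in_itv /=; case/andP: xT => *; apply/andP; split; exact: ltW.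
  have := derivative_on_is_derive xT (yd x xT') => dy.
  rewrite /w; apply: is_derive_eq.
  rewrite /GRing.scale /=; field.
  by [].
have cw : {within `[0, t], continuous w}.
  have sub : `[0, t]%classic `<=` `[0, T]%classic.
    by move=> s /=; rewrite !in_itv /= => /andP[-> /= st]; exact: le_trans st tT'.
  apply: (continuous_subspaceW sub) => s.
  apply: cvgM; last by apply: cvgD; [exact: cy|exact: cvg_cst].
  apply: continuous_subspaceT => r.
  apply: continuous_comp; last exact: continuous_expR.
  by apply: cvgMr; exact: cvg_id.
have : w t <= w 0.
  apply: (@ler0_derive1_nincr _ _ 0 t) => // x; rewrite in_itv /= => /andP[x0 xt].
    by have [] := dw x; [rewrite x0 (lt_le_trans xt)|].
  have xT : 0 < x < T by rewrite x0 (lt_le_trans xt).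
  rewrite derive1E (@derive_val _ _ _ _ _ _ _ (dw x xT)).
  rewrite pmulr_rle0 ?expR_gt0 // -addrA -opprD subr_le0.
  apply: yle; rewrite in_itv /= (ltW x0) /= ltW //; by case/andP: xT.
rewrite /w mulr0 expR0 mul1r mulNr expRN => h.
by rewrite -ler_pdivrMl ?expR_gt0.
Qed.

Lemma gronwall0 (T a : R) (y y' : R -> R) : 0 < a ->
  (forall t, t \in `[0, T] -> derivative_on T y t (y' t)) ->
  (forall t, t \in `[0, T] -> y' t <= a * y t) -> y 0 <= 0 ->
  forall t, t \in `[0, T] -> y t <= 0.
Proof.
move=> a0 yd yle y0 t tT.
have := @gronwall T a 0 y y' _ yd _ t tT; rewrite mul0r !addr0.
move=> /(_ (lt0r_neq0 a0)) h; apply: (le_trans (h _)) => [s sT|].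
  by rewrite addr0; exact: yle.
by rewrite pmulr_rle0 ?expR_gt0.
Qed.

End derivative_on.

Section clamp.
Context {R : realType} (T : R).
Hypothesis T0 : 0 < T.

(** Composition with the clamp freezes a function outside [0, T], so that continuity on [0, T]
    becomes continuity on the line. *)
Definition clamp (t : R) : R := if t <= 0 then 0 else if T <= t then T else t.

Lemma clamp_itv t : clamp t \in `[0, T].
Proof.
rewrite in_itv /= /clamp; case: ifPn => [_|]; first by rewrite lexx ltW.
rewrite -ltNge => t0; case: ifPn => [_|]; first by rewrite lexx ltW.
by rewrite -ltNge => tT; rewrite !ltW.
Qed.

Lemma clamp_id t : t \in `[0, T] -> clamp t = t.
Proof.
rewrite in_itv /= /clamp => /andP[t0 tT]; case: ifPn => [h|_].
  by apply/eqP; rewrite eq_le t0 h.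
by case: ifPn => // h; apply/eqP; rewrite eq_le tT h.
Qed.

Lemma clamp_dist s t : `|clamp s - clamp t| <= `|s - t|.
Proof.
have := T0; rewrite /clamp.
do ![case: ifPn => [?|]; [|rewrite -ltNge => ?]] => ?;
  rewrite ler_norml; have := ler_norm (s - t); have := ler_norm (- (s - t));
  rewrite normrN; set r := `|_| => *; apply/andP; split; lra.
Qed.

Lemma continuous_clamp {E : normedModType R} (h : R -> E) :
  {within `[0, T], continuous h} -> continuous (h \o clamp).
Proof.
move=> /continuous_onP hc t; apply/cvgrPdist_le => eps eps0.
have [d d0 hd] := hc _ (clamp_itv t) _ eps0.
exists d => // s /= st; rewrite distrC hd ?clamp_itv //.
by rewrite (le_lt_trans (clamp_dist _ _)) // distrC.
Qed.

Lemma continuous_bounded {E : normedModType R} (h : R -> E) :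
  {within `[0, T], continuous h} ->
  exists2 M, 0 <= M & forall t, t \in `[0, T] -> `|h t| <= M.
Proof.
move=> hc; have := @EVT_max _ (fun t => `|h t|) 0 T (ltW T0) _.
case=> [|c cT hm]; last by exists `|h c|.
by move=> t; apply: cvg_norm; exact: hc.
Qed.

End clamp.

(** * Scalar and weak Hilbert-valued integrals *)

Section integrals.
Context {R : realType}.
Local Notation leb := (@lebesgue_measure R).

Lemma itv_measure (s t : R) : s <= t -> fine (leb `[s, t]%classic) = t - s.
Proof.
move=> st; rewrite lebesgue_measure_itv /= lte_fin.
case: ifPn => //; rewrite -leNgt => ts.
by have -> : s = t; [apply/eqP; rewrite eq_le st ts|rewrite subrr].
Qed.

Lemma continuous_integrable (h : R -> R) (s t : R) : continuous h ->
  leb.-integrable `[s, t] (EFin \o h).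
Proof.
move=> hc; apply: continuous_compact_integrable; first exact: segment_compact.
exact: continuous_subspaceT.
Qed.

Lemma Rintegral_le_cst (h : R -> R) (s t C : R) : s <= t -> continuous h ->
  (forall r, r \in `[s, t] -> `|h r| <= C) ->
  `|\int[leb]_(r in `[s, t]) h r| <= C * (t - s).
Proof.
move=> st hc hC; rewrite (le_trans (le_normr_Rintegral _ _)) //.
  exact: continuous_integrable.
rewrite -itv_measure // -Rintegral_cst //; apply: le_Rintegral => //.
- apply: (@continuous_integrable (fun r => `|h r|)) => r.
  by apply: cvg_norm; exact: hc.
- apply: (@continuous_integrable (fun=> C)) => r; exact: cvg_cst.
Qed.

(** The quantitative core of the fundamental theorem, stated for s <= t so that it serves both sides
    of a point. *)
Lemma Rintegral_increment (h : R -> R) (s t c eps : R) : continuous h ->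
  0 <= s -> s <= t -> (forall r, r \in `[s, t] -> `|h r - c| <= eps) ->
  `|\int[leb]_(r in `[0, t]) h r - \int[leb]_(r in `[0, s]) h r - (t - s) * c|
    <= eps * (t - s).
Proof.
move=> hc s0 st hC; rewrite Rintegral_itvB; last 3 first.
- exact: continuous_integrable.
- by rewrite bnd_simp.
- by rewrite bnd_simp.
rewrite Rintegral_itv_obnd_cbnd; last first.
  apply: (integrableS _ _ _ (@continuous_integrable h s t hc)) => //.
  exact: subset_itv_oc_cc.
rewrite [_ * c]mulrC -itv_measure // -Rintegral_cst // -RintegralB //.
- rewrite itv_measure //; apply: Rintegral_le_cst => // r.
  by apply: cvgB; [exact: hc|exact: cvg_cst].
- exact: continuous_integrable.
- apply: (@continuous_integrable (fun=> c)) => r; exact: cvg_cst.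
Qed.

Lemma derivative_on_integral (T : R) (h : R -> R) t : continuous h ->
  t \in `[0, T] ->
  derivative_on T (fun s => \int[leb]_(r in `[0, s]) h r) t (h t).
Proof.
move=> hc tT; apply/derivative_onP => eps eps0.
have /cvgrPdist_le /(_ _ eps0) [d /= d0 hd] := hc t.
exists d => // s sT st.
move: (tT) (sT); rewrite !in_itv /= => /andP[t0 _] /andP[s0 _].
have near r : `|r - t| < d -> `|h r - h t| <= eps.
  by move=> rt; rewrite distrC; apply: hd; rewrite /= distrC.
rewrite /GRing.scale /=.
have [ts|/ltW ts] := leP t s.
  rewrite (ger0_norm (x := s - t)) ?subr_ge0 //; apply: Rintegral_increment => // r.
  rewrite in_itv /= => /andP[tr rs]; apply: near; rewrite ger0_norm ?subr_ge0 //.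
  by move: st; rewrite ger0_norm ?subr_ge0 //; apply: le_lt_trans; rewrite lerD2r.
rewrite (distrC s t) (ger0_norm (x := t - s)) ?subr_ge0 // -normrN.
rewrite (_ : - _ = \int[leb]_(r in `[0, t]) h r - \int[leb]_(r in `[0, s]) h r - (t - s) * h t); last by ring.
apply: Rintegral_increment => // r.
rewrite in_itv /= => /andP[sr rt]; apply: near; rewrite distrC ger0_norm ?subr_ge0 //.
by move: st; rewrite distrC ger0_norm ?subr_ge0 //; apply: le_lt_trans; rewrite lerD2l lerN2.
Qed.

Context {E : hilbertType R}.

(** The integral is the Riesz representer of the bounded functional that sends z to the scalar
    integral of [⟨h s, z⟩]. *)
Lemma hilbert_integral_exists (h : R -> E) (T : R) : 0 < T -> continuous h ->
  exists I : R -> E, forall t z, t \in `[0, T] ->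
    ⟨I t, z⟩ = \int[leb]_(s in `[0, t]) ⟨h s, z⟩.
Proof.
move=> T0 hc.
have hcz z : continuous (fun s => ⟨h s, z⟩) by move=> s; apply: inner_cvg; exact: hc.
have [M M0 hM] : exists2 M, 0 <= M & forall t, t \in `[0, T] -> `|h t| <= M.
  by apply: continuous_bounded => //; exact: continuous_subspaceT.
suff /choice[I IP] : forall t, exists y : E, t \in `[0, T] -> forall z,
    ⟨y, z⟩ = \int[leb]_(s in `[0, t]) ⟨h s, z⟩.
  by exists I => t z tT; exact: IP.
move=> t; have [tT|tT] := boolP (t \in `[0, T]); last by exists 0.
move: (tT); rewrite in_itv /= => /andP[t0 tT'].
have [||y yP] := @riesz_representation R E (fun z => \int[leb]_(s in `[0, t]) ⟨h s, z⟩) (M * (t - 0)).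
- move=> a x y; rewrite -RintegralZl //; last exact: continuous_integrable.
  rewrite -RintegralD //; last 2 first.
  + apply: (@continuous_integrable (fun s => a * ⟨h s, x⟩)) => s.
    by apply: cvgMr; exact: hcz.
  + exact: continuous_integrable.
  by apply: eq_Rintegral => s _; rewrite innerDr innerZr.
- move=> z; rewrite mulrAC; apply: Rintegral_le_cst => // s.
  rewrite in_itv /= => /andP[s0 st]; rewrite (le_trans (inner_cauchy_schwarz _ _)) //.
  by rewrite ler_wpM2r // hM // in_itv /= s0 (le_trans st).
by exists y => _ z; rewrite yP.
Qed.

(** The modulus of continuity of h controls the error uniformly in the test vector; testing the
    remainder against itself gives a derivative in norm. *)
Lemma derivative_on_hilbert_integral (h : R -> E) (T : R) (I : R -> E) x0 :
  continuous h ->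
  (forall t z, t \in `[0, T] -> ⟨I t, z⟩ = ⟨x0, z⟩ + \int[leb]_(s in `[0, t]) ⟨h s, z⟩) ->
  forall t, t \in `[0, T] -> derivative_on T I t (h t).
Proof.
move=> hc IP t tT; apply/derivative_onP => eps eps0.
have hcz z : continuous (fun s => ⟨h s, z⟩) by move=> s; apply: inner_cvg; exact: hc.
have /cvgrPdist_le /(_ _ eps0) [d /= d0 hd] := hc t.
exists d => // s sT st.
move: (tT) (sT); rewrite !in_itv /= => /andP[t0 _] /andP[s0 _].
have near r z : `|r - t| < d -> `|⟨h r, z⟩ - ⟨h t, z⟩| <= eps * `|z|.
  move=> rt; rewrite -innerBl (le_trans (inner_cauchy_schwarz _ _)) // ler_wpM2r //.
  by rewrite distrC; apply: hd; rewrite /= distrC.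
apply: norm_le_inner; first by rewrite mulr_ge0 // ltW.
set v := (X in ⟨X, _⟩).
suff key w : ⟨v, w⟩ <= eps * `|s - t| * `|w| by exact: key.
rewrite (le_trans (ler_norm _)) // /v !innerBl innerZl !IP //.
rewrite (_ : _ - _ - _ = \int[leb]_(r in `[0, s]) ⟨h r, w⟩ - \int[leb]_(r in `[0, t]) ⟨h r, w⟩ - (s - t) * ⟨h t, w⟩); last by ring.
rewrite mulrAC.
have [ts|/ltW ts] := leP t s.
  rewrite (ger0_norm (x := s - t)) ?subr_ge0 //; apply: Rintegral_increment => // r.
  rewrite in_itv /= => /andP[tr rs]; apply: near; rewrite ger0_norm ?subr_ge0 //.
  by move: st; rewrite ger0_norm ?subr_ge0 //; apply: le_lt_trans; rewrite lerD2r.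
rewrite (distrC s t) (ger0_norm (x := t - s)) ?subr_ge0 //.
rewrite (_ : _ - _ - _ = - (\int[leb]_(r in `[0, t]) ⟨h r, w⟩ - \int[leb]_(r in `[0, s]) ⟨h r, w⟩ - (t - s) * ⟨h t, w⟩)); last by ring.
rewrite normrN.
apply: Rintegral_increment => // r.
rewrite in_itv /= => /andP[sr rt]; apply: near; rewrite distrC ger0_norm ?subr_ge0 //.
by move: st; rewrite distrC ger0_norm ?subr_ge0 //; apply: le_lt_trans; rewrite lerD2l lerN2.
Qed.

End integrals.

(** * Picard's iteration *)

Section picard.
Context {R : realType} {E : hilbertType R}.
Local Notation leb := (@lebesgue_measure R).

Lemma continuous_uniform_limit {F : normedModType R} (f : nat -> R -> F) (g : R -> F) :
  (forall n, continuous (f n)) ->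
  (forall eps, 0 < eps -> exists n, forall t, `|f n t - g t| <= eps) ->
  continuous g.
Proof.
move=> fc fg t; apply/cvgrPdist_le => eps eps0.
have e3 : 0 < eps / 3 by rewrite divr_gt0.
have [n hn] := fg _ e3.
have /cvgrPdist_le /(_ _ e3) := fc n t; apply: filterS => s hs.
rewrite (_ : g t - g s = (g t - f n t) + ((f n t - f n s) + (f n s - g s))); last first.
  by rewrite !addrA !subrK.
rewrite [leRHS](_ : _ = eps / 3 + (eps / 3 + eps / 3)); last by field.
rewrite (le_trans (ler_normD _ _)) // lerD //; first by rewrite distrC.
by rewrite (le_trans (ler_normD _ _)) // lerD.
Qed.

Lemma Rintegral_le_exp (h : R -> R) (t a C : R) : 0 <= t -> 0 < a -> continuous h ->
  (forall r, r \in `[0, t] -> h r <= a * C * expR (a * r)) ->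
  \int[leb]_(r in `[0, t]) h r <= C * (expR (a * t) - 1).
Proof.
move=> t0 a0 hc hC.
have ce (c : R) : continuous (fun r : R => c * expR (a * r)).
  move=> r; apply: cvgMr; apply: continuous_comp; last exact: continuous_expR.
  by apply: cvgMr; exact: cvg_id.
rewrite (@le_trans _ _ (\int[leb]_(r in `[0, t]) (a * C * expR (a * r)))) //.
  apply: le_Rintegral => //; first exact: continuous_integrable.
  by apply: continuous_integrable; exact: ce.
have [->|tN0] := eqVneq t 0.
  by rewrite set_itv1 Rintegral_set1 mulr0 expR0 subrr mulr0.
have tp : 0 < t by rewrite lt_neqAle eq_sym tN0.
have dF (x : R) : is_derive x 1 (fun r : R => C * expR (a * r)) (a * C * expR (a * x)).
  by apply: is_derive_eq; rewrite /GRing.scale /=; ring.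
rewrite /Rintegral (@continuous_FTC2 _ _ (fun r => C * expR (a * r)) 0 t) //=.
- by rewrite mulr0 expR0 mulr1 mulrBr mulr1.
- exact: continuous_subspaceT.
- split; first by move=> x _; have [] := dF x.
  + by apply: cvg_at_right_filter; exact: ce.
  + by apply: cvg_at_left_filter; exact: ce.
- by move=> x _; rewrite derive1E (@derive_val _ _ _ _ _ _ _ (dF x)).
Qed.

Lemma lipschitz_continuous {F1 F2 : normedModType R} (G : F1 -> F2) (K : R) :
  0 <= K -> (forall x y, `|G x - G y| <= K * `|x - y|) -> continuous G.
Proof.
move=> K0 GK x; apply/cvgrPdist_le => eps eps0.
have K1 : 0 < K + 1 by rewrite ltr_wpDl.
near=> y; rewrite (le_trans (GK _ _)) // (le_trans (y := (K + 1) * `|x - y|)) //.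
  by rewrite ler_wpM2r // lerDl.
rewrite -ler_pdivlMl //; near: y.
by apply: cvgr_dist_le; [exact: cvg_id|rewrite mulr_gt0 ?invr_gt0].
Unshelve. all: by end_near. Qed.

(** A global Lipschitz constant and an exponential weight give the solution on all of [0, T] at
    once. The integral equation is kept in weak form until the limit is reached. *)
Lemma picard_lindelof (G : E -> E) (K T : R) (x0 : E) : 0 < K -> 0 < T ->
  (forall x y, `|G x - G y| <= K * `|x - y|) ->
  exists psi : R -> E, psi 0 = x0 /\
    forall t, t \in `[0, T] -> derivative_on T psi t (G (psi t)).
Proof.
move=> K0 T0 GK.
have Gc : continuous G by apply: (lipschitz_continuous (ltW K0)).
have comp (psi : R -> E) : continuous psi -> continuous (G \o psi).
  by move=> pc t; apply: continuous_comp; [exact: pc|exact: Gc].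
have zT : 0 \in `[0, T] by rewrite in_itv /= lexx ltW.
pose sol (psi psi' : R -> E) := forall t z, t \in `[0, T] ->
  ⟨psi' t, z⟩ = ⟨x0, z⟩ + \int[leb]_(s in `[0, t]) ⟨G (psi s), z⟩.
(* The choice ranges over all psi, so the properties are conditional on continuity; clamping the new
   iterate makes it continuous on the whole line. *)
have /choice[step stepP] : forall psi : R -> E, exists psi' : R -> E,
    continuous psi -> [/\ continuous psi', forall t, psi' t = psi' (clamp T t) & sol psi psi'].
  move=> psi; have [pc|pN] := pselect (continuous psi); last by exists (fun=> 0) => /pN.
  have [I IP] := hilbert_integral_exists T0 (comp _ pc).
  have I'P : sol psi (fun t => x0 + I t).
    by move=> t z tT; rewrite innerDl IP.
  have cI : {within `[0, T], continuous (fun t => x0 + I t)}.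
    apply: (@derivative_on_continuous _ _ _ _ (G \o psi)).
    exact: derivative_on_hilbert_integral (comp _ pc) I'P.
  exists ((fun t => x0 + I t) \o clamp T) => _; split.
  - exact: continuous_clamp.
  - by move=> t /=; rewrite (clamp_id (t := clamp T t)) // clamp_itv.
  - by move=> t z tT /=; rewrite clamp_id // I'P.
pose u n := iter n step (fun=> x0).
have uc n : continuous (u n).
  elim: n => [|n IH] /=; first by move=> t; exact: cvg_cst.
  by have [] := stepP _ IH.
have uclamp n t : u n t = u n (clamp T t).
  by case: n => [//|n] /=; have [_ h _] := stepP _ (uc n); exact: h.
have usol n : sol (u n) (u n.+1) by have [] := stepP _ (uc n).
have uint n z : continuous (fun s => ⟨G (u n s), z⟩).
  by move=> s; apply: inner_cvg; exact: comp.
have [A A0 hA] : exists2 A, 0 <= A & forall t, t \in `[0, T] -> `|u 1%N t - u 0%N t| <= A.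
  apply: (continuous_bounded T0 (h := fun t => u 1%N t - u 0%N t)); apply: continuous_subspaceT => t.
  by apply: cvgB; exact: uc.
(* The weight exp(2 K t) loses a factor 2 K when integrated, against the Lipschitz constant K: each
   iteration gains 1/2. *)
have udist n t : t \in `[0, T] -> `|u n.+1 t - u n t| <= A * 2^-1 ^+ n * expR (2 * K * t).
  elim: n t => [|n IH] t tT.
    rewrite expr0 mulr1 (le_trans (hA t tT)) // ler_peMr // -expR0 ler_expR.
    by move: tT; rewrite in_itv /= => /andP[? _]; rewrite !mulr_ge0 // ltW.
  move: (tT); rewrite in_itv /= => /andP[t0 tT'].
  apply: norm_le_inner; first by rewrite !mulr_ge0 ?expR_ge0 ?exprn_ge0 ?invr_ge0.
  suff key v : ⟨u n.+2 t - u n.+1 t, v⟩ <= A * 2^-1 ^+ n.+1 * expR (2 * K * t) * `|v| by exact: key.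
  rewrite innerBl !usol // opprD addrACA subrr add0r -RintegralB //; last 2 first.
  - exact: continuous_integrable.
  - exact: continuous_integrable.
  apply: (@le_trans _ _ (A * 2^-1 ^+ n.+1 * `|v| * (expR (2 * K * t) - 1))); last first.
    rewrite mulrAC ler_wpM2r // ler_wpM2l ?mulr_ge0 ?exprn_ge0 ?invr_ge0 //.
    by rewrite gerBl.
  apply: Rintegral_le_exp => //; first by rewrite mulr_gt0.
    by move=> s; apply: cvgB; exact: uint.
  move=> s; rewrite in_itv /= => /andP[s0 st].
  have sT : s \in `[0, T] by rewrite in_itv /= s0 (le_trans st).
  rewrite -innerBl (le_trans (inner_le_norm _ _)) //.
  rewrite (_ : 2 * K * _ * _ = K * (A * 2^-1 ^+ n * expR (2 * K * s)) * `|v|); last first.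
    by rewrite exprS; field.
  rewrite ler_wpM2r // (le_trans (GK _ _)) // ler_wpM2l ?(ltW K0) //.
  exact: IH.
set A' := A * expR (2 * K * T).
have A'0 : 0 <= A' by rewrite mulr_ge0 ?expR_ge0.
have ustep n t : `|u n.+1 t - u n t| <= A' * 2^-1 ^+ n.
  rewrite (uclamp n) (uclamp n.+1); have tT := clamp_itv T0 t.
  rewrite (le_trans (udist n _ tT)) // /A' mulrAC ler_wpM2r ?exprn_ge0 ?invr_ge0 //.
  rewrite ler_wpM2l // ler_expR ler_wpM2l ?mulr_ge0 ?(ltW K0) //.
  by move: tT; rewrite in_itv /= => /andP[].
(* The subtracted tail makes the induction on m close; it is dropped in [umn']. *)
have umn n m t : (n <= m)%N -> `|u m t - u n t| <= 2 * A' * 2^-1 ^+ n - 2 * A' * 2^-1 ^+ m.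
  elim: m => [|m IH]; first by rewrite leqn0 => /eqP ->; rewrite !subrr normr0.
  rewrite leq_eqVlt => /orP[/eqP <-|]; first by rewrite !subrr normr0.
  rewrite ltnS => nm; rewrite -(subrK (u m t) (u m.+1 t)) -addrA (le_trans (ler_normD _ _)) //.
  have := ustep m t; have := IH nm; rewrite exprS.
  set a := `|_|; set c := `|_|; set p := _ ^+ n; set q := _ ^+ m => h1 h2; lra.
have umn' n m t : (n <= m)%N -> `|u m t - u n t| <= 2 * A' * 2^-1 ^+ n.
  move=> nm; rewrite (le_trans (umn n m t nm)) // gerBl.
  by rewrite !mulr_ge0 ?exprn_ge0 ?invr_ge0.
have small eps : 0 < eps -> exists N, 2 * A' * 2^-1 ^+ N <= eps.
  move=> eps0; have : (fun n => 2 * A' * 2^-1 ^+ n) @ \oo --> 2 * A' * 0.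
    apply: cvgMr; apply: cvg_expr; rewrite ger0_norm ?invr_ge0 //; lra.
  rewrite mulr0 => /cvg_seq_dist /(_ eps0)[N hN]; exists N.
  by have := hN N (leqnn _); rewrite subr0; apply: le_trans; exact: ler_norm.
have ucvg t : cvgn (fun n => u n t).
  apply: cauchy_seq_cvg => eps eps0.
  have [|N hN] := small (eps / 2); first by rewrite divr_gt0.
  exists N => n m Nn Nm; rewrite -(subrK (u N t) (u n t)) -addrA (le_trans (ler_normD _ _)) //.
  rewrite [leRHS]splitr lerD //; first exact: le_trans (umn' _ _ _ Nn) hN.
  by rewrite distrC; exact: le_trans (umn' _ _ _ Nm) hN.
pose psi t := limn (fun n => u n t).
have psi_dist n t : `|u n t - psi t| <= 2 * A' * 2^-1 ^+ n.
  apply: (@cvg_le_cst _ _ \oo _ (fun m => `|u n t - u m t|)).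
    by apply: cvg_norm; apply: cvgB; [exact: cvg_cst|exact: ucvg].
  by exists n => // m /= nm; rewrite distrC; exact: umn'.
have psic : continuous psi.
  apply: (continuous_uniform_limit uc) => eps eps0.
  by have [N hN] := small _ eps0; exists N => t; exact: le_trans (psi_dist N t) hN.
have psisol : sol psi psi.
  move=> t z tT; move: (tT); rewrite in_itv /= => /andP[t0 tT'].
  apply/eqP; rewrite -subr_eq0 -normr_le0; apply/ler_addgt0Pr => eps eps0.
  (* [|z|] pays for replacing the iterate at time t, [K * |z| * T] for replacing it under the
     integral, and 1 keeps D positive. *)
  set D := `|z| + K * `|z| * T + 1.
  have D0 : 0 < D by rewrite ltr_wpDl // addr_ge0 // !mulr_ge0 // ltW.
  have [|N hN] := small (eps / D); first by rewrite divr_gt0.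
  have h1 : `|⟨u N.+1 t - psi t, z⟩| <= eps / D * `|z|.
    rewrite (le_trans (inner_cauchy_schwarz _ _)) // ler_wpM2r //.
    rewrite (le_trans (psi_dist _ _)) // (le_trans _ hN) // ler_wpM2l ?mulr_ge0 //.
    by rewrite exprS ler_piMl ?exprn_ge0 ?invr_ge0 // invf_le1 // ler1n.
  have cpsi z' : continuous (fun s => ⟨G (psi s), z'⟩).
    by move=> s; apply: inner_cvg; exact: comp.
  have h2 : `|\int[leb]_(s in `[0, t]) (⟨G (u N s), z⟩ - ⟨G (psi s), z⟩)| <=
      K * (eps / D) * `|z| * (t - 0).
    apply: Rintegral_le_cst => //; first by move=> s; apply: cvgB; [exact: uint|exact: cpsi].
    move=> s _; rewrite -innerBl (le_trans (inner_cauchy_schwarz _ _)) // ler_wpM2r //.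
    rewrite (le_trans (GK _ _)) // ler_wpM2l ?(ltW K0) //.
    exact: le_trans (psi_dist _ _) hN.
  move: h2; rewrite RintegralB //; last 2 first.
  - exact: continuous_integrable.
  - exact: continuous_integrable.
  move: h1; rewrite innerBl usol //.
  set I1 := Rintegral _ _ _; set I2 := Rintegral _ _ _ => h1 h2.
  rewrite add0r (_ : _ - _ = - (⟨x0, z⟩ + I1 - ⟨psi t, z⟩) + (I1 - I2)); last by ring.
  rewrite (le_trans (ler_normD _ _)) // normrN (le_trans (lerD h1 h2)) //.
  rewrite subr0 (_ : _ + _ = eps / D * (`|z| + K * `|z| * t)); last by ring.
  rewrite mulrAC ler_pdivrMr // ler_wpM2l ?(ltW eps0) // /D -addrA lerD2l.
  by rewrite ler_wpDr // ler_wpM2l // mulr_ge0 // ltW.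
exists psi; split.
  by apply: inner_ext => z; rewrite psisol // set_itv1 Rintegral_set1 addr0.
exact: derivative_on_hilbert_integral (comp _ psic) psisol.
Qed.

End picard.

(** * The jump integrals *)

Section exp_inequalities.
Context {R : realType}.
Implicit Types s t : R.

Lemma expRN_lipschitz s t : 0 <= s -> 0 <= t ->
  `|expR (- s) - expR (- t)| <= `|s - t|.
Proof.
wlog st : s t / s <= t.
  move=> h s0 t0; have [|/ltW ts] := leP s t; first by move=> ?; exact: h.
  by rewrite distrC (distrC s); exact: h.
move=> s0 t0; rewrite (distrC s) (ger0_norm (x := t - s)) ?subr_ge0 //.
rewrite ger0_norm ?subr_ge0 ?ler_expR ?lerN2 //.
have -> : expR (- t) = expR (- s) * expR (- (t - s)) by rewrite -expRD; congr expR; ring.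
have := expR_ge1Dx (- (t - s)).
have : expR (- s) <= 1 by rewrite -expR0 ler_expR oppr_le0.
have := expR_gt0 (- s).
set a := expR (- s); set c := expR _ => a0 a1 cD.
rewrite -[X in X - _]mulr1 -mulrBr (le_trans (ler_wpM2l (ltW a0) (y := t - s) _)) //; first lra.
by rewrite ler_piMl // subr_ge0.
Qed.

(** The derivative 1 - exp(- s) lies between 0 and s, hence in [0, S]. The factor S supplies the
    second power of the jump size. *)
Lemma expRN_quadratic_lipschitz s t S : 0 <= s <= S -> 0 <= t <= S ->
  `|(expR (- s) - 1 + s) - (expR (- t) - 1 + t)| <= S * `|s - t|.
Proof.
wlog st : s t / s <= t.
  move=> h s0 t0; have [|/ltW ts] := leP s t; first by move=> ?; exact: h.
  by rewrite distrC (distrC s); exact: h.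
move=> /andP[s0 sS] /andP[t0 tS]; have := expRN_lipschitz s0 t0.
rewrite (distrC s) (ger0_norm (x := t - s)) ?subr_ge0 //.
rewrite ger0_norm ?subr_ge0 ?ler_expR ?lerN2 // => h1.
have h2 : (1 - t) * (t - s) <= expR (- s) - expR (- t).
  have -> : expR (- s) = expR (- t) * expR (t - s) by rewrite -expRD; congr expR; ring.
  have := expR_ge1Dx (t - s); have := expR_ge1Dx (- t); have := expR_gt0 (- t).
  set a := expR (- t); set c := expR _ => a0 aD cD.
  rewrite -[X in _ <= _ - X]mulr1 -mulrBr (@le_trans _ _ (a * (t - s))) //.
    by rewrite ler_wpM2r ?subr_ge0 //; lra.
  by rewrite ler_wpM2l ?(ltW a0) //; lra.
have h3 : t * (t - s) <= S * (t - s) by rewrite ler_wpM2r // subr_ge0.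
move: h1 h2 h3; set p := expR (- s); set q := expR (- t); set w := S * _ => h1 h2 h3.
rewrite ler_norml; apply/andP; split; last by nra.
by nra.
Qed.

End exp_inequalities.

(** * Measurability and bounds of the jump kernel *)

Section borel_measurability.
Context {R : realType} {H : hilbertType R} {e : onb H}.

Lemma borel_open (A : set (borel (HS e))) : open (A : set (HS e)) -> measurable A.
Proof. by move=> oA; apply: sub_sigma_algebra. Qed.

Lemma borel_closed (A : set (borel (HS e))) : closed (A : set (HS e)) -> measurable A.
Proof.
move=> cA; rewrite -[A]setCK; apply: measurableC; apply: borel_open.
exact: closed_openC.
Qed.

Lemma borel_measurable_continuous (f : HS e -> R) : continuous f ->
  measurable_fun setT (f : borel (HS e) -> R).
Proof.
move=> cf; apply: (measurability _ (measurable_realfun.RGenOInfty.measurableE R)).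
move=> _ [_ [r ->] <-]; rewrite setTI; apply: borel_open.
apply: (@open_comp _ _ f `]r, +oo[%classic); first by move=> x _; exact: cf.
exact: interval_open.
Qed.

Lemma Hplus0_measurable : measurable (Hplus0 e : set (borel (HS e))).
Proof.
apply: measurableD; apply: borel_closed; first exact: Hplus_closed.
exact: (accessible_closed_set1 (hausdorff_accessible (@norm_hausdorff _ _))).
Qed.

Lemma chi_inner_measurable (u : HS e) :
  measurable_fun setT (fun xi : borel (HS e) => ⟨chi (xi : HS e), u⟩).
Proof.
rewrite (_ : (fun _ => _) = (fun xi : borel (HS e) => \1_([set z : borel (HS e) | `|(z : HS e)| <= 1]) xi * ⟨(xi : HS e), u⟩)).
  apply: measurable_funM.
    apply: measurable_indic; apply: borel_closed.
    apply: (@preimage_closed _ _ (fun x : HS e => `|x|) [set r | r <= 1]).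
      by move=> x _; exact: norm_continuous.
    exact: closed_le.
  exact: (borel_measurable_continuous (@inner_continuousl _ _ u)).
apply/funext => xi; rewrite indicE /chi; case: ifPn => h.
  by rewrite mem_set // mul1r.
by rewrite memNset ?mul0r ?inner0l //; exact/negP.
Qed.

Lemma inv_sqr_norm_measurable :
  measurable_fun setT (fun xi : borel (HS e) => `|(xi : HS e)| ^- 2).
Proof.
rewrite (_ : (fun _ => _) = (fun r : R => r `^ (- 2)) \o (fun xi : borel (HS e) => `|(xi : HS e)|)).
  apply: measurableT_comp; first exact: measurable_powR.
  exact: (borel_measurable_continuous (@norm_continuous _ _)).
by apply/funext => xi /=; rewrite powRN powR_mulrn.
Qed.

Lemma jump_kernel_measurable (u : HS e) :
  measurable_fun setT (fun xi : borel (HS e) => jump_kernel u (xi : HS e)).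
Proof.
apply: measurable_funD; last exact: chi_inner_measurable.
apply: measurable_funB; last exact: measurable_cst.
apply: (@borel_measurable_continuous (fun xi : HS e => expR (- ⟨xi, u⟩))) => x.
apply: continuous_comp; last exact: continuous_expR.
exact: (cvgN (@inner_continuousl _ _ u x)).
Qed.

(** Small jumps gain a second factor [|xi|] from the compensator, and large ones satisfy
    [|xi| <= |xi|^2]. The common bound in [|xi|^2] fits both the second moment of m and the weight
    [|xi|^-2] of mu. *)
Lemma jump_kernel_lipschitz (u v xi : HS e) (r : R) :
  Hplus e u -> Hplus e v -> Hplus e xi -> `|u| <= r -> `|v| <= r ->
  `|jump_kernel u xi - jump_kernel v xi| <= (1 + r) * `|xi| ^+ 2 * `|u - v|.
Proof.
move=> up vp xp ur vr.
have r0 : 0 <= r by exact: le_trans (normr_ge0 _) ur.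
have s0 := Hplus_inner_ge0 xp up; have t0 := Hplus_inner_ge0 xp vp.
have st : `|⟨xi, u⟩ - ⟨xi, v⟩| <= `|xi| * `|u - v|.
  by rewrite -innerBr inner_cauchy_schwarz.
rewrite /jump_kernel /chi; case: ifPn => [x1|].
  have le w : `|w| <= r -> ⟨xi, w⟩ <= `|xi| * r.
    by move=> wr; rewrite (le_trans (inner_le_norm _ _)) // ler_wpM2l.
  rewrite (le_trans (@expRN_quadratic_lipschitz _ _ _ (`|xi| * r) _ _)) ?s0 ?t0 ?le //.
  rewrite (le_trans (ler_wpM2l _ st)) ?mulr_ge0 //.
  rewrite mulrA ler_wpM2r // mulrAC -expr2 mulrC ler_wpM2r ?sqr_ge0 //.
  by rewrite lerDr.
rewrite -ltNge => x1; rewrite !inner0l !addr0 opprB addrA subrK.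
rewrite (le_trans (expRN_lipschitz _ _)) // (le_trans st) // ler_wpM2r //.
rewrite (le_trans (y := `|xi| ^+ 2)) //; last first.
  by rewrite ler_peMl ?sqr_ge0 // lerDl.
by rewrite expr2 ler_peMl // ltW.
Qed.

(** In this form, division by [|xi|^2] bounds the integrand of R̂ below by -1, uniformly in u. *)
Lemma jump_kernel_ge (u xi : HS e) : Hplus e u -> Hplus e xi ->
  - `|xi| ^+ 2 <= jump_kernel u xi.
Proof.
move=> up xp; rewrite /jump_kernel /chi; case: ifPn => x1.
  have := expR_ge1Dx (- ⟨xi, u⟩); have := sqr_ge0 `|xi|; lra.
rewrite inner0l addr0; have := expR_gt0 (- ⟨xi, u⟩).
have : 1 <= `|xi| ^+ 2 by rewrite exprn_ege1 // ltW // ltNge.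
lra.
Qed.

(** Compares the kernel with the compensator in [admissible_Gamma], whence quasi-monotonicity. *)
Lemma jump_kernel_le (u xi : HS e) : Hplus e u -> Hplus e xi ->
  jump_kernel u xi <= ⟨chi xi, u⟩.
Proof.
move=> up xp; rewrite /jump_kernel gerDr subr_le0 -expR0 ler_expR oppr_le0.
exact: Hplus_inner_ge0.
Qed.

Lemma jump_kernel0 (xi : HS e) : jump_kernel 0 xi = 0.
Proof. by rewrite /jump_kernel !inner0r oppr0 expR0 subrr addr0. Qed.

End borel_measurability.

(** * The positive measures <x, mu(.)> *)

Section integral_congruence.
Import HBNNSimple.

(** Integrals of simple functions evaluate a set function only on preimages of points, which are
    measurable. *)
Lemma integral_eq_on_measurable d (T : measurableType d) (R : realType)
    (m1 m2 : set T -> \bar R) (D : set T) (f : T -> \bar R) :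
  (forall A, measurable A -> m1 A = m2 A) ->
  (\int[m1]_(x in D) f x = \int[m2]_(x in D) f x)%E.
Proof.
move=> m12.
have sE (h : {nnsfun T >-> R}) : sintegral m1 h = sintegral m2 h.
  by rewrite !sintegralET; apply: eq_fsbigr => r _; rewrite m12.
by rewrite /integral; congr (_ - _)%E; congr ereal_sup; apply/seteqP; split=> _ [h hh <-];
  exists h => //; rewrite sE.
Qed.

End integral_congruence.

Section pairing_measure.
Context {R : realType} {H : hilbertType R} {e : onb H}.
Variables (mu : set (borel (HS e)) -> HS e) (muP : Hplus_measure mu)
  (x : HS e) (xp : Hplus e x).

(* The values of mu on non-measurable sets are unconstrained, so pairing mu x
   is a measure only after they have been reset. *)
Definition pairing_measure (_ : Hplus_measure mu) (_ : Hplus e x)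
    (A : set (borel (HS e))) : \bar R :=
  if `[< measurable A >] then pairing mu x A else 0%E.

Local Notation nu := (pairing_measure muP xp).

Lemma pairing_measureE A : measurable A -> nu A = ⟨x, mu A⟩%:E.
Proof. by move=> mA; rewrite /pairing_measure; case: asboolP. Qed.

Lemma pairing_measure0 : nu set0 = 0%E.
Proof.
by rewrite pairing_measureE //; case: muP => -> _ _ _; rewrite inner0r.
Qed.

Lemma pairing_measure_ge0 A : (0 <= nu A)%E.
Proof.
rewrite /pairing_measure; case: asboolP => // mA.
by case: muP => _ h _ _; rewrite lee_fin Hplus_inner_ge0 //; exact: h.
Qed.

Lemma pairing_measure_sigma_additive : semi_sigma_additive nu.
Proof.
move=> F mF tF mUF; rewrite pairing_measureE //.
rewrite (_ : (fun n => _) = EFin \o (fun n => ⟨series (mu \o F) n, x⟩)).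
  apply: cvg_EFin; first by near=> n.
  case: muP => _ _ h _; rewrite innerC.
  exact: inner_cvg (h F mF tF).
apply/funext => n /=; rewrite /series /= inner_suml -sumEFin; apply: eq_bigr => i _.
by rewrite pairing_measureE // innerC.
Unshelve. all: by end_near. Qed.

HB.instance Definition _ := isMeasure.Build _ _ _ nu
  pairing_measure0 pairing_measure_ge0 pairing_measure_sigma_additive.

Lemma pairing_integral (D : set (borel (HS e))) (f : borel (HS e) -> \bar R) :
  (\int[pairing mu x]_(xi in D) f xi = \int[nu]_(xi in D) f xi)%E.
Proof.
by apply: integral_eq_on_measurable => A mA; rewrite pairing_measureE.
Qed.

Lemma pairing_integrable (D : set (borel (HS e))) (f : borel (HS e) -> \bar R) :
  (pairing mu x).-integrable D f = nu.-integrable D f.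
Proof.
by apply/integrableP/integrableP => -[mf fi]; split=> //; move: fi; rewrite pairing_integral.
Qed.

End pairing_measure.

Section order_bound.
Context {R : realType} {H : hilbertType R} {e : onb H}.

(** The hypothesis says that w - v and w + v are positive; by self-duality their inner product
    [|w|^2 - |v|^2] is nonnegative. Norm bounds on vector integrals come from here. *)
Lemma Hplus_order_bound (v w : HS e) :
  (forall x, Hplus e x -> `|⟨v, x⟩| <= ⟨w, x⟩) -> `|v| <= `|w|.
Proof.
move=> vw; rewrite -(ler_pXn2r (n := 2)) ?nnegrE // -!inner_norm -subr_ge0.
rewrite (_ : _ - _ = ⟨w - v, w + v⟩).
  apply: Hplus_inner_ge0; apply: HplusP => x xp; have := vw _ xp; rewrite ler_norml => /andP[? ?].
  - by rewrite innerBl subr_ge0.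
  - by rewrite innerDl -lerBlDl sub0r.
by rewrite innerDr !innerBl (innerC w v); ring.
Qed.

End order_bound.

Section layer_cake.
Context {R : realType}.

(** The sum counts the integers from 1 to n that do not exceed a: it is the integer part of a. *)
Lemma count_le_real (n : nat) (a : R) : 0 <= a <= n%:R ->
  a - 1 <= \sum_(k < n) (k.+1%:R <= a)%R%:R <= a.
Proof.
elim: n a => [|n IH] a /andP[a0 an].
  by rewrite big_ord0 a0 andbT; move: an => /=; lra.
rewrite big_ord_recl /=; have [a1|a1] := leP 1 a.
  have := IH (a - 1); rewrite subr_ge0 a1 lerBlDr natr1 an => /(_ isT).
  have -> : \sum_(i < n) ((bump 0 i).+1%:R <= a)%R%:R = \sum_(i < n) (i.+1%:R <= a - 1)%R%:R :> R.
    by apply: eq_bigr => k _; rewrite /bump /= add1n lerBrDr natr1.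
  have -> : true%:R = 1 :> R by [].
  by set s := \sum_(k < n) _ => /andP[? ?]; apply/andP; split; lra.
have -> : false%:R = 0 :> R by [].
rewrite add0r big1; first by apply/andP; split; lra.
by move=> k _; rewrite leNgt (lt_le_trans a1) // ler1n.
Qed.

End layer_cake.

(** * Integration of bounded functions against mu *)

Section vector_integral.
Context {R : realType} {H : hilbertType R} {e : onb H}.
Variables (mu : set (borel (HS e)) -> HS e) (muP : Hplus_measure mu).

Local Notation D := (Hplus0 e : set (borel (HS e))).
Local Notation nu := (pairing_measure muP).
Local Notation muD := (mu (Hplus0 e)).

(** The condition that characterises [vintegral], restated for the genuine measures [nu xp]. *)
Definition vector_integral (g : HS e -> R) (y : HS e) : Prop :=
  forall x (xp : Hplus e x), (nu xp).-integrable D (EFin \o g) /\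
    ⟨y, x⟩ = \int[nu xp]_(xi in D) g xi.

Let mD : measurable D := Hplus0_measurable.

Lemma pairing_measure_finite x (xp : Hplus e x) : (nu xp D < +oo)%E.
Proof. by rewrite pairing_measureE ?ltry. Qed.

Lemma pairing_integrable_bounded x (xp : Hplus e x) (g : HS e -> R) C :
  measurable_fun D (g : borel (HS e) -> R) -> (forall xi, D xi -> `|g xi| <= C) ->
  (nu xp).-integrable D (EFin \o g).
Proof.
move=> mg gC; apply: measurable_bounded_integrable => //.
  exact: pairing_measure_finite.
exists C; split; first exact: num_real.
by move=> M CM xi Dxi /=; rewrite (le_trans (gC _ Dxi)) // ltW.
Qed.

Lemma pairing_integral_bounded x (xp : Hplus e x) (g : HS e -> R) C :
  measurable_fun D (g : borel (HS e) -> R) -> (forall xi, D xi -> `|g xi| <= C) ->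
  `|\int[nu xp]_(xi in D) g xi| <= C * ⟨x, muD⟩.
Proof.
move=> mg gC; have ig := pairing_integrable_bounded xp mg gC.
rewrite (le_trans (le_normr_Rintegral mD ig)) //.
have -> : C * ⟨x, muD⟩ = \int[nu xp]_(xi in D) cst C xi.
  by rewrite Rintegral_cst //= pairing_measureE.
apply: le_Rintegral => //.
- apply: (@pairing_integrable_bounded _ xp (fun xi => `|g xi|) C); last by move=> xi /gC; rewrite normr_id.
  exact: measurableT_comp.
- by apply: (@pairing_integrable_bounded _ xp (cst C) `|C|).
Qed.

Lemma vector_integral_bound g y C : 0 <= C ->
  measurable_fun D (g : borel (HS e) -> R) -> (forall xi, D xi -> `|g xi| <= C) ->
  vector_integral g y -> `|y| <= C * `|muD|.
Proof.
move=> C0 mg gC gy; rewrite -[C in C * _]ger0_norm // -normrZ.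
apply: Hplus_order_bound => x xp; have [_ ->] := gy x xp.
by rewrite innerZl innerC; exact: pairing_integral_bounded.
Qed.

Lemma vector_integral_lin a g1 y1 g2 y2 :
  vector_integral g1 y1 -> vector_integral g2 y2 ->
  vector_integral (fun xi => a * g1 xi + g2 xi) (a *: y1 + y2).
Proof.
move=> h1 h2 x xp; have [i1 e1] := h1 x xp; have [i2 e2] := h2 x xp.
have ia : (nu xp).-integrable D (EFin \o (fun xi => a * g1 xi)) by exact: (integrableZl mD a i1).
split; first exact: (integrableD mD ia i2).
by rewrite innerDl innerZl e1 e2 -RintegralZl // -RintegralD.
Qed.

Lemma vector_integral_indic (A : set (borel (HS e))) : measurable A -> A `<=` D ->
  vector_integral \1_A (mu A).
Proof.
move=> mA AD x xp; split.
  apply: (@pairing_integrable_bounded _ xp \1_A 1); first exact: measurable_indic.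
  by move=> xi _; rewrite indicE; case: (_ \in _); rewrite ?normr1 ?normr0.
rewrite /Rintegral integral_indic //= setIidl // pairing_measureE //=.
exact: innerC.
Qed.

Lemma vector_integral0 : vector_integral (cst 0) 0.
Proof.
move=> x xp; split.
  by apply: (@pairing_integrable_bounded _ xp (cst 0) 0) => // xi _; rewrite normr0.
by rewrite Rintegral_cst // mul0r inner0l.
Qed.

Lemma vector_integral_sum n (A : nat -> set (borel (HS e))) (a : R) :
  (forall k, measurable (A k)) -> (forall k, A k `<=` D) ->
  vector_integral (fun xi => \sum_(k < n) a * \1_(A k) xi) (\sum_(k < n) a *: mu (A k)).
Proof.
move=> mA AD; elim: n => [|n IH].
  by rewrite big_ord0 (_ : (fun _ => _) = cst 0); [exact: vector_integral0|apply/funext => xi; rewrite big_ord0].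
rewrite big_ord_recr /= addrC (_ : (fun _ => _) = fun xi => a * \1_(A n) xi + \sum_(k < n) a * \1_(A k) xi).
  exact: (vector_integral_lin a (vector_integral_indic (mA n) (AD n)) IH).
by apply/funext => xi; rewrite big_ord_recr /= addrC.
Qed.

(* h is approximated by the averages of the indicators of {k <= n h}, k = 1..n. *)
Lemma vector_integral_unit (h : HS e -> R) :
  measurable_fun D (h : borel (HS e) -> R) -> (forall xi, D xi -> 0 <= h xi <= 1) ->
  exists y, vector_integral h y.
Proof.
move=> mh h01.
pose A n k : set (borel (HS e)) := D `&` [set xi | k.+1%:R <= n.+1%:R * h xi].
have mA n k : measurable (A n k).
  have mnh : measurable_fun D (fun xi : borel (HS e) => n.+1%:R * h xi).
    by apply: measurable_funM => //; exact: measurable_cst.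
  rewrite /A (_ : [set xi | _] = (fun xi : borel (HS e) => n.+1%:R * h xi) @^-1` `[k.+1%:R, +oo[%classic).
    exact: mnh.
  by apply/seteqP; split=> xi /=; rewrite in_itv /= andbT.
have AD n k : A n k `<=` D by move=> xi [].
pose s n (xi : HS e) : R := \sum_(k < n.+1) n.+1%:R^-1 * \1_(A n k) xi.
pose y n := \sum_(k < n.+1) n.+1%:R^-1 *: mu (A n k).
have sy n : vector_integral (s n) (y n) by apply: vector_integral_sum.
have hs n xi : D xi -> `|h xi - s n xi| <= n.+1%:R^-1.
  move=> Dxi; have /andP[h0 h1] := h01 _ Dxi.
  have n0 : 0 < n.+1%:R :> R by rewrite ltr0n.
  have := @count_le_real R n.+1 (n.+1%:R * h xi).
  rewrite mulr_ge0 //= ler_piMr // => /(_ isT).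
  have -> : \sum_(k < n.+1) (k.+1%:R <= n.+1%:R * h xi)%R%:R = n.+1%:R * s n xi :> R.
    rewrite /s mulr_sumr; apply: eq_bigr => k _.
    rewrite mulrA mulfV ?gt_eqF // mul1r indicE; congr ((nat_of_bool _)%:R).
    have [/set_mem[_ /= -> //]|/negP nA] := boolP (xi \in A n k).
    by apply/negbTE/negP => hk; apply: nA; apply/mem_set.
  move=> /andP[cnt1 cnt2].
  have -> : `|h xi - s n xi| = n.+1%:R^-1 * `|n.+1%:R * h xi - n.+1%:R * s n xi|.
    by rewrite -mulrBr normrM (ger0_norm (ltW n0)) mulrA mulVf ?gt_eqF // mul1r.
  rewrite ler_piMr ?invr_ge0 ?(ltW n0) // ler_norml.
  move: cnt1 cnt2; set p := n.+1%:R * h xi; set q := n.+1%:R * s n xi => ? ?.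
  by apply/andP; split; lra.
have ms n : measurable_fun D (s n : borel (HS e) -> R).
  apply: measurable_sum => k; apply: measurable_funM; first exact: measurable_cst.
  exact: measurable_indic.
have ih x (xp : Hplus e x) : (nu xp).-integrable D (EFin \o h).
  apply: (@pairing_integrable_bounded _ xp h 1) => // xi /h01/andP[? ?].
  by rewrite ger0_norm.
have yh n x (xp : Hplus e x) : `|\int[nu xp]_(xi in D) h xi - ⟨y n, x⟩| <= n.+1%:R^-1 * ⟨x, muD⟩.
  have [is_ ->] := sy n x xp; rewrite -(RintegralB mD (ih x xp) is_).
  by apply: (@pairing_integral_bounded _ xp (fun xi => h xi - s n xi)); [exact: measurable_funB|exact: hs].
(* Both y n and y m are compared with the scalar integral of h for each positive x; the order bound
   turns this into a Cauchy estimate in norm. *)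
have ynm n m : `|y n - y m| <= (n.+1%:R^-1 + m.+1%:R^-1) * `|muD|.
  rewrite -[X in X * _]ger0_norm ?addr_ge0 // -normrZ.
  apply: Hplus_order_bound => x xp.
  rewrite innerZl innerBl (innerC muD) mulrDl.
  have := yh n x xp; have := yh m x xp.
  set I := Rintegral _ _ _ => h1 h2.
  rewrite -(subrK I ⟨y n, x⟩) -addrA (le_trans (ler_normD _ _)) // lerD // distrC //.
have small eps : 0 < eps -> exists N : nat, forall n, (N <= n)%N -> n.+1%:R^-1 * `|muD| <= eps.
  move=> eps0; have M0 : 0 < `|muD| + 1 by rewrite ltr_wpDl.
  exists (Num.truncn (eps / (`|muD| + 1))^-1) => n Nn.
  have : n.+1%:R^-1 <= eps / (`|muD| + 1).
    rewrite -[leRHS]invrK lef_pV2 ?posrE ?invr_gt0 ?divr_gt0 //.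
    by rewrite (le_trans (ltW (truncnS_gt _))) // ler_nat ltnS.
  rewrite ler_pdivlMr //; apply: le_trans; rewrite ler_wpM2l // lerDl //.
have cy : cvgn y.
  apply: cauchy_seq_cvg => eps eps0.
  have [|N hN] := small (eps / 2); first by rewrite divr_gt0.
  exists N => n m Nn Nm; rewrite (le_trans (ynm n m)) // mulrDl [leRHS]splitr.
  by rewrite lerD // hN.
exists (limn y) => x xp; split; first exact: ih.
have c1 : ⟨y n, x⟩ @[n --> \oo] --> ⟨limn y, x⟩ by apply: inner_cvg; exact: cy.
apply: (cvg_unique _ c1); first exact: Rhausdorff.
apply: cvg_seqP => eps eps0.
have c0 : 0 < `|x| + 1 by rewrite ltr_wpDl.
have [|N hN] := small (eps / (`|x| + 1)); first by rewrite divr_gt0.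
exists N => n Nn; rewrite distrC (le_trans (yh n x xp)) //.
rewrite (le_trans (ler_wpM2l _ (inner_le_norm _ _))) //.
rewrite mulrCA (le_trans (ler_wpM2l _ (hN n Nn))) //.
by rewrite mulrA ler_pdivrMr // mulrC ler_wpM2l ?(ltW eps0) // lerDl.
Qed.

Lemma vector_integral_exists (g : HS e -> R) C :
  measurable_fun D (g : borel (HS e) -> R) -> (forall xi, D xi -> `|g xi| <= C) ->
  exists y, vector_integral g y.
Proof.
move=> mg gC.
(* An affine map with C' > 0 brings g into [0, 1]; it is undone by linearity, the constant having
   integral mu D. *)
pose C' := `|C| + 1; have C'0 : 0 < C' by rewrite ltr_wpDl.
have [||y yP] := @vector_integral_unit (fun xi => (g xi / C' + 1) / 2).
- apply: measurable_funM; last exact: measurable_cst.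
  apply: measurable_funD; last exact: measurable_cst.
  by apply: measurable_funM => //; exact: measurable_cst.
- move=> xi /gC gxi.
  have : `|g xi / C'| <= 1.
    rewrite normrM normfV (ger0_norm (ltW C'0)) ler_pdivrMr // mul1r.
    by rewrite (le_trans gxi) // /C' (le_trans (ler_norm C)) // lerDl.
  by rewrite ler_norml; set q := g xi / C' => /andP[? ?]; apply/andP; split; lra.
exists ((2 * C') *: y + ((- C') *: mu D + 0)) => x xp.
have := vector_integral_lin (2 * C') yP (vector_integral_lin (- C') (vector_integral_indic mD (@subset_refl _ _)) vector_integral0) xp.
have gE : {in D, (fun xi => 2 * C' * ((g xi / C' + 1) / 2) + (- C' * \1_D xi + cst 0 xi)) =1 g}.
  by move=> xi Dxi; rewrite indicE Dxi /=; field; rewrite gt_eqF.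
move=> [i1 ->]; split; last by apply: eq_Rintegral.
by apply: eq_integrable i1 => // xi Dxi; rewrite /= gE.
Qed.

Lemma vintegralE (g : HS e -> R) y : vector_integral g y -> vintegral mu g = y.
Proof.
move=> gy; have hy x (xp : Hplus e x) : ⟨y, x⟩%:E = (\int[pairing mu x]_(xi in Hplus0 e) (g xi)%:E)%E.
  have [ig e1] := gy x xp; rewrite (pairing_integral muP xp) e1 /Rintegral fineK //.
  exact: integrable_fin_num.
apply: xget_unique => [x xp|z zP].
  by split; [rewrite (pairing_integrable muP xp); have [] := gy x xp|exact: hy].
apply: Hplus_inner_ext => x xp; have [_] := zP x xp.
by rewrite -hy // => -[].
Qed.

End vector_integral.

(** * Regularity, quasi-monotonicity and growth of F and R̂ *)

Section coefficients.
Context {R : realType} {H : hilbertType R} {e : onb H}.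
Variables (Gamma : HS e -> HS e) (b : HS e)
  (m : {measure set (borel (HS e)) -> \bar R})
  (mu : set (borel (HS e)) -> HS e).
Hypotheses (hm : admissible_m m) (hmu : admissible_mu mu)
  (hGamma : admissible_Gamma Gamma mu).

Local Notation D := (Hplus0 e : set (borel (HS e))).
Local Notation muD := (mu (Hplus0 e)).

Let muP : Hplus_measure mu. Proof. by case: hmu. Qed.
Let mD : measurable D := Hplus0_measurable.

Lemma continuous_linear_bounded {E F : normedModType R} (A : E -> F) :
  linear A -> continuous A -> exists2 C, 0 <= C & forall x, `|A x| <= C * `|x|.
Proof.
move=> lA cA.
have A0 : A 0 = 0 by have := lA (-1) 0 0; rewrite scaleN1r addNr scaleN1r addNr.
have AZ a x : A (a *: x) = a *: A x by have := lA a x 0; rewrite !addr0 A0 addr0.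
have /cvgrPdist_le /(_ 1 ltr01) := cA 0; rewrite A0 => /nbhs_ballP[d /= d0 hd].
exists (2 / d); first by rewrite divr_ge0 // ltW.
move=> x; have [->|xN0] := eqVneq x 0; first by rewrite A0 !normr0 mulr0.
have x0 : 0 < `|x| by rewrite normr_gt0.
have dx : 0 < d / (2 * `|x|) by rewrite divr_gt0 // mulr_gt0.
have := hd ((d / (2 * `|x|)) *: x).
rewrite -ball_normE /= sub0r normrN normrZ (ger0_norm (ltW dx)).
have -> : d / (2 * `|x|) * `|x| = d / 2 by field; rewrite gt_eqF.
rewrite ltr_pdivrMr // ltr_pMr // ltr1n => /(_ isT).
rewrite sub0r normrN AZ normrZ (ger0_norm (ltW dx)) mulrC -ler_pdivlMr // mul1r => /le_trans; apply.
by rewrite le_eqVlt; apply/orP; left; apply/eqP; field; rewrite !gt_eqF.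
Qed.

Lemma adjointP : forall u x, ⟨adjoint Gamma u, x⟩ = ⟨u, Gamma x⟩.
Proof.
have [lG cG _ _] := hGamma; have [C C0 hC] := continuous_linear_bounded lG cG.
move=> u; have [|x|y yP] := @riesz_representation R (HS e) (fun x => ⟨u, Gamma x⟩) (`|u| * C).
- by move=> a x y; rewrite lG innerDr innerZr.
- by rewrite (le_trans (inner_cauchy_schwarz _ _)) // -mulrA ler_wpM2l.
- by apply: (@xgetPex (HS e) 0 [set y | forall x, ⟨y, x⟩ = ⟨u, Gamma x⟩]); exists y.
Qed.

Let kernel u (xi : HS e) : R := jump_kernel u xi * `|xi| ^- 2.

Lemma kernel_measurable u : measurable_fun D (kernel u : borel (HS e) -> R).
Proof.
apply: (@measurable_funS _ _ _ _ setT) => //; apply: measurable_funM.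
- exact: jump_kernel_measurable.
- exact: inv_sqr_norm_measurable.
Qed.

Lemma sqr_norm_gt0 xi : D xi -> 0 < `|(xi : HS e)| ^+ 2.
Proof. by move=> [_ /eqP]; rewrite -normr_gt0 => ?; rewrite exprn_gt0. Qed.

Lemma kernel_lipschitz u v xi (r : R) :
  Hplus e u -> Hplus e v -> `|u| <= r -> `|v| <= r -> D xi ->
  `|kernel u xi - kernel v xi| <= (1 + r) * `|u - v|.
Proof.
move=> up vp ur vr Dxi; have x0 := sqr_norm_gt0 Dxi.
rewrite /kernel -mulrBl normrM normfV (ger0_norm (ltW x0)) ler_pdivrMr //.
have [xp _] := Dxi.
by rewrite mulrAC; exact: jump_kernel_lipschitz.
Qed.

Lemma kernel_bounded u xi : Hplus e u -> D xi -> `|kernel u xi| <= (1 + `|u|) * `|u|.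
Proof.
move=> up Dxi; have := @kernel_lipschitz u 0 xi `|u| up (@Hplus_0 _ _ e) (lexx _) _ Dxi.
by rewrite /kernel jump_kernel0 mul0r !subr0 normr0; exact.
Qed.

Lemma kernel_integral u : Hplus e u ->
  exists2 y, vector_integral muP (kernel u) y & coef_R Gamma mu u = adjoint Gamma u - y.
Proof.
move=> up; have [y yP] := vector_integral_exists muP (@kernel_measurable u) (fun xi => kernel_bounded up).
by exists y => //; rewrite /coef_R (vintegralE yP).
Qed.

(** C bounds the adjoint, and (1 + r) [|muD|] the integral, by the kernel estimate. The added 1
    keeps K positive for Picard and Gronwall. *)
Lemma coef_R_lipschitz (r : R) : 0 <= r -> exists2 K, 0 < K & forall u v, Hplus e u -> Hplus e v ->
  `|u| <= r -> `|v| <= r -> `|coef_R Gamma mu u - coef_R Gamma mu v| <= K * `|u - v|.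
Proof.
move=> r0; have [lG cG _ _] := hGamma; have [C C0 hC] := continuous_linear_bounded lG cG.
exists (C + (1 + r) * `|muD| + 1).
  by rewrite ltr_wpDl // addr_ge0 // mulr_ge0 // addr_ge0.
move=> u v up vp ur vr; have [y yP ->] := kernel_integral up; have [z zP ->] := kernel_integral vp.
rewrite (_ : _ - _ = (adjoint Gamma u - adjoint Gamma v) - (y - z)); last first.
  by rewrite !opprB addrACA [RHS]addrACA (addrC (- y)).
rewrite (le_trans (ler_normB _ _)) // mulrDl mul1r ler_wpDr // mulrDl lerD //.
  apply: norm_le_inner; first by rewrite mulr_ge0.
  set w := (X in ⟨_, X⟩); rewrite {1}/w innerBl !adjointP -innerBl.
  by rewrite (le_trans (inner_le_norm _ _)) // mulrAC mulrC ler_wpM2r // mulrC.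
rewrite mulrAC; apply: (@vector_integral_bound _ _ _ _ muP (fun xi => kernel u xi - kernel v xi)).
- by rewrite mulr_ge0 // addr_ge0.
- by apply: measurable_funB; exact: kernel_measurable.
- by move=> xi Dxi; exact: kernel_lipschitz.
- rewrite -scaleN1r addrC (_ : (fun _ => _) = fun xi => -1 * kernel v xi + kernel u xi).
    exact: vector_integral_lin.
  by apply/funext => xi; rewrite mulN1r addrC.
Qed.

(** On the positive measure <x, mu(.)> the kernel is at most the compensator, whose integral the
    admissibility of Gamma bounds by [⟨Gamma x, u⟩]. *)
Lemma coef_R_quasi_monotone u x : Hplus e u -> Hplus e x -> ⟨u, x⟩ = 0 ->
  0 <= ⟨coef_R Gamma mu u, x⟩.
Proof.
move=> up xp ux; have [y yP ->] := kernel_integral up.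
rewrite innerBl adjointP; have [_ _ _ /(_ x u xp up ux)] := hGamma.
have [iy ->] := yP x xp.
rewrite (pairing_integral muP xp) (innerC u) => h.
have chi0 xi : D xi -> 0 <= ⟨chi (xi : HS e), u⟩ * `|(xi : HS e)| ^- 2.
  move=> Dxi; rewrite mulr_ge0 ?invr_ge0 ?sqr_ge0 // /chi.
  by case: ifP => _; [apply: Hplus_inner_ge0 => //; case: Dxi|rewrite inner0l].
have mchi : measurable_fun D (fun xi : borel (HS e) => ⟨chi (xi : HS e), u⟩ * `|(xi : HS e)| ^- 2).
  apply: (@measurable_funS _ _ _ _ setT) => //; apply: measurable_funM.
  - exact: chi_inner_measurable.
  - exact: inv_sqr_norm_measurable.
have ichi : (pairing_measure muP xp).-integrable D
    (EFin \o (fun xi : borel (HS e) => ⟨chi (xi : HS e), u⟩ * `|(xi : HS e)| ^- 2)).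
  apply/integrableP; split; first exact/measurable_EFinP.
  have [_ _ /(_ u x up xp ux)] := hmu; rewrite (pairing_integral muP xp).
  apply: le_lt_trans; rewrite le_eqVlt; apply/orP; left; apply/eqP.
  by apply: eq_integral => xi /set_mem Dxi /=; rewrite ger0_norm // chi0.
rewrite subr_ge0 (@le_trans _ _ (\int[pairing_measure muP xp]_(xi in D) (⟨chi (xi : HS e), u⟩ * `|(xi : HS e)| ^- 2))) //.
  apply: le_Rintegral => // xi Dxi; rewrite ler_wpM2r ?invr_ge0 ?sqr_ge0 //.
  by apply: jump_kernel_le => //; case: Dxi.
(* The admissibility inequality is extended-real; finiteness of the compensator integral makes it
   real. *)
have := integrable_fin_num mD ichi; move: h; rewrite /Rintegral /=.
by case: integral => [r| |] //=; rewrite -EFinB lee_fin subr_ge0.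
Qed.

(** The constant of [coef_R_lipschitz] grows with r and would allow explosion. The one-sided bound
    by -1 on the integrand leaves the quadratic term to Gamma and only [|muD| * |u|] to the
    jumps. *)
Lemma coef_R_growth : exists2 C, 0 <= C & forall u, Hplus e u ->
  ⟨coef_R Gamma mu u, u⟩ <= C * (`|u| ^+ 2 + `|u|).
Proof.
have [lG cG _ _] := hGamma; have [C C0 hC] := continuous_linear_bounded lG cG.
exists (C + `|muD|); first by rewrite addr_ge0.
move=> u up; have [y yP ->] := kernel_integral up.
rewrite innerBl adjointP; have [iy ->] := yP u up.
have h1 : ⟨u, Gamma u⟩ <= C * `|u| ^+ 2.
  by rewrite (le_trans (inner_le_norm _ _)) // expr2 mulrCA ler_wpM2l.
have h2 : - (`|muD| * `|u|) <= \int[pairing_measure muP up]_(xi in D) kernel u xi.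
  rewrite (@le_trans _ _ (\int[pairing_measure muP up]_(xi in D) cst (-1) xi)) //.
    rewrite Rintegral_cst //= pairing_measureE //= mulN1r lerN2 mulrC.
    exact: inner_le_norm.
  apply: le_Rintegral => //.
    by apply: (@pairing_integrable_bounded _ _ _ _ muP _ up (cst (-1)) 1) => // xi _; rewrite normrN normr1.
  move=> xi Dxi; have x0 := sqr_norm_gt0 Dxi.
  rewrite /kernel ler_pdivlMr // mulN1r; apply: jump_kernel_ge => //; by case: Dxi.
have h3 : 0 <= `|muD| * `|u| ^+ 2 by rewrite mulr_ge0 ?sqr_ge0.
have h4 : 0 <= C * `|u| by rewrite mulr_ge0.
by move: h1 h2 h3 h4; set I := Rintegral _ _ _; nra.
Qed.

(** The kernel estimate is integrated against m, whose second moment M is finite. *)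
Lemma coef_F_lipschitz (r : R) : 0 <= r -> exists2 K, 0 <= K & forall u v, Hplus e u -> Hplus e v ->
  `|u| <= r -> `|v| <= r -> `|coef_F b m u - coef_F b m v| <= K * `|u - v|.
Proof.
move=> r0; have [_ m2 _ _] := hm.
have i2 : m.-integrable D (EFin \o (fun xi : borel (HS e) => `|(xi : HS e)| ^+ 2)).
  apply/integrableP; split.
    apply/measurable_EFinP; apply: (@measurable_funS _ _ _ _ setT) => //.
    apply: measurable_funX.
    exact: (borel_measurable_continuous (@norm_continuous _ _)).
  apply: le_lt_trans m2; rewrite le_eqVlt; apply/orP; left; apply/eqP.
  by apply: eq_integral => xi _ /=; rewrite ger0_norm // sqr_ge0.
set M := \int[m]_(xi in D) (`|(xi : HS e)| ^+ 2).
have M0 : 0 <= M by apply: Rintegral_ge0 => xi _; exact: sqr_ge0.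
have mjk u : measurable_fun D (fun xi : borel (HS e) => jump_kernel u (xi : HS e)).
  apply: (@measurable_funS _ _ _ _ setT) => //; exact: jump_kernel_measurable.
have ijk u : Hplus e u -> m.-integrable D (EFin \o (fun xi : borel (HS e) => jump_kernel u (xi : HS e))).
  move=> up; apply: (@le_integrable _ _ _ m D mD _ (EFin \o (fun xi : borel (HS e) => (1 + `|u|) * `|u| * `|(xi : HS e)| ^+ 2))).
  - exact/measurable_EFinP.
  - move=> xi [xp _]; rewrite /= lee_fin [leRHS]ger0_norm ?mulr_ge0 ?sqr_ge0 ?addr_ge0 //.
    have := jump_kernel_lipschitz up (@Hplus_0 _ _ e) xp (lexx `|u|).
    by rewrite normr0 normr_ge0 jump_kernel0 !subr0 mulrAC => /(_ isT).
  - exact: (integrableZl mD ((1 + `|u|) * `|u|) i2).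
exists (`|b| + (1 + r) * M); first by rewrite addr_ge0 // mulr_ge0 // addr_ge0.
move=> u v up vp ur vr; rewrite /coef_F.
rewrite (_ : _ - _ = ⟨b, u - v⟩ - (\int[m]_(xi in D) jump_kernel u xi - \int[m]_(xi in D) jump_kernel v xi)); last first.
  by rewrite innerBr; ring.
rewrite (le_trans (ler_normB _ _)) // mulrDl lerD ?inner_cauchy_schwarz //.
rewrite -(RintegralB mD (ijk _ up) (ijk _ vp)).
have iB : m.-integrable D (EFin \o (fun xi : borel (HS e) => jump_kernel u (xi : HS e) - jump_kernel v (xi : HS e))).
  exact: (integrableB mD (ijk _ up) (ijk _ vp)).
rewrite (le_trans (le_normr_Rintegral mD iB)) //.
rewrite mulrAC /M -RintegralZl //; apply: le_Rintegral => //.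
- by have := integrable_norm iB.
- exact: (integrableZl mD ((1 + r) * `|u - v|) i2).
- by move=> xi [xp _]; rewrite mulrAC; exact: jump_kernel_lipschitz.
Qed.

End coefficients.

(** * The Galerkin system *)

Section radial_retraction.
Context {R : realType} {E : innerType R} (rho : R).
Hypothesis rho0 : 0 < rho.

Definition radial (x : E) : E := if `|x| <= rho then x else (rho / `|x|) *: x.

(** As multiplication by a positive scalar, the truncation preserves the cone, H_d and orthogonality
    relations. *)
Lemma radial_scale x : exists2 th, 0 < th <= 1 & radial x = th *: x.
Proof.
rewrite /radial; case: ifPn => [_|]; first by exists 1; rewrite ?ltr01 ?lexx ?scale1r.
rewrite -ltNge => xr; have x0 : 0 < `|x| by exact: lt_trans xr.
exists (rho / `|x|) => //; rewrite divr_gt0 //= ler_pdivrMr // mul1r ltW //.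
Qed.

Lemma radial_le x : `|radial x| <= rho.
Proof.
rewrite /radial; case: ifPn => //; rewrite -ltNge => xr.
have x0 : 0 < `|x| by exact: lt_trans xr.
by rewrite normrZ ger0_norm ?divr_ge0 ?(ltW rho0) // divfK ?gt_eqF.
Qed.

Lemma radial_id x : `|x| <= rho -> radial x = x.
Proof. by rewrite /radial => ->. Qed.

(** The retraction satisfies the variational inequality of the projection onto the ball. *)
Lemma radial_nonexpansive x y : `|radial x - radial y| <= `|x - y|.
Proof.
apply: (@projection_nonexpansive _ _ [set z | `|z| <= rho] radial); first exact: radial_le.
move=> {x y} x z /= zr; rewrite /radial; case: ifPn => [_|].
  by rewrite subrr inner0l.
rewrite -ltNge => xr; have x0 : 0 < `|x| by exact: lt_trans xr.
set th := rho / `|x|.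
have th1 : th <= 1 by rewrite ler_pdivrMr // mul1r ltW.
rewrite -{1}(scale1r x) -scalerBl innerZl innerBr innerZr inner_norm expr2 mulrA.
rewrite /th divfK ?gt_eqF // -/th mulr_ge0_le0 ?subr_ge0 // subr_le0.
rewrite (le_trans (inner_le_norm _ _)) // mulrC ler_wpM2r //.
Qed.

End radial_retraction.

(** The factor 3 comes from 2 a c <= a^2 + c^2 applied to the cross term; a and c are the sizes of
    the low and high modes. *)
Lemma low_modes_estimate (R : realType) (K a c eps i1 i2 : R) :
  i1 <= 0 -> i2 <= a * (K * (a + c)) -> 0 <= K * (a - c) ^+ 2 -> K * c ^+ 2 <= K * eps ->
  2 * (i1 + i2) <= 3 * K * a ^+ 2 + K * eps.
Proof. by move=> h1 h2 h3 h4; lra. Qed.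

(** Reads off Gronwall's conclusion for a negative rate: q is the negative shift b / a and c the
    decay factor. *)
Lemma high_modes_estimate (R : realType) (x y q c w : R) :
  x + q <= c * (y + q) -> 0 <= y -> y <= w -> q <= 0 -> 0 <= c -> c <= 1 -> x <= w - q.
Proof.
move=> h y0 yw q0 c0 c1.
have h1 : c * y <= y by rewrite ler_piMl.
have h2 : c * q <= 0 by rewrite mulr_ge0_le0.
by lra.
Qed.

(** * Galerkin curves: existence, uniqueness and Cauchy estimate *)

Section galerkin_ode.
Context {R : realType} {H : hilbertType R} {e : onb H}.
Variables (lam : nat -> R) (Rh : HS e -> HS e) (T C : R).
Hypotheses (lam0 : forall i, 0 <= lam i) (lamS : {homo lam : i j / (i <= j)%N >-> i <= j}).
Hypothesis T0 : 0 < T.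
Hypothesis Rh_lipschitz : forall r, 0 <= r -> exists2 K, 0 < K &
  forall u v, Hplus e u -> Hplus e v -> `|u| <= r -> `|v| <= r ->
    `|Rh u - Rh v| <= K * `|u - v|.
Hypothesis Rh_quasi_monotone : forall u x, Hplus e u -> Hplus e x -> ⟨u, x⟩ = 0 ->
  0 <= ⟨Rh u, x⟩.
Hypothesis C0 : 0 <= C.
Hypothesis Rh_growth : forall u, Hplus e u -> ⟨Rh u, u⟩ <= C * (`|u| ^+ 2 + `|u|).

Definition galerkin_field d (x : HS e) := lyapunov_cutoff lam d x + cutoff d (Rh x).

Definition galerkin_curve d (psi : R -> HS e) :=
  forall t, t \in `[0, T] -> [/\ Hplus e (psi t), cutoff d (psi t) = psi t &
    derivative_on T psi t (galerkin_field d (psi t))].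

(** Gronwall's bound for [|psi|^2] with a = b = 4 C + 1: since n <= n^2 + 1, twice the growth bound
    is at most 4 C n^2 + 2 C. It is at least 1, so it bounds [|psi|] as well. *)
Definition growth_radius (u : HS e) := expR ((4 * C + 1) * T) * (`|u| ^+ 2 + 1).

Lemma growth_radius_ge1 u : 1 <= growth_radius u.
Proof.
rewrite mulr_ege1 //; last by rewrite lerDr sqr_ge0.
by rewrite -expR0 ler_expR mulr_ge0 ?(ltW T0) // addr_ge0 // mulr_ge0.
Qed.

(** The derivative is left arbitrary because the bound is applied both to Galerkin curves and to the
    flow of the truncated field. *)
Lemma growth_bound (u : HS e) (psi psi' : R -> HS e) : `|psi 0| <= `|u| ->
  (forall t, t \in `[0, T] -> derivative_on T psi t (psi' t)) ->
  (forall t, t \in `[0, T] -> ⟨psi t, psi' t⟩ <= C * (`|psi t| ^+ 2 + `|psi t|)) ->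
  forall t, t \in `[0, T] -> `|psi t| <= growth_radius u.
Proof.
move=> psi0 dpsi gpsi t tT; pose a := 4 * C + 1.
have a0 : 0 < a by rewrite /a ltr_wpDl // mulr_ge0.
have aN0 : a != 0 by rewrite gt_eqF.
have := @gronwall _ T a a (fun s => `|psi s| ^+ 2) (fun s => 2 * ⟨psi s, psi' s⟩) aN0 _ _ t tT.
rewrite divff // => h.
have {}h : `|psi t| ^+ 2 + 1 <= expR (a * t) * (`|psi 0| ^+ 2 + 1).
  apply: h => s sT; first exact: derivative_on_sqr_norm (dpsi s sT).
  have := gpsi s sT; have := sqr_ge0 (`|psi s| - 1); rewrite /a.
  have := sqr_ge0 `|psi s|.
  set n := `|psi s|; set i := ⟨_, _⟩ => n2 n1 h1.
  have h2 : n <= n ^+ 2 + 1 by nra.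
  have h3 : C * n <= C * (n ^+ 2 + 1) by rewrite ler_wpM2l.
  by nra.
have {}h : `|psi t| ^+ 2 <= growth_radius u.
  rewrite -lerBrDr in h; rewrite (le_trans h) // lerBlDr ler_wpDr //.
  rewrite /growth_radius ler_pM ?expR_ge0 ?addr_ge0 ?sqr_ge0 ?lerD2r //.
    by rewrite ler_expR ler_wpM2l ?(ltW a0) //; move: tT; rewrite in_itv /= => /andP[].
  by rewrite lerXn2r ?nnegrE.
have g1 := growth_radius_ge1 u.
rewrite -(ler_pXn2r (n := 2)) ?nnegrE ?(le_trans ler01 g1) // (le_trans h) //.
by rewrite expr2 ler_peMr // (le_trans ler01 g1).
Qed.

Lemma inner_lyapunov_cutoff_le0 d (x : HS e) : cutoff d x = x ->
  ⟨lyapunov_cutoff lam d x, x⟩ <= 0.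
Proof.
move=> xd; have := @lyapunov_cutoff_dissipative _ _ _ lam d x 0 _ xd.
by rewrite oppr0 mul0r; apply=> i j _ _ _; exact: lambda2_ge0.
Qed.

Lemma galerkin_curve_bound d u psi : galerkin_curve d psi -> `|psi 0| <= `|u| ->
  forall t, t \in `[0, T] -> `|psi t| <= growth_radius u.
Proof.
move=> gpsi psi0; apply: (growth_bound psi0 (psi' := fun t => galerkin_field d (psi t))).
  by move=> t /gpsi[].
move=> t /gpsi[pp pd _]; rewrite innerDr -inner_cutoff pd.
rewrite innerC (innerC (psi t)) ler_wnDl ?inner_lyapunov_cutoff_le0 //.
exact: Rh_growth.
Qed.

(** Metric projection onto the cone of H_d. The last two clauses are Moreau's: p x - x is orthogonal
    to p x and nonnegative against that cone. *)
Lemma galerkin_cone d : exists p : HS e -> HS e,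
  [/\ forall x, Hplus e (p x) /\ cutoff d (p x) = p x,
      forall x y, `|p x - p y| <= `|x - y|,
      forall x y, `| `|y - p y| ^+ 2 - `|x - p x| ^+ 2 - ⟨2 *: (x - p x), y - x⟩ | <= 1 * `|y - x| ^+ 2,
      forall x, ⟨p x - x, p x⟩ = 0 &
      forall x k, Hplus e k -> cutoff d k = k -> 0 <= ⟨p x - x, k⟩].
Proof.
pose Kd := [set x : HS e | Hplus e x /\ cutoff d x = x].
have Kd0 : Kd 0 by split; [exact: Hplus_0|rewrite -[X in cutoff d X](scale0r 0) cutoffZ scale0r].
have KdZ a x : 0 <= a -> Kd x -> Kd (a *: x).
  move=> a0 [xp xd]; split; last by rewrite cutoffZ xd.
  by have := Hplus_comb a0 ler01 xp (@Hplus_0 _ _ e); rewrite scaler0 addr0.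
have KdD x y : Kd x -> Kd y -> Kd (x + y).
  move=> [xp xd] [yp yd]; split; last by rewrite cutoffD xd yd.
  by have := Hplus_comb ler01 ler01 xp yp; rewrite !scale1r.
have [||t x y|p [Cp pP]] := @metric_projection R (HS e) Kd.
- by exists 0.
- apply: closedI; first exact: Hplus_closed.
  rewrite [X in closed X](_ : _ = (fun x : HS e => cutoff d x - x) @^-1` [set 0]).
    apply: preimage_closed; last exact: (accessible_closed_set1 (hausdorff_accessible (@norm_hausdorff _ _))).
    have cc : continuous (fun x : HS e => cutoff d x - x).
      apply: (lipschitz_continuous (K := 1)) => // y z; rewrite mul1r -normrN.
      have -> : - (cutoff d y - y - (cutoff d z - z)) = (y - z) - cutoff d (y - z).
        by rewrite cutoffB !opprB addrCA addrA [RHS]addrACA -!addrA; congr (_ + _); rewrite addrCA.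
      exact: cutoff_compl_le.
    by move=> x _; exact: cc.
  by apply/seteqP; split=> x /= => [->|/eqP]; rewrite ?subrr // subr_eq0 => /eqP.
- by move=> /andP[t0 t1] Kx Ky; apply: KdD; apply: KdZ; rewrite ?subr_ge0.
(* The variational inequality is tested at 0 and at 2 p x, both of which lie in the cone. *)
have pp x : ⟨x - p x, p x⟩ = 0.
  apply/eqP; rewrite eq_le; have := pP x _ Kd0; have := pP x _ (KdZ 2 _ (ler0n _ 2) (Cp x)).
  rewrite sub0r innerNr oppr_le0 => h ->; rewrite andbT.
  by move: h; rewrite -{3}(scale1r (p x)) -scalerBl innerZr; lra.
exists p; split=> //.
- by move=> x y; apply: (@projection_nonexpansive _ _ Kd).
- by move=> x y; apply: (@projection_sqr_dist _ _ Kd).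
- by move=> x; rewrite -opprB innerNl pp oppr0.
- move=> x k kp kd; have := pP x k (conj kp kd).
  by rewrite innerBr pp subr0 -opprB innerNl oppr_le0.
Qed.

(* Nagumo's argument: the normal n = p x - x to the cone at p x satisfies
   <n, p x> = 0, hence <n, G (p x)> >= 0 by quasi-monotonicity, so the squared
   distance to the cone does not increase along the flow of G \o p. *)
Lemma galerkin_exists d u : Hplus e u ->
  exists2 psi, galerkin_curve d psi & psi 0 = cutoff d u.
Proof.
move=> up; have [p [pK plip pquad pp pdual]] := galerkin_cone d.
set rho := growth_radius u; have rho0 : 0 < rho by exact: lt_le_trans (growth_radius_ge1 u).
have [K K0 RhK] := Rh_lipschitz (ltW rho0).
pose y x := radial rho (p x).
have yP x : [/\ Hplus e (y x), cutoff d (y x) = y x, `|y x| <= rho &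
    exists2 th, 0 < th <= 1 & y x = th *: p x].
  have [px pd] := pK x; have [th thP yE] := radial_scale rho0 (p x).
  split; rewrite /y; [|by rewrite yE cutoffZ pd|exact: radial_le|by exists th].
  case/andP: thP => th0 _; rewrite yE.
  by have := Hplus_comb (ltW th0) ler01 px (@Hplus_0 _ _ e); rewrite scaler0 addr0.
pose G x := galerkin_field d (y x).
have [||psi [psi0 dpsi]] := @picard_lindelof R (HS e) G (2 * lam d + K) T (cutoff d u) _ T0.
- by rewrite ltr_wpDl // mulr_ge0.
- move=> v w; have [yv _ yvr _] := yP v; have [yw _ ywr _] := yP w.
  have yvw : `|y v - y w| <= `|v - w|.
    by rewrite (le_trans (radial_nonexpansive rho0 _ _)) // plip.
  rewrite /G /galerkin_field opprD addrACA -lyapunov_cutoffB -cutoffB.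
  rewrite (le_trans (ler_normD _ _)) // mulrDl lerD //.
    rewrite (le_trans (lyapunov_cutoff_le lam0 lamS _ _)) // ler_wpM2l // mulr_ge0 //.
  rewrite (le_trans (cutoff_le _ _)) // (le_trans (RhK _ _ yv yw yvr ywr)) //.
  by rewrite ler_wpM2l // ltW.
have psiK t : t \in `[0, T] -> p (psi t) = psi t.
  move=> tT; apply/eqP; rewrite eq_sym -subr_eq0 -normr_eq0 -sqrf_eq0 eq_le sqr_ge0 andbT.
  apply: (@gronwall0 _ T 1 (fun s => `|psi s - p (psi s)| ^+ 2)
    (fun s => ⟨2 *: (psi s - p (psi s)), G (psi s)⟩)) => //; last first.
  - have [tup tud] : Hplus e (cutoff d u) /\ cutoff d (cutoff d u) = cutoff d u.
      by split; [exact: cutoff_Hplus|exact: cutoff_idem].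
    rewrite psi0 -inner_norm -(opprB (p (cutoff d u))) innerNl innerNr opprK.
    by rewrite innerBr pp sub0r oppr_le0; exact: pdual.
  - move=> s sT; rewrite mul1r (@le_trans _ _ 0) ?sqr_ge0 //.
    have [yp yd _ [th thP yE]] := yP (psi s).
    set n := p (psi s) - psi s.
    (* The normal is nonnegative only against the cone of H_d; its cutoff is positive in the full
       cone, where quasi-monotonicity is known. *)
    have np : Hplus e (cutoff d n).
      by apply: HplusP => k kp; rewrite inner_cutoff; apply: pdual; [exact: cutoff_Hplus|exact: cutoff_idem].
    have ny : ⟨y (psi s), cutoff d n⟩ = 0.
      by rewrite -inner_cutoff yd yE innerZl innerC /n pp mulr0.
    rewrite innerZl -opprB -/n innerNl mulrN oppr_le0 mulr_ge0 //.
    rewrite /G /galerkin_field innerDr -[in X in _ <= _ + X]inner_cutoff.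
    rewrite (innerC (cutoff d n)) addr_ge0 //; last exact: Rh_quasi_monotone.
    have := calH_cutoff (lyapunov_cutoff_calH lam d (y (psi s))) => <-.
    by rewrite -inner_cutoff innerC lyapunov_cutoff_orthogonal.
  - move=> s sT; exact: (derivative_on_chain pquad (dpsi s sT)).
have psi_bound : forall t, t \in `[0, T] -> `|psi t| <= rho.
  apply: (growth_bound _ dpsi); first by rewrite psi0 cutoff_le.
  move=> t tT; have [yp yd _ [th thP yE]] := yP (psi t).
  have [_ pd] := pK (psi t); rewrite psiK // in yE pd.
  case/andP: thP => th0 th1; have th00 := ltW th0.
  (* The growth bound holds at y = th psi. Dividing by th is harmless as [|y|^2 + |y|] is at most th
     ([|psi|^2 + |psi|]), so the truncated flow obeys the same bound and never meets the
     truncation. *)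
  have -> : ⟨psi t, G (psi t)⟩ = th^-1 * ⟨y (psi t), G (psi t)⟩.
    by rewrite yE innerZl mulrA mulVf ?mul1r // gt_eqF.
  rewrite mulrC ler_pdivrMr // /G /galerkin_field innerDr -inner_cutoff yd.
  rewrite innerC (innerC (y (psi t))) ler_wnDl ?inner_lyapunov_cutoff_le0 //.
  rewrite (le_trans (Rh_growth yp)) // -mulrA ler_wpM2l // yE normrZ ger0_norm //.
  rewrite mulrDl exprMn [`|psi t| * th]mulrC lerD2r mulrC ler_wpM2l ?sqr_ge0 //.
  by rewrite expr2 ler_piMr.
exists psi => // t tT; have [] := pK (psi t); rewrite psiK // => pt pd.
split=> //; have := dpsi t tT; congr (derivative_on _ _ _ _).
by rewrite /G /y psiK // radial_id // psi_bound.
Qed.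

Lemma derivative_on_eq {E : normedModType R} (g h : R -> E) t l : t \in `[0, T] ->
  (forall s, s \in `[0, T] -> g s = h s) -> derivative_on T g t l -> derivative_on T h t l.
Proof.
move=> tT gh /derivative_onP dg; apply/derivative_onP => eps eps0.
have [d d0 hd] := dg _ eps0; exists d => // s sT st.
by rewrite -!gh //; exact: hd.
Qed.

Lemma galerkin_unique d psi1 psi2 : galerkin_curve d psi1 -> galerkin_curve d psi2 ->
  psi1 0 = psi2 0 -> forall t, t \in `[0, T] -> psi1 t = psi2 t.
Proof.
move=> g1 g2 p12 t tT.
set r := growth_radius (psi1 0).
have b1 := galerkin_curve_bound g1 (lexx _).
have b2 : forall t, t \in `[0, T] -> `|psi2 t| <= r.
  by apply: (galerkin_curve_bound g2); rewrite p12.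
have [K K0 RhK] := Rh_lipschitz (le_trans ler01 (growth_radius_ge1 (psi1 0))).
apply/eqP; rewrite -subr_eq0 -normr_eq0 -sqrf_eq0 eq_le sqr_ge0 andbT.
apply: (@gronwall0 _ T (2 * K) (fun s => `|psi1 s - psi2 s| ^+ 2)
  (fun s => 2 * ⟨psi1 s - psi2 s, galerkin_field d (psi1 s) - galerkin_field d (psi2 s)⟩)) => //.
- by rewrite mulr_gt0.
- move=> s sT; have [_ _ d1] := g1 s sT; have [_ _ d2] := g2 s sT.
  exact: derivative_on_sqr_norm (derivative_onB d1 d2).
- move=> s sT; have [k1 c1 _] := g1 s sT; have [k2 c2 _] := g2 s sT.
  rewrite -mulrA ler_wpM2l // /galerkin_field opprD addrACA -lyapunov_cutoffB -cutoffB innerDr.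
  have cw : cutoff d (psi1 s - psi2 s) = psi1 s - psi2 s by rewrite cutoffB c1 c2.
  rewrite innerC ler_wnDl ?(inner_lyapunov_cutoff_le0 cw) //.
  rewrite (le_trans (inner_le_norm _ _)) // expr2 mulrCA ler_wpM2l //.
  by rewrite (le_trans (cutoff_le _ _)) // RhK // ?b1 ?b2.
- by rewrite p12 subrr normr0 expr0n.
Qed.

Lemma lyapunov_cutoff_widen m n (x : HS e) : (m <= n)%N ->
  lyapunov_cutoff lam n x - cutoff m (lyapunov_cutoff lam n x) =
  lyapunov_cutoff lam n (x - cutoff m x).
Proof.
move=> mn; apply: ecoef_ext => i j ij; rewrite ecoefB ecoef_cutoff // /lyapunov_cutoff !ecoef_tri_ebasis //.
rewrite ecoefB ecoef_cutoff //; case: ltnP => jn; last by case: ifP; rewrite subrr.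
by case: ifP => _; rewrite ?subrr ?subr0 ?mulr0.
Qed.

Lemma cutoff_lyapunov_cutoff m n (x : HS e) : (m <= n)%N ->
  cutoff m (lyapunov_cutoff lam n x) = lyapunov_cutoff lam m (cutoff m x).
Proof.
move=> mn; apply: ecoef_ext => i j ij; rewrite ecoef_cutoff // /lyapunov_cutoff !ecoef_tri_ebasis //.
by case: ifP => // jm; rewrite (leq_trans jm mn).
Qed.

(* The modes with j >= m are damped at rate lam m, whatever their driving term. *)
Lemma galerkin_high_modes m n u M psi : (m <= n)%N -> 0 < lam m -> 0 <= M ->
  galerkin_curve n psi -> psi 0 = cutoff n u ->
  (forall t, t \in `[0, T] -> `|Rh (psi t)| <= M) ->
  forall t, t \in `[0, T] ->
  `|psi t - cutoff m (psi t)| ^+ 2 <= `|u - cutoff m u| ^+ 2 + M ^+ 2 / lam m ^+ 2.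
Proof.
move=> mn l0 M0 gpsi psi0 RhM t tT.
pose z s := psi s - cutoff m (psi s).
have lN : - lam m != 0 by rewrite oppr_eq0 gt_eqF.
have dz s : s \in `[0, T] -> derivative_on T z s (galerkin_field n (psi s) - cutoff m (galerkin_field n (psi s))).
  move=> sT; have [_ _ d1] := gpsi s sT; apply: derivative_onB => //.
  by apply: (derivative_on_bounded_linear (C := 1)) => //;
    [exact: cutoffB|exact: cutoffZ|move=> x; rewrite mul1r; exact: cutoff_le].
have := @gronwall _ T (- lam m) (M ^+ 2 / lam m) (fun s => `|z s| ^+ 2)
  (fun s => 2 * ⟨z s, galerkin_field n (psi s) - cutoff m (galerkin_field n (psi s))⟩) lN _ _ t tT.
move=> h.
have {}h : `|z t| ^+ 2 + M ^+ 2 / lam m / - lam m <=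
    expR (- lam m * t) * (`|z 0| ^+ 2 + M ^+ 2 / lam m / - lam m).
  apply: h => s sT; first exact: derivative_on_sqr_norm (dz s sT).
  have [_ pn _] := gpsi s sT.
  have zn : cutoff n (z s) = z s by rewrite /z cutoffB pn cutoff_idem.
  have zm : cutoff m (z s) = 0 by rewrite /z cutoffB cutoff_idem // subrr.
  rewrite /galerkin_field cutoffD opprD addrACA lyapunov_cutoff_widen // -/(z s).
  rewrite cutoff_idem' // innerDr [X in 2 * (_ + X)]innerBr -!inner_cutoff zn zm inner0l subr0.
  have h1 : ⟨z s, lyapunov_cutoff lam n (z s)⟩ <= - lam m * `|z s| ^+ 2.
    rewrite innerC; apply: lyapunov_cutoff_dissipative => // i j ij jn.
    rewrite -[in ecoef _]/(z s) => zij; have mj : (m <= j)%N.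
      rewrite leqNgt; apply/negP => jm; move: zij.
      by have := ecoef_cutoff m (z s) ij; rewrite jm zm /ecoef inner0l => <-; rewrite eqxx.
    by rewrite /lambda2 (le_trans (lamS mj)) // lerDr.
  have h2 : ⟨z s, Rh (psi s)⟩ <= `|z s| * M.
    by rewrite (le_trans (inner_le_norm _ _)) // ler_wpM2l // RhM.
  (* Young's inequality weighted by [lam m]: the driving term consumes half of the damping 2
     [lam m]. *)
  have h3 : 2 * (`|z s| * M) <= lam m * `|z s| ^+ 2 + M ^+ 2 / lam m.
    have := sqr_ge0 (lam m * `|z s| - M).
    move=> sq; rewrite -subr_ge0 (_ : _ + _ - _ = (lam m * `|z s| - M) ^+ 2 / lam m); last by field; rewrite gt_eqF.
    by rewrite divr_ge0 // ltW.
  by move: h1 h2 h3; set q := M ^+ 2 / _; lra.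
have z0 : `|z 0| ^+ 2 <= `|u - cutoff m u| ^+ 2.
  have -> : z 0 = cutoff n (u - cutoff m u) by rewrite /z psi0 cutoff_idem' // cutoffB cutoff_idem.
  by rewrite lerXn2r ?nnegrE ?cutoff_le.
have -> : M ^+ 2 / lam m ^+ 2 = - (M ^+ 2 / lam m / - lam m) by field; rewrite gt_eqF.
have q0 : M ^+ 2 / lam m / - lam m <= 0.
  by rewrite invrN mulrN oppr_le0 divr_ge0 ?divr_ge0 ?sqr_ge0 // ltW.
apply: high_modes_estimate h _ z0 q0 _ _; rewrite ?sqr_ge0 ?expR_ge0 //.
rewrite -expR0 ler_expR mulNr oppr_le0 mulr_ge0 ?(ltW l0) //.
by move: tT; rewrite in_itv /= => /andP[].
Qed.

(** The high-mode bound, amplified by Gronwall at the rate 3 K of the low modes; the 2 comes from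
    squaring a sum. It does not depend on the finer level n. *)
Definition galerkin_error K M m (u : HS e) :=
  2 * (1 + expR (3 * K * T)) * (`|u - cutoff m u| ^+ 2 + M ^+ 2 / lam m ^+ 2).

(** After projection to level m both curves start from the same point and L only helps; the high
    modes of the finer curve enter through R̂ as a source of size K eps. *)
Lemma galerkin_cauchy m n u K M psin psim : (m <= n)%N -> 0 < lam m -> 0 <= M -> 0 < K ->
  galerkin_curve n psin -> galerkin_curve m psim ->
  psin 0 = cutoff n u -> psim 0 = cutoff m u ->
  (forall t, t \in `[0, T] -> `|Rh (psin t)| <= M) ->
  (forall t, t \in `[0, T] -> `|Rh (psin t) - Rh (psim t)| <= K * `|psin t - psim t|) ->
  forall t, t \in `[0, T] -> `|psin t - psim t| ^+ 2 <= galerkin_error K M m u.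
Proof.
move=> mn l0 M0 K0 gn gm n0 m0 RhM RhK t tT.
have hz := galerkin_high_modes mn l0 M0 gn n0 RhM.
set eps := `|u - cutoff m u| ^+ 2 + M ^+ 2 / lam m ^+ 2 in hz.
have eps0 : 0 <= eps by rewrite addr_ge0 ?divr_ge0 ?sqr_ge0.
pose v s := cutoff m (psin s) - psim s.
have vE s : psin s - psim s = v s + (psin s - cutoff m (psin s)).
  by rewrite /v [RHS]addrC addrA subrK.
have dv s : s \in `[0, T] -> derivative_on T v s (cutoff m (galerkin_field n (psin s)) - galerkin_field m (psim s)).
  move=> sT; have [_ _ d1] := gn s sT; have [_ _ d2] := gm s sT; apply: derivative_onB => //.
  by apply: (derivative_on_bounded_linear (C := 1)) => //;
    [exact: cutoffB|exact: cutoffZ|move=> x; rewrite mul1r; exact: cutoff_le].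
have K3 : 3 * K != 0 by rewrite gt_eqF // mulr_gt0.
have := @gronwall _ T (3 * K) (K * eps) (fun s => `|v s| ^+ 2)
  (fun s => 2 * ⟨v s, cutoff m (galerkin_field n (psin s)) - galerkin_field m (psim s)⟩) K3 _ _ t tT.
move=> h.
have {}h : `|v t| ^+ 2 + K * eps / (3 * K) <= expR (3 * K * t) * (`|v 0| ^+ 2 + K * eps / (3 * K)).
  apply: h => s sT; first exact: derivative_on_sqr_norm (dv s sT).
  have [_ cn _] := gn s sT; have [_ cm _] := gm s sT.
  have vm : cutoff m (v s) = v s by rewrite /v cutoffB cutoff_idem // cm.
  rewrite /galerkin_field cutoffD cutoff_lyapunov_cutoff // cutoff_idem' // opprD addrACA.
  rewrite -lyapunov_cutoffB -cutoffB -/(v s) innerDr -[X in 2 * (_ + X)]inner_cutoff vm innerC.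
  have h1 := inner_lyapunov_cutoff_le0 vm.
  have vz : `|psin s - psim s| <= `|v s| + `|psin s - cutoff m (psin s)|.
    by rewrite vE; exact: ler_normD.
  have h2 : ⟨v s, Rh (psin s) - Rh (psim s)⟩ <= `|v s| * (K * (`|v s| + `|psin s - cutoff m (psin s)|)).
    rewrite (le_trans (inner_le_norm _ _)) // ler_wpM2l // (le_trans (RhK s sT)) //.
    by rewrite ler_wpM2l // ltW.
  have h3 := hz s sT.
  set a := `|v s| in h2 *; set c := `|psin s - cutoff m (psin s)| in h2 h3.
  have h4 : 0 <= K * (a - c) ^+ 2 by rewrite mulr_ge0 ?sqr_ge0 // ltW.
  have h5 : K * c ^+ 2 <= K * eps by rewrite ler_wpM2l // ltW.
  exact: low_modes_estimate h1 h2 h4 h5.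
have v0 : v 0 = 0 by rewrite /v n0 m0 cutoff_idem' // subrr.
rewrite v0 normr0 expr0n /= add0r in h.
rewrite vE.
set w := psin t - _; have hw := hz t tT; rewrite -/w in hw.
have hs : `|v t + w| ^+ 2 <= 2 * (`|v t| ^+ 2 + `|w| ^+ 2).
  have : `|v t + w| ^+ 2 <= (`|v t| + `|w|) ^+ 2 by rewrite lerXn2r ?nnegrE ?addr_ge0 ?ler_normD.
  have := sqr_ge0 (`|v t| - `|w|); nra.
rewrite (le_trans hs) // /galerkin_error -/eps -mulrA ler_wpM2l // mulrDl mul1r addrC lerD //.
have hq : K * eps / (3 * K) = eps / 3 by field; rewrite gt_eqF.
rewrite hq in h.
have e1 : expR (3 * K * t) <= expR (3 * K * T).
  rewrite ler_expR ler_wpM2l ?mulr_ge0 ?(ltW K0) //.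
  by move: tT; rewrite in_itv /= => /andP[].
have h1 : expR (3 * K * t) * (eps / 3) <= expR (3 * K * T) * eps.
  rewrite ler_pM ?expR_ge0 ?divr_ge0 // ler_pdivrMr // ler_peMr //; lra.
have : 0 <= eps / 3 by rewrite divr_ge0.
by move: h h1; set p := expR _ * (_ / _); set q := eps / 3; lra.
Qed.

End galerkin_ode.

(** * The limiting Riccati system *)

Section mild_equation.
Context {R : realType} {H : hilbertType R} {e : onb H}.
Local Notation leb := (@lebesgue_measure R).

(** Fundamental theorem for s -> exp(- l (t - s)) y(s), differentiated in the interior and
    continuous up to the end points. *)
Lemma variation_of_constants (T l : R) (y r : R -> R) : continuous r ->
  (forall t, t \in `[0, T] -> derivative_on T y t (- l * y t + r t)) ->
  forall t, t \in `[0, T] ->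
  y t - expR (- l * t) * y 0 = \int[leb]_(s in `[0, t]) (expR (- l * (t - s)) * r s).
Proof.
move=> rc dy t tT; move: (tT); rewrite in_itv /= => /andP[t0 tT'].
have [->|tN0] := eqVneq t 0.
  by rewrite set_itv1 Rintegral_set1 mulr0 expR0 mul1r subrr.
have tp : 0 < t by rewrite lt_neqAle eq_sym tN0.
have ec : continuous (fun s : R => expR (- l * (t - s))).
  move=> s; apply: continuous_comp; last exact: continuous_expR.
  by apply: cvgMr; apply: cvgB; [exact: cvg_cst|exact: cvg_id].
pose F s := expR (- l * (t - s)) * y s.
have dF (x : R) : 0 < x < T -> is_derive x 1 F (expR (- l * (t - x)) * r x).
  move=> xT; have xT' : x \in `[0, T].
    by rewrite in_itv /=; case/andP: xT => *; apply/andP; split; exact: ltW.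
  have := derivative_on_is_derive xT (dy x xT') => dyx.
  by rewrite /F; apply: is_derive_eq; rewrite /GRing.scale /=; ring.
have cF : {within `[0, t], continuous F}.
  have sub : `[0, t]%classic `<=` `[0, T]%classic.
    by move=> s /=; rewrite !in_itv /= => /andP[-> /= st]; exact: le_trans st tT'.
  apply: (continuous_subspaceW sub) => s; apply: cvgM.
    exact: (continuous_subspaceT (fun s => ec s)).
  exact: (derivative_on_continuous dy).
have [_ cl cr] := (continuous_within_itvP _ tp).1 cF.
have xT x : x \in `]0, t[ -> 0 < x < T.
  by rewrite in_itv /= => /andP[-> xt] /=; exact: lt_le_trans xt tT'.
rewrite /Rintegral (@continuous_FTC2 _ _ F 0 t) //=.
- by rewrite /F subrr mulr0 expR0 mul1r subr0.
- by apply: continuous_subspaceT => s; apply: cvgM; [exact: ec|exact: rc].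
- split; [move=> x /xT x0; by have [] := dF x x0|exact: cl|exact: cr].
- by move=> x /xT xT0; rewrite derive1E (@derive_val _ _ _ _ _ _ _ (dF x xT0)).
Qed.

Lemma derivative0_cst (T : R) (y : R -> R) :
  (forall t, t \in `[0, T] -> derivative_on T y t 0) ->
  forall t, t \in `[0, T] -> y t = y 0.
Proof.
move=> dy t tT; move: (tT); rewrite in_itv /= => /andP[t0 tT'].
have [->//|tN0] := eqVneq t 0; have tp : 0 < t by rewrite lt_neqAle eq_sym tN0.
have sub : `[0, t]%classic `<=` `[0, T]%classic.
  by move=> s /=; rewrite !in_itv /= => /andP[-> /= st]; exact: le_trans st tT'.
have [x|c _ /eqP] := @MVT _ y (fun=> 0) 0 t tp _ (continuous_subspaceW sub (derivative_on_continuous dy)).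
  rewrite in_itv /= => /andP[x0 xt]; apply: (@derivative_on_is_derive _ T).
    by rewrite x0 (lt_le_trans xt).
  by apply: dy; rewrite in_itv /= ltW //= (le_trans (ltW xt)).
by rewrite mul0r subr_eq0 => /eqP.
Qed.

Lemma continuous_curve_comp {E F : normedModType R} (S : set E) (G : E -> F) (K : R) (c : R -> E) :
  (forall x y, S x -> S y -> `|G x - G y| <= K * `|x - y|) ->
  continuous c -> (forall t, S (c t)) -> continuous (fun t => G (c t)).
Proof.
move=> GK cc cS t; apply/cvgrPdist_le => eps eps0.
have K1 : 0 < `|K| + 1 by rewrite ltr_wpDl.
near=> s; rewrite (le_trans (GK _ _ (cS _) (cS _))) //.
rewrite (le_trans (y := (`|K| + 1) * `|c t - c s|)) //.
  by rewrite ler_wpM2r // (le_trans (ler_norm K)) // lerDl.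
rewrite -ler_pdivlMl //; near: s.
by apply: cvgr_dist_le; [exact: cc|rewrite mulr_gt0 ?invr_gt0].
Unshelve. all: by end_near. Qed.

Lemma integrable_bounded_itv (g : R -> R) (t M : R) : measurable_fun `[0, t] g ->
  (forall s, s \in `[0, t] -> `|g s| <= M) -> leb.-integrable `[0, t] (EFin \o g).
Proof.
move=> mg gM; apply: measurable_bounded_integrable => //.
  change (leb `[0%R, t]%classic < +oo)%E.
  by rewrite lebesgue_measure_itv /=; case: ifP => _; rewrite ?ltry // -EFinB ltry.
exists M; split; first exact: num_real.
by move=> N MN s ts /=; rewrite (le_trans (gM _ _)) // ltW.
Qed.

Lemma Rintegral_bounded_itv (g : R -> R) (t M : R) : 0 <= t -> measurable_fun `[0, t] g ->
  (forall s, s \in `[0, t] -> `|g s| <= M) -> `|\int[leb]_(s in `[0, t]) g s| <= M * t.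
Proof.
move=> t0 mg gM; rewrite (le_trans (le_normr_Rintegral _ (integrable_bounded_itv mg gM))) //.
rewrite -[X in _ * X]subr0 -itv_measure // -Rintegral_cst //; apply: le_Rintegral => //.
- apply: (@integrable_bounded_itv (fun s => `|g s|) t M); first exact: measurableT_comp.
  by move=> s /gM; rewrite normr_id.
- by apply: (@integrable_bounded_itv (cst M) t `|M|).
Qed.

(** The condition is checked where the integrand is scalar, and extends to finite combinations by
    linearity; [cutoff_cvg] and the bound M then carry measurability and the identity to all z. *)
Lemma is_integral_coordinates (h : R -> HS e) (t M : R) (Y : HS e) : 0 <= t ->
  (forall s, s \in `[0, t] -> `|h s| <= M) ->
  (forall i j, (i <= j)%N -> measurable_fun `[0, t] (fun s => ecoef (h s) i j) /\
     ecoef Y i j = \int[leb]_(s in `[0, t]) ecoef (h s) i j) ->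
  is_integral `[0, t] h Y.
Proof.
move=> t0 hM hcoef.
have M0 : 0 <= M by apply: le_trans (hM 0 _); rewrite // in_itv /= lexx.
have hz z s : s \in `[0, t] -> `|⟨h s, z⟩| <= M * `|z|.
  by move=> st; rewrite (le_trans (inner_cauchy_schwarz _ _)) // ler_wpM2r // hM.
pose P (z : HS e) := measurable_fun `[0, t] (fun s => ⟨h s, z⟩) /\
  ⟨Y, z⟩ = \int[leb]_(s in `[0, t]) ⟨h s, z⟩.
have P0 : P 0.
  have h0 s : ⟨h s, 0⟩ = 0 by exact: inner0r.
  split; first by rewrite (funext h0); exact: measurable_cst.
  by rewrite (funext h0) Rintegral_cst // mul0r; exact: inner0r.
have PD z w : P z -> P w -> P (z + w).
  move=> [mz ez] [mw ew].
  have hD s : ⟨h s, z + w⟩ = ⟨h s, z⟩ + ⟨h s, w⟩ by exact: innerDr.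
  split; first by rewrite (funext hD); exact: measurable_funD.
  rewrite (funext hD) RintegralD // -?ez -?ew; first exact: innerDr.
  - exact: integrable_bounded_itv mz (hz z).
  - exact: integrable_bounded_itv mw (hz w).
have PZ a i j : (i <= j)%N -> P (a *: ebasis e i j).
  move=> ij; have [mz ez] := hcoef i j ij.
  have hZ s : ⟨h s, a *: ebasis e i j⟩ = a * ecoef (h s) i j by exact: innerZr.
  split; first by rewrite (funext hZ); apply: measurable_funM => //; exact: measurable_cst.
  rewrite (funext hZ) RintegralZl // -?ez; first exact: innerZr.
  exact: integrable_bounded_itv mz (hz _).
have Pn n z : P (cutoff n z).
  rewrite /cutoff /tri_ebasis /tri_sum; elim/big_ind : _ => // j _.
  by elim/big_ind : _ => // i _; apply: PZ; rewrite -ltnS.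
suff PP z : P z by move=> z; have [mz ez] := PP z; split=> //; exact: integrable_bounded_itv mz (hz z).
have cz := @cutoff_cvg _ _ e z.
have mz : measurable_fun `[0, t] (fun s => ⟨h s, z⟩).
  apply: (@measurable_fun_cvg _ _ _ `[0, t]%classic (fun n s => ⟨h s, cutoff n z⟩) (fun s => ⟨h s, z⟩)) => //.
    by move=> n; have [] := Pn n z.
  by move=> s _; apply: continuous_cvg => //; exact: inner_continuousr.
split=> //; apply: (@cvg_unique _ (@Rhausdorff R) ((fun n => ⟨Y, cutoff n z⟩) @ \oo)).
  by apply: continuous_cvg => //; exact: inner_continuousr.
apply: cvg_seqP => eps eps0.
have D0 : 0 < M * t + 1 by rewrite ltr_wpDl // mulr_ge0.
have [|N hN] := cvg_seq_dist cz (eps := eps / (M * t + 1)); first by rewrite divr_gt0.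
exists N => n Nn; have [mn ->] := Pn n z.
rewrite -(RintegralB _ (integrable_bounded_itv mn (hz _)) (integrable_bounded_itv mz (hz _))) //.
apply: (@le_trans _ _ (M * (eps / (M * t + 1)) * t)).
  apply: Rintegral_bounded_itv => //; first exact: measurable_funB.
  move=> s st; rewrite -innerBr (le_trans (hz _ _ st)) // ler_wpM2l // hN //.
rewrite mulrAC mulrA ler_pdivrMr // mulrC ler_wpM2l ?(ltW eps0) // lerDl //.
Qed.

End mild_equation.

Section integral_estimates.
Context {R : realType}.
Local Notation leb := (@lebesgue_measure R).

Lemma Rintegral_diff_le (t : R) (g h k : R -> R) :
  leb.-integrable `[0, t] (EFin \o g) -> leb.-integrable `[0, t] (EFin \o h) ->
  leb.-integrable `[0, t] (EFin \o k) ->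
  (forall s, s \in `[0, t] -> g s - h s <= k s) ->
  \int[leb]_(s in `[0, t]) g s - \int[leb]_(s in `[0, t]) h s <=
  \int[leb]_(s in `[0, t]) k s.
Proof.
move=> ig ih ik le; rewrite -RintegralB //; apply: le_Rintegral => //.
exact: (integrableB _ ig ih).
Qed.

(** A is fixed before eps. The errors are A eps from p - q and A eps t from the integral, whence the
    factor 1 + t. *)
Lemma Rintegral_identity_limit (t q w A : R) (g : R -> R) :
  0 <= t -> 0 <= A -> continuous g ->
  (forall eps, 0 < eps -> exists p (h : R -> R), [/\ continuous h,
    p - w = \int[leb]_(s in `[0, t]) h s, `|p - q| <= A * eps &
    forall s, s \in `[0, t] -> `|h s - g s| <= A * eps]) ->
  q - w = \int[leb]_(s in `[0, t]) g s.
Proof.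
move=> t0 A0 gc approx; apply/eqP; rewrite -subr_eq0 -normr_le0.
apply/ler_addgt0Pr => eps eps0; rewrite add0r.
have D0 : 0 < A * (1 + t) + 1 by rewrite ltr_wpDl // mulr_ge0 // addr_ge0.
have [|p [h [hc pE pq hg]]] := approx (eps / (A * (1 + t) + 1)); first by rewrite divr_gt0.
have := Rintegral_le_cst t0 (h := fun s => h s - g s) _ hg.
rewrite RintegralB //; last 2 first.
- exact: continuous_integrable.
- exact: continuous_integrable.
rewrite -pE; set I := Rintegral _ _ _; set a := A * (eps / _) in pq *.
move=> /(_ (fun s => cvgB (hc s) (gc s))) hI.
rewrite (_ : _ - _ - _ = - (p - q) + (p - w - I)); last by ring.
rewrite (le_trans (ler_normD _ _)) // normrN (le_trans (lerD pq hI)) //.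
rewrite subr0 -[X in X + _]mulr1 -mulrDr /a mulrAC mulrA ler_pdivrMr // mulrC.
by rewrite ler_wpM2l ?(ltW eps0) // lerDl.
Qed.

End integral_estimates.

(** * Passage to the limit and uniqueness of the mild solution *)

Section riccati_system.
Context {R : realType} {H : hilbertType R} {e : onb H}.
Local Notation leb := (@lebesgue_measure R).
Variables (lam : nat -> R) (Gamma : HS e -> HS e) (b : HS e)
  (m : {measure set (borel (HS e)) -> \bar R})
  (mu : set (borel (HS e)) -> HS e) (T : R) (u : HS e).
Hypotheses (lam0 : forall i, 0 <= lam i) (lamS : {homo lam : i j / (i <= j)%N >-> i <= j})
  (lam_oo : lam @ \oo --> +oo).
Hypotheses (hm : admissible_m m) (hmu : admissible_mu mu)
  (hGamma : admissible_Gamma Gamma mu).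
Hypotheses (T0 : 0 < T) (up : Hplus e u).

Local Notation Rh := (coef_R Gamma mu).
Local Notation F := (coef_F b m).

Let Rh_lipschitz := coef_R_lipschitz hmu hGamma.
Let Rh_quasi_monotone := coef_R_quasi_monotone hmu hGamma.

Lemma galerkin_curve_clamp d (psi : R -> HS e) : galerkin_curve lam Rh T d psi ->
  galerkin_curve lam Rh T d (psi \o clamp T).
Proof.
move=> g t tT; have [pp pd dp] := g t tT; rewrite /= clamp_id //; split=> //.
by apply: (@derivative_on_eq R T _ psi) dp => // s sT /=; rewrite clamp_id.
Qed.

Definition bounded_cone (r : R) : set (HS e) := [set x | Hplus e x /\ `|x| <= r].

(** The radius is common to all d since [|P_d u| <= |u|]. Invariance under the clamp extends
    estimates on [0, T] to all times. *)
Lemma galerkin_family : exists r : R, exists psi : nat -> R -> HS e, 0 <= r /\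
  forall d, [/\ galerkin_curve lam Rh T d (psi d), psi d 0 = cutoff d u,
    continuous (psi d), forall t, psi d t = psi d (clamp T t) &
    forall t, bounded_cone r (psi d t)].
Proof.
have [C C0 Rh_growth] := coef_R_growth hmu hGamma.
exists (growth_radius T C u).
have /choice[psi psiP] : forall d, exists psi, galerkin_curve lam Rh T d psi /\ psi 0 = cutoff d u.
  move=> d; have [psi g psi0] := galerkin_exists lam0 lamS T0 Rh_lipschitz Rh_quasi_monotone C0 Rh_growth d up.
  by exists psi.
exists (fun d => psi d \o clamp T); split; first exact: le_trans ler01 (growth_radius_ge1 T0 C0 u).
move=> d; have [g psi0] := psiP d.
have zT : 0 \in `[0, T] by rewrite in_itv /= lexx ltW.
split.
- exact: galerkin_curve_clamp.
- by rewrite /= clamp_id.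
- apply: continuous_clamp => //; apply: derivative_on_continuous => t tT.
  by have [_ _] := g t tT; apply.
- by move=> t /=; rewrite (clamp_id (t := clamp T t)) // clamp_itv.
- move=> t; have cT := clamp_itv T0 t; split; first by have [] := g _ cT.
  apply: (galerkin_curve_bound lam0 T0 C0 Rh_growth g) => //.
  by rewrite psi0 cutoff_le.
Qed.

Lemma bounded_cone_closed r : closed (bounded_cone r).
Proof.
apply: closedI; first exact: Hplus_closed.
apply: (@preimage_closed _ _ (fun x : HS e => `|x|) [set s | s <= r]).
  by move=> x _; exact: norm_continuous.
exact: closed_le.
Qed.

Lemma coef_R_continuous_curve r (psi : R -> HS e) : 0 <= r -> continuous psi ->
  (forall t, bounded_cone r (psi t)) -> continuous (fun t => Rh (psi t)).
Proof.
move=> r0 pc pr; have [K _ RhK] := Rh_lipschitz r0.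
apply: (@continuous_curve_comp R (HS e) (HS e) (bounded_cone r) Rh K psi) => // x y [xp xr] [yp yr].
exact: RhK.
Qed.

Lemma coef_F_continuous_curve r (psi : R -> HS e) : 0 <= r -> continuous psi ->
  (forall t, bounded_cone r (psi t)) -> continuous (fun t => F (psi t)).
Proof.
move=> r0 pc pr; have [K _ FK] := coef_F_lipschitz b hm r0.
apply: (@continuous_curve_comp R (HS e) R (bounded_cone r) F K psi) => // x y [xp xr] [yp yr].
exact: FK.
Qed.

Lemma coef_R_bounded r : 0 <= r -> exists2 M, 0 <= M & forall x, bounded_cone r x -> `|Rh x| <= M.
Proof.
move=> r0; have [K K0 RhK] := Rh_lipschitz r0.
exists (`|Rh 0| + K * r); first by rewrite addr_ge0 // mulr_ge0 // ltW.
move=> x [xp xr]; rewrite -(subrK (Rh 0) (Rh x)) addrC (le_trans (ler_normD _ _)) // lerD2l.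
rewrite (le_trans (RhK _ _ xp (@Hplus_0 _ _ e) xr _)) ?normr0 // subr0 ler_wpM2l //.
exact: ltW.
Qed.

Lemma galerkin_error_cvg0 K M eps : 0 < eps ->
  exists N, forall n, (N <= n)%N -> 0 < lam n /\ galerkin_error lam T K M n u <= eps.
Proof.
move=> eps0; set c := 2 * (1 + expR (3 * K * T)).
have c0 : 0 < c by rewrite mulr_gt0 // addr_gt0 ?expR_gt0.
set de := eps / (2 * c); have de0 : 0 < de by rewrite divr_gt0 // mulr_gt0.
(* A distance below 1 has a square below itself; likewise the next threshold takes [lam n >= 1], so
   that its square dominates it. *)
have de1 : 0 < Num.min 1 de by rewrite lt_min ltr01.
have [N1 hN1] := cvg_seq_dist (@cutoff_cvg _ _ e u) de1.
have /cvgryPge /(_ (Num.max 1 (M ^+ 2 / de))) [N2 _ hN2] := lam_oo.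
exists (maxn N1 N2) => n; rewrite geq_max => /andP[/hN1 h1 /hN2].
rewrite /= ge_max => /andP[l1 lM].
have ln0 : 0 < lam n by exact: lt_le_trans l1.
split=> //; rewrite /galerkin_error -/c.
move: h1; rewrite distrC le_min => /andP[h1 h1'].
have h2 : `|u - cutoff n u| ^+ 2 <= de.
  by rewrite (le_trans _ h1') // expr2 ler_piMl.
have h3 : M ^+ 2 / lam n ^+ 2 <= de.
  rewrite ler_pdivrMr ?exprn_gt0 // expr2 mulrA.
  move: lM; rewrite ler_pdivrMr // mulrC => lM; rewrite (le_trans lM) //.
  by rewrite ler_peMr // mulr_ge0 // ltW.
rewrite (le_trans (ler_wpM2l (ltW c0) (lerD h2 h3))) //.
by rewrite le_eqVlt; apply/orP; left; apply/eqP; rewrite /de; field; rewrite gt_eqF.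
Qed.

Lemma galerkin_limit r (psi : nat -> R -> HS e) : 0 <= r ->
  (forall d, [/\ galerkin_curve lam Rh T d (psi d), psi d 0 = cutoff d u,
    continuous (psi d), forall t, psi d t = psi d (clamp T t) &
    forall t, bounded_cone r (psi d t)]) ->
  exists psi_oo : R -> HS e, [/\ continuous psi_oo, forall t, bounded_cone r (psi_oo t) &
    forall eps, 0 < eps -> exists N, forall d, (N <= d)%N -> forall t, `|psi d t - psi_oo t| <= eps].
Proof.
move=> r0 psiP; have [K K0 RhK] := Rh_lipschitz r0; have [M M0 RhM] := coef_R_bounded r0.
have cauchy eps : 0 < eps -> exists N, forall n k, (N <= k)%N -> (k <= n)%N -> forall t, `|psi n t - psi k t| <= eps.
  move=> eps0; have [|N hN] := @galerkin_error_cvg0 K M (eps ^+ 2); first by rewrite exprn_gt0.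
  exists N => n k Nk kn t; have [lk0 err] := hN k Nk.
  have [gn n0 _ cn bn] := psiP n; have [gk k0 _ ck bk] := psiP k.
  rewrite cn ck -(ler_pXn2r (n := 2)) ?nnegrE ?(ltW eps0) // (le_trans _ err) //.
  apply: (galerkin_cauchy lam0 lamS kn lk0 M0 K0 gn gk n0 k0); last exact: clamp_itv.
    by move=> s _; exact: RhM.
  by move=> s _; have [? ?] := bn s; have [? ?] := bk s; exact: RhK.
have pcvg t : cvgn (fun d => psi d t).
  apply: cauchy_seq_cvg => eps eps0; have [N hN] := cauchy _ eps0.
  exists N => n k Nn Nk; have [kn|/ltnW nk] := leqP k n; first exact: hN.
  by rewrite distrC; exact: hN.
pose psi_oo t := limn (fun d => psi d t).
have plim eps : 0 < eps -> exists N, forall d, (N <= d)%N -> forall t, `|psi d t - psi_oo t| <= eps.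
  move=> eps0; have [N hN] := cauchy _ eps0; exists N => d Nd t.
  apply: (@cvg_le_cst _ _ \oo _ (fun n => `|psi d t - psi n t|)).
    by apply: cvg_norm; apply: cvgB; [exact: cvg_cst|exact: pcvg].
  by exists d => // n /= dn; rewrite distrC; exact: hN.
exists psi_oo; split=> //.
  apply: (@continuous_uniform_limit _ _ psi) => [n|eps eps0]; first by have [] := psiP n.
  by have [N hN] := plim _ eps0; exists N => t; exact: hN.
move=> t; apply: (closed_cvg (bounded_cone r) (@bounded_cone_closed r) _ _ (pcvg t)).
by near=> n; have [_ _ _ _] := psiP n; apply.
Unshelve. all: by end_near. Qed.

Lemma integral_F_C1 (r : R) (psi : R -> HS e) : 0 <= r -> continuous psi ->
  (forall t, bounded_cone r (psi t)) ->
  let phi t := \int[leb]_(s in `[0, t]) F (psi s) in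
  C1_on T phi /\ forall t, t \in `[0, T] -> derivative_on T phi t (F (psi t)).
Proof.
move=> r0 pc pr phi; have Fc := coef_F_continuous_curve r0 pc pr.
have dphi t : t \in `[0, T] -> derivative_on T phi t (F (psi t)).
  by move=> tT; exact: (derivative_on_integral Fc tT).
by split=> //; exists (fun t => F (psi t)) => //; exact: continuous_subspaceT.
Qed.

Lemma ecoef_galerkin_field d x i j : (i <= j < d)%N ->
  ecoef (galerkin_field lam Rh d x) i j = - lambda2 lam i j * ecoef x i j + ecoef (Rh x) i j.
Proof.
move=> /andP[ij jd]; rewrite /galerkin_field {1}/ecoef innerDl.
rewrite -!/(ecoef _ i j) ecoef_lyapunov_cutoff ?ij // ecoef_cutoff // jd.
by [].
Qed.

(** As soon as j < d, coordinate (i, j) of the Galerkin equation carries no projection error: it is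
    a scalar linear equation driven by R̂, solved exactly before d tends to infinity. *)
Lemma mild_coordinates r (psi : nat -> R -> HS e) (psi_oo : R -> HS e) : 0 <= r ->
  (forall d, [/\ galerkin_curve lam Rh T d (psi d), psi d 0 = cutoff d u,
    continuous (psi d), forall t, psi d t = psi d (clamp T t) &
    forall t, bounded_cone r (psi d t)]) ->
  continuous psi_oo -> (forall t, bounded_cone r (psi_oo t)) ->
  (forall eps, 0 < eps -> exists N, forall d, (N <= d)%N -> forall t, `|psi d t - psi_oo t| <= eps) ->
  forall i j t, (i <= j)%N -> t \in `[0, T] ->
  ecoef (psi_oo t) i j - expR (- lambda2 lam i j * t) * ecoef u i j =
  \int[leb]_(s in `[0, t]) (expR (- lambda2 lam i j * (t - s)) * ecoef (Rh (psi_oo s)) i j).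
Proof.
move=> r0 psiP pc pb plim i j t ij tT.
have [K K0 RhK] := Rh_lipschitz r0.
move: (tT); rewrite in_itv /= => /andP[t0 tT'].
set l := lambda2 lam i j; have l0 : 0 <= l by exact: lambda2_ge0.
have rc (q : R -> HS e) : continuous q -> (forall t, bounded_cone r (q t)) -> continuous (fun s => ecoef (Rh (q s)) i j).
  by move=> qc qb s; apply: inner_cvg; exact: (coef_R_continuous_curve r0 qc qb).
have ec : continuous (fun s : R => expR (- l * (t - s))).
  move=> s; apply: continuous_comp; last exact: continuous_expR.
  by apply: cvgMr; apply: cvgB; [exact: cvg_cst|exact: cvg_id].
have ec1 s : s \in `[0, t] -> 0 <= expR (- l * (t - s)) <= 1.
  rewrite in_itv /= => /andP[s0 st]; rewrite expR_ge0 /= -expR0 ler_expR mulNr oppr_le0.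
  by rewrite mulr_ge0 // subr_ge0.
have vc d : (j < d)%N -> ecoef (psi d t) i j - expR (- l * t) * ecoef u i j =
    \int[leb]_(s in `[0, t]) (expR (- l * (t - s)) * ecoef (Rh (psi d s)) i j).
  move=> jd; have [g p0 qc _ qb] := psiP d.
  rewrite -(@variation_of_constants R T l (fun s => ecoef (psi d s) i j) _ (rc _ qc qb) _ t tT).
    by rewrite p0 ecoef_cutoff // jd.
  move=> s sT; have [_ _ dp] := g s sT.
  have := @derivative_on_inner R (HS e) T _ (ebasis e i j) _ _ dp.
  by rewrite -[X in derivative_on _ _ _ X]/(ecoef _ i j) ecoef_galerkin_field ?ij.
have co := rc _ pc pb; set B := `|ebasis e i j|.
have B0 : 0 <= B by exact: normr_ge0.
(* B eps bounds the error of the coordinate and K B eps that of the integrand; the sum covers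
   both. *)
have A0 : 0 <= (1 + K) * B.
  by apply: mulr_ge0 => //; apply: addr_ge0 => //; exact: ltW.
apply: (Rintegral_identity_limit t0 A0) => [s|eps eps0]; first exact: cvgM (ec s) (co s).
have [N hN] := plim eps eps0; pose d := maxn N j.+1.
have hd s := hN d (leq_maxl _ _) s; have [g p0 qc _ qb] := psiP d.
have cd := rc _ qc qb.
have eB : 0 <= B * eps by apply: mulr_ge0 => //; exact: ltW.
exists (ecoef (psi d t) i j), (fun s => expR (- l * (t - s)) * ecoef (Rh (psi d s)) i j).
split.
- by move=> s; exact: cvgM (ec s) (cd s).
- exact: (vc d (leq_maxr _ _)).
- rewrite -innerBl (le_trans (inner_cauchy_schwarz _ _)) // (le_trans (ler_wpM2r (normr_ge0 _) (hd t))) //.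
  by rewrite mulrC -mulrA ler_peMl // lerDl ltW.
move=> s st; have /andP[e0 e1] := ec1 s st.
rewrite -mulrBr normrM (ger0_norm e0).
apply: (@le_trans _ _ (1 * `|ecoef (Rh (psi d s)) i j - ecoef (Rh (psi_oo s)) i j|)).
  exact: ler_wpM2r.
rewrite mul1r -innerBl (le_trans (inner_cauchy_schwarz _ _)) //.
have [k1 b1] := qb s; have [k2 b2] := pb s.
have h1 : `|Rh (psi d s) - Rh (psi_oo s)| <= K * eps.
  by rewrite (le_trans (RhK _ _ k1 k2 b1 b2)) // ler_wpM2l ?(ltW K0).
rewrite (le_trans (ler_wpM2r (normr_ge0 _) h1)) // -/B mulrAC -mulrA [_ * B * eps]mulrAC -mulrA.
rewrite [eps * B]mulrC mulrDl mul1r mulrCA.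
by rewrite lerDr.
Qed.

Lemma mild_exists r (psi : R -> HS e) : 0 <= r -> continuous psi ->
  (forall t, bounded_cone r (psi t)) ->
  (forall i j t, (i <= j)%N -> t \in `[0, T] ->
    ecoef (psi t) i j - expR (- lambda2 lam i j * t) * ecoef u i j =
    \int[leb]_(s in `[0, t]) (expR (- lambda2 lam i j * (t - s)) * ecoef (Rh (psi s)) i j)) ->
  mild_solution lam Gamma b m mu T u (fun t => \int[leb]_(s in `[0, t]) F (psi s)) psi.
Proof.
move=> r0 pc pb coords; have [C1phi _] := integral_F_C1 r0 pc pb.
have [M M0 RhM] := coef_R_bounded r0.
split=> //.
  by split; [exact: continuous_subspaceT|move=> t _; have [] := pb t].
move=> t tT; move: (tT); rewrite in_itv /= => /andP[t0 tT'].
have sem s : s \in `[0, t] -> 0 <= t - s by rewrite in_itv /= subr_ge0 => /andP[].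
apply: (@is_integral_coordinates _ _ _ _ t M) => //.
  move=> s st; rewrite (le_trans (semigroup_spec lam0 (Rh (psi s)) (sem s st)).2) //.
  exact: RhM.
move=> i j ij.
have hE s : s \in `[0, t] -> ecoef (semigroup lam (t - s) (Rh (psi s))) i j =
    expR (- lambda2 lam i j * (t - s)) * ecoef (Rh (psi s)) i j.
  by move=> st; rewrite (semigroup_spec lam0 _ (sem s st)).1.
have cg : continuous (fun s => expR (- lambda2 lam i j * (t - s)) * ecoef (Rh (psi s)) i j).
  move=> s; apply: cvgM; last by apply: inner_cvg; exact: (coef_R_continuous_curve r0 pc pb).
  apply: continuous_comp; last exact: continuous_expR.
  by apply: cvgMr; apply: cvgB; [exact: cvg_cst|exact: cvg_id].
split.
  have mg : measurable_fun `[0, t] (fun s => expR (- lambda2 lam i j * (t - s)) * ecoef (Rh (psi s)) i j).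
    apply: (@measurable_funS _ _ _ _ setT) => //.
    exact: continuous_measurable_fun.
  by apply: eq_measurable_fun mg => s /set_mem st; rewrite hE.
rewrite (@eq_Rintegral _ _ _ leb _ (fun s => expR (- lambda2 lam i j * (t - s)) * ecoef (Rh (psi s)) i j)).
  by rewrite -coords // ecoefB (semigroup_spec lam0 _ t0).1.
by move=> s /set_mem st; rewrite hE.
Qed.

(** The mild equation gives no derivative of psi, so Gronwall is applied to the primitive y of the
    distance, which satisfies y' <= K y. The radius r depends on the two solutions. *)
Lemma mild_unique phi1 psi1 phi2 psi2 :
  mild_solution lam Gamma b m mu T u phi1 psi1 ->
  mild_solution lam Gamma b m mu T u phi2 psi2 ->
  forall t, t \in `[0, T] -> phi1 t = phi2 t /\ psi1 t = psi2 t.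
Proof.
move=> [_ [c1 k1] i1 f1] [_ [c2 k2] i2 f2].
suff pE : forall t, t \in `[0, T] -> psi1 t = psi2 t.
  move=> t tT; split; last exact: pE.
  rewrite (f1 t tT) (f2 t tT); apply: eq_Rintegral => s /set_mem /=; rewrite in_itv /= => /andP[s0 st].
  rewrite pE // in_itv /= s0 (le_trans st) //.
  by move: tT; rewrite in_itv /= => /andP[].
have [r1 r10 b1] := continuous_bounded T0 c1.
have [r2 r20 b2] := continuous_bounded T0 c2.
pose r := r1 + r2; have r0 : 0 <= r by rewrite addr_ge0.
have [K K0 RhK] := Rh_lipschitz r0.
pose de s := `|psi1 (clamp T s) - psi2 (clamp T s)|.
have dec : continuous de.
  by move=> s; apply: cvg_norm; apply: cvgB; [exact: (continuous_clamp T0 c1)|exact: (continuous_clamp T0 c2)].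
pose y s := \int[leb]_(r in `[0, s]) de r.
have deK t : t \in `[0, T] -> de t <= K * y t.
  move=> tT; move: (tT); rewrite in_itv /= => /andP[t0 tT'].
  rewrite /de clamp_id //; apply: norm_le_inner.
    by rewrite mulr_ge0 ?(ltW K0) //; apply: Rintegral_ge0 => s _; exact: normr_ge0.
  suff key z : ⟨psi1 t - psi2 t, z⟩ <= K * y t * `|z| by exact: key.
  have -> : psi1 t - psi2 t = (psi1 t - semigroup lam t u) - (psi2 t - semigroup lam t u).
    by rewrite opprB addrA subrK.
  have [j1 e1] := i1 t tT z; have [j2 e2] := i2 t tT z.
  have ide : leb.-integrable `[0, t] (EFin \o (fun s => K * `|z| * de s)).
    by apply: (@continuous_integrable _ (fun s => K * `|z| * de s)) => s; apply: cvgMr; exact: dec.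
  rewrite innerBl e1 e2 mulrAC /y -RintegralZl //; last exact: continuous_integrable.
  apply: (Rintegral_diff_le j1 j2 ide).
  move=> s; rewrite in_itv /= => /andP[s0 st].
  have sT : s \in `[0, T] by rewrite in_itv /= s0 (le_trans st).
  have ts : 0 <= t - s by rewrite subr_ge0.
  rewrite -innerBl -semigroupB // (le_trans (inner_le_norm _ _)) // mulrAC ler_wpM2r //.
  rewrite (le_trans (semigroup_spec lam0 _ ts).2) // /de clamp_id //.
  apply: RhK; [exact: k1|exact: k2| |].
    by rewrite (le_trans (b1 s sT)) // lerDl.
  by rewrite (le_trans (b2 s sT)) // lerDr.
move=> t tT.
have y0 : y t <= 0.
  apply: (@gronwall0 _ T K y de K0) => //.
    by move=> s sT; exact: derivative_on_integral.
  by rewrite /y set_itv1 Rintegral_set1.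
apply/eqP; rewrite -subr_eq0 -normr_le0.
have := deK t tT; rewrite /de clamp_id // => /le_trans; apply.
by rewrite pmulr_rle0.
Qed.

Lemma galerkin_solution_curve d phi psi :
  galerkin_solution lam Gamma b m mu d T u phi psi ->
  galerkin_curve lam Rh T d psi /\ psi 0 = cutoff d u.
Proof.
move=> [_ [_ pK] _ dpsi [_ psi0]]; rewrite psi0 projHE; split=> // t tT.
have [pH pp] := pK t tT; split=> //; first exact: calH_cutoff.
by have := dpsi t tT; rewrite (lyapunov_calH lam pH) projHE.
Qed.

Lemma galerkin_solution_unique d phi1 psi1 phi2 psi2 :
  galerkin_solution lam Gamma b m mu d T u phi1 psi1 ->
  galerkin_solution lam Gamma b m mu d T u phi2 psi2 ->
  forall t, t \in `[0, T] -> phi1 t = phi2 t /\ psi1 t = psi2 t.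
Proof.
move=> s1 s2; have [g1 p1] := galerkin_solution_curve s1.
have [g2 p2] := galerkin_solution_curve s2.
have [C C0 Rh_growth] := coef_R_growth hmu hGamma.
have pE t : t \in `[0, T] -> psi1 t = psi2 t.
  by apply: (galerkin_unique lam0 T0 Rh_lipschitz C0 Rh_growth g1 g2); rewrite p1 p2.
move=> t tT; split; last exact: pE.
case: s1 => _ _ d1 _ [z1 _]; case: s2 => _ _ d2 _ [z2 _].
apply/eqP; rewrite -subr_eq0.
rewrite (@derivative0_cst _ T (fun t => phi1 t - phi2 t)) ?z1 ?z2 ?subrr //.
move=> s sT; have := derivative_onB (d1 s sT) (d2 s sT).
by rewrite pE // subrr.
Qed.

Lemma galerkin_solution_exists r d psi : 0 <= r ->
  galerkin_curve lam Rh T d psi -> psi 0 = cutoff d u -> continuous psi ->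
  (forall t, bounded_cone r (psi t)) ->
  galerkin_solution lam Gamma b m mu d T u (fun t => \int[leb]_(s in `[0, t]) F (psi s)) psi.
Proof.
move=> r0 g psi0 pc pb; have [C1phi dphi] := integral_F_C1 r0 pc pb.
have pH t : t \in `[0, T] -> calH e d (psi t).
  by move=> tT; have [_ <- _] := g t tT; exact: cutoff_calH.
split=> //.
- split; last by move=> t tT; split; [exact: pH|have [] := g t tT].
  exists (fun t => galerkin_field lam Rh d (psi t)); last by move=> t /g[].
  apply: continuous_subspaceT => t; apply: cvgD.
    have cl : continuous (lyapunov_cutoff lam d : HS e -> HS e).
      apply: (lipschitz_continuous (K := 2 * lam d)); first by rewrite mulr_ge0.
      by move=> x y; rewrite -lyapunov_cutoffB lyapunov_cutoff_le.
    by apply: continuous_cvg; [exact: cl|exact: pc].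
  have cc : continuous (cutoff d : HS e -> HS e).
    by apply: (lipschitz_continuous ler01) => x y; rewrite mul1r -cutoffB cutoff_le.
  by apply: continuous_cvg; [exact: cc|exact: (coef_R_continuous_curve r0 pc pb)].
- move=> t tT; rewrite (lyapunov_calH lam (pH t tT)) projHE.
  by have [_ _] := g t tT.
- by rewrite psi0 projHE set_itv1 Rintegral_set1.
Qed.

Lemma riccati_convergence : exists (phi_d : nat -> R -> R) (psi_d : nat -> R -> HS e),
    (forall d : nat, unique_solution_on T
       (galerkin_solution lam Gamma b m mu d T u) (phi_d d) (psi_d d)) /\
    exists (phi : R -> R) (psi : R -> HS e),
      unique_solution_on T (mild_solution lam Gamma b m mu T u) phi psi /\
      (fun d => ereal_sup [set (`|phi_d d t - phi t| + `|psi_d d t - psi t|)%:E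
                          | t in `[0, T]]) @ \oo --> 0%E.
Proof.
have [r [psi_d [r0 psiP]]] := galerkin_family.
have [psi [pc pb plim]] := galerkin_limit r0 psiP.
exists (fun d t => \int[leb]_(s in `[0, t]) F (psi_d d s)), psi_d; split.
  move=> d; have [g p0 qc _ qb] := psiP d.
  have sol := galerkin_solution_exists r0 g p0 qc qb.
  by split=> // phi' psi' sol' t tT; exact: galerkin_solution_unique sol' sol t tT.
exists (fun t => \int[leb]_(s in `[0, t]) F (psi s)), psi; split.
  have sol := mild_exists r0 pc pb (mild_coordinates r0 psiP pc pb plim).
  by split=> // phi' psi' sol' t tT; exact: mild_unique sol' sol t tT.
have [K K0 FK] := coef_F_lipschitz b hm r0.
(* K T comes from integrating the Lipschitz bound of F, and 1 from the error of psi itself. *)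
set D := K * T + 1; have D0 : 0 < D by rewrite ltr_wpDl // mulr_ge0 // ltW.
have bound eps : 0 < eps -> exists N, forall d, (N <= d)%N -> forall t, t \in `[0, T] ->
    `|\int[leb]_(s in `[0, t]) F (psi_d d s) - \int[leb]_(s in `[0, t]) F (psi s)| +
    `|psi_d d t - psi t| <= eps.
  move=> eps0; have [|N hN] := plim (eps / D); first by rewrite divr_gt0.
  exists N => d Nd t tT; move: (tT); rewrite in_itv /= => /andP[t0 tT'].
  have [_ _ qc _ qb] := psiP d.
  have cd := coef_F_continuous_curve r0 qc qb; have co := coef_F_continuous_curve r0 pc pb.
  rewrite -(RintegralB _ (continuous_integrable 0 t cd) (continuous_integrable 0 t co)) //.
  have h1 : `|\int[leb]_(s in `[0, t]) (F (psi_d d s) - F (psi s))| <= K * (eps / D) * (t - 0).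
    apply: Rintegral_le_cst => //; first by move=> s; apply: cvgB; [exact: cd|exact: co].
    move=> s _; have [k1 b1] := qb s; have [k2 b2] := pb s.
    by rewrite (le_trans (FK _ _ k1 k2 b1 b2)) // ler_wpM2l // hN.
  rewrite (le_trans (lerD h1 (hN d Nd t))) // subr0.
  rewrite (_ : _ + _ = eps / D * (K * t + 1)); last by ring.
  by rewrite mulrAC ler_pdivrMr // ler_wpM2l ?(ltW eps0) // /D lerD2r ler_wpM2l.
set S := (X in X @ _ --> _).
(* The point t = 0 shows that the supremum is over a nonempty set; it would otherwise be minus
   infinity. *)
have S0 d : (0 <= S d)%E.
  apply: (@le_trans _ _ ((`|\int[leb]_(s in `[0, 0]) F (psi_d d s) - \int[leb]_(s in `[0, 0]) F (psi s)| +
    `|psi_d d 0 - psi 0|)%:E)); first by rewrite lee_fin addr_ge0.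
  by apply: ereal_sup_ubound; exists 0 => //=; rewrite in_itv /= lexx ltW.
have Sle eps : 0 < eps -> exists N, forall d, (N <= d)%N -> (S d <= eps%:E)%E.
  move=> eps0; have [N hN] := bound _ eps0; exists N => d Nd.
  by apply: ge_ereal_sup => _ [t tT <-]; rewrite lee_fin; exact: hN.
have [N1 hN1] := Sle 1 ltr01.
have Sfin d : (N1 <= d)%N -> S d \is a fin_num.
  by move=> /hN1 S1; rewrite ge0_fin_numE // (le_lt_trans S1) // ltry.
apply/fine_cvgP; split; first by exists N1 => // d /= /Sfin.
apply: cvg_seqP => eps eps0; have [N hN] := Sle _ eps0.
exists (maxn N N1) => d; rewrite geq_max => /andP[Nd N1d].
by rewrite subr0 ger0_norm ?fine_ge0 // -lee_fin fineK ?Sfin // hN.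
Qed.

End riccati_system.

Theorem proposition2p8 (R : realType) (H V : hilbertType R) (iota : V -> H)
  (f : onb V) (e : onb H) (lam : nat -> R)
  (domB : set H) (B : H -> H) (B' : V -> V -> R) (Gamma : HS e -> HS e)
  (b : HS e) (bB : HS e -> HS e -> R)
  (m : {measure set (borel (HS e)) -> \bar R})
  (mu : set (borel (HS e)) -> HS e) :
  admissible iota f lam domB B B' Gamma b bB m mu ->
  forall (T : R) (u : HS e), 0 < T -> Hplus e u ->
  exists (phi_d : nat -> R -> R) (psi_d : nat -> R -> HS e),
    (forall d : nat, unique_solution_on T
       (galerkin_solution lam Gamma b m mu d T u) (phi_d d) (psi_d d)) /\
    exists (phi : R -> R) (psi : R -> HS e),
      unique_solution_on T (mild_solution lam Gamma b m mu T u) phi psi /\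
      (fun d => ereal_sup [set (`|phi_d d t - phi t| + `|psi_d d t - psi t|)%:E
                          | t in `[0, T]]) @ \oo --> 0%E.
Proof.
move=> [_ hm _ hmu [_ _ [_ _ _ [_ lam00 lamS lam_oo] _] hGamma _]] T u T0 up.
apply: riccati_convergence => // i.
exact: le_trans lam00 (lamS _ _ (leq0n i)).
Qed.
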